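(* Let $T\in(0,\infty)$, $d,m\in\mathbb N$, let $(\Omega,\mathcal F,\mathbb P)$ be a probability space with a normal filtration $(\mathcal F_t)_{t\in[0,T]}$, let $W\colon[0,T]\times\Omega\to\mathbb R^m$ be an $m$-dimensional standard $(\mathcal F_t)_{t\in[0,T]}$-Brownian motion with continuous sample paths, let $\mu\colon\mathbb R^d\to\mathbb R^d$ and $\sigma\colon\mathbb R^d\to\mathbb R^{d\times m}$ be globally Lipschitz continuous functions, let $X\colon[0,T]\times\Omega\to\mathbb R^d$ be an $(\mathcal F_t)_{t\in[0,T]}$-adapted stochastic process with continuous sample paths which satisfies $\forall\,p\in[1,\infty)\colon\mathbb E[\|X_0\|^p_{\mathbb R^d}]<\infty$ and which satisfies for all $t\in[0,T]$ that $\mathbb P$-a.s. $$X_t=X_0+\int_0^t\mu(X_s)\,ds+\int_0^t\sigma(X_s)\,dW_s,$$ and let $Y^N\colon[0,T]\times\Omega\to\mathbb R^d$, $N\in\mathbb N$, be mappings which satisfy for all $N\in\mathbb N$, $n\in\{0,1,\dots,N-1\}$, $t\in[\frac{nT}N,\frac{(n+1)T}N]$ that $Y^N_0=X_0$ and $$Y^N_t=Y^N_{\frac{nT}N}+\bigl(t-\tfrac{nT}N\bigr)\,\mu\bigl(Y^N_{\frac{nT}N}\bigr)+\bigl(\tfrac{tN}T-n\bigr)\,\sigma\bigl(Y^N_{\frac{nT}N}\bigr)\bigl(W_{\frac{(n+1)T}N}-W_{\frac{nT}N}\bigr).$$ Then for all $\alpha\in[0,\frac12)$, $\varepsilon\in(0,\infty)$,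 $p\in[1,\infty)$ it holds that $$\sup_{N\in\mathbb N}\Bigl[N^{\frac12-\alpha-\varepsilon}\Bigl(\mathbb E\bigl[\|X-Y^N\|^p_{\mathcal C^\alpha([0,T],\|\cdot\|_{\mathbb R^d})}\bigr]\Bigr)^{1/p}\Bigr]<\infty.$$
   Context: $\mathbb N=\{1,2,\dots\}$. A normal filtration is a right-continuous filtration such that $\mathcal F_0$ contains all $\mathbb P$-null sets of $\mathcal F$. For $f\colon[0,T]\to\mathbb R^d$ and $r\in[0,1]$, $\|f\|_{\mathcal C^r([0,T],\|\cdot\|_{\mathbb R^d})}=\sup_{t\in[0,T]}\|f(t)\|_{\mathbb R^d}+\sup_{s,t\in[0,T],\,s\ne t}\frac{\|f(t)-f(s)\|_{\mathbb R^d}}{|t-s|^r}\in[0,\infty]$ (applied to each sample path of $X-Y^N$). *)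

(* Defs.v *)
From HB Require Import structures.
From mathcomp Require Import all_boot all_order all_algebra.
From mathcomp Require Import all_classical all_reals all_analysis.
From mathcomp Require Import measurable_realfun.
Set Implicit Arguments.
Unset Strict Implicit.
Unset Printing Implicit Defensive.
Import Order.TTheory GRing.Theory Num.Theory.
Import numFieldNormedType.Exports.
Local Open Scope classical_set_scope.
Local Open Scope ring_scope.

(* Stochastic processes indexed by [0, T] are functions on all of R; no
   definition below looks at their values outside [0, T].
   R^d is 'cV[R]_d and R^(d x m) is 'M[R]_(d, m). *)

(* The library norm on matrices is the max norm; this is the Euclidean norm on
   column vectors and the Hilbert-Schmidt (Frobenius) norm on matrices. *)
Definition enorm (R : realType) (m n : nat) (A : 'M[R]_(m, n)) : R :=
  Num.sqrt (\sum_(i < m) \sum_(j < n) A i j ^+ 2).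

Definition globally_lipschitz (R : realType) (d m n : nat)
    (f : 'cV[R]_d -> 'M[R]_(m, n)) : Prop :=
  exists L : R, forall x y, enorm (f x - f y) <= L * enorm (x - y).

(* No sigma-algebra on matrices is declared in the library. *)
Definition borel_mx (R : realType) (m n : nat) : set (set 'M[R]_(m, n)) :=
  <<s [set U : set 'M[R]_(m, n) | open U] >>.

Definition borel_measurable_wrt (R : realType) (Omega : Type)
    (G : set (set Omega)) (m n : nat) (X : Omega -> 'M[R]_(m, n)) : Prop :=
  forall B, borel_mx B -> G (X @^-1` B).

Definition holder_norm (R : realType) (d : nat) (T r : R) (f : R -> 'cV[R]_d)
    : \bar R :=
  (ereal_sup [set (enorm (f t))%:E | t in `[0%R, T]] +
   ereal_sup [set (enorm (f st.2 - f st.1) / `|st.2 - st.1| `^ r)%:E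
             | st in [set st : R * R | [/\ st.1 \in `[0%R, T],
                                            st.2 \in `[0%R, T] & st.1 != st.2]]])%E.

Section stochastic_calculus.
Context {disp : measure_display} {Omega : measurableType disp} {R : realType}.
Variables (P : probability Omega R) (T : R).
Implicit Types F : R -> set (set Omega).

Definition is_filtration F : Prop :=
  [/\ forall t : R, t \in `[0, T] -> sigma_algebra setT (F t),
      forall t : R, t \in `[0, T] -> F t `<=` measurable
    & forall s t : R, 0 <= s -> s <= t -> t <= T -> F s `<=` F t].

Definition normal_filtration F : Prop :=
  [/\ is_filtration F,
      forall t : R, t \in `[0, T[ -> \bigcap_(s in `]t, T]) F s = F t
    & forall A, measurable A -> P A = 0%E -> F 0 A].

Definition adapted F (m n : nat) (X : R -> Omega -> 'M[R]_(m, n)) : Prop :=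
  forall t : R, t \in `[0, T] -> borel_measurable_wrt (F t) (X t).

Definition continuous_paths (m n : nat) (X : R -> Omega -> 'M[R]_(m, n)) : Prop :=
  forall w, {within `[0, T], continuous (fun t => X t w)}.

(* The last clause is the law N(0, (t - s) I_m), given on measurable boxes;
   the second parameter of normal_prob is the standard deviation. *)
Definition standard_brownian_motion F (m : nat) (W : R -> Omega -> 'cV[R]_m)
    : Prop :=
  [/\ adapted F W,
      {ae P, forall w, W 0 w = 0},
      forall s t : R, 0 <= s -> s < t -> t <= T ->
        forall A B, F s A -> borel_mx B ->
          P (A `&` [set w | B (W t w - W s w)]) =
          (P A * P [set w | B (W t w - W s w)%R])%E
    & forall s t : R, 0 <= s -> s < t -> t <= T ->
        forall B : 'I_m -> set R, (forall i, measurable (B i)) ->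
          P [set w | forall i, B i ((W t w - W s w) i 0)] =
          (\prod_(i < m) normal_prob 0 (Num.sqrt (t - s)) (B i))%E].

(* Convergence to 0 in probability of [0, +oo]-valued random variables. *)
Definition cvg0_in_probability (Z : nat -> Omega -> \bar R) : Prop :=
  (forall k, measurable_fun setT (Z k)) /\
  forall e : R, 0 < e -> P [set w | (e%:E <= Z k w)%E] @[k --> \oo] --> 0%E.

(* The elementary process sum_(i < es_size) es_val i 1_(es_node i, es_node i.+1]
   with values in R^(d x m). *)
Record elementary (d m : nat) := Elementary {
  es_size : nat;
  es_node : nat -> R;
  es_val : nat -> Omega -> 'M[R]_(d, m) }.

Definition elementary_wf F (t : R) (d m : nat) (S : elementary d m) : Prop :=
  [/\ forall i, (i <= es_size S)%N -> es_node S i \in `[0, t],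
      forall i, (i < es_size S)%N -> es_node S i <= es_node S i.+1,
      forall i, (i < es_size S)%N ->
        borel_measurable_wrt (F (es_node S i)) (es_val S i)
    & forall i, (i < es_size S)%N ->
        exists C : R, forall w, enorm (es_val S i w) <= C].

Definition elementary_process (d m : nat) (S : elementary d m) (s : R)
    (w : Omega) : 'M[R]_(d, m) :=
  \sum_(i < es_size S)
    \1_(`]es_node S i, es_node S i.+1] : set R) s *: es_val S i w.

Definition elementary_integral (d m : nat) (W : R -> Omega -> 'cV[R]_m)
    (S : elementary d m) (w : Omega) : 'cV[R]_d :=
  \sum_(i < es_size S)
    es_val S i w *m (W (es_node S i.+1) w - W (es_node S i) w).

(* I is (a version of) the Ito integral of H over [0, t] with respect to W: the
   limit in probability of the integrals of elementary processes that converge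
   to H in L^2([0, t]) in probability.  Meant for adapted H with continuous
   paths (more generally, progressively measurable H with almost surely
   square-integrable paths): the approximating sequence then exists and the
   limit does not depend on it, up to almost sure equality. *)
Definition is_ito_integral F (d m : nat) (W : R -> Omega -> 'cV[R]_m) (t : R)
    (H : R -> Omega -> 'M[R]_(d, m)) (I : Omega -> 'cV[R]_d) : Prop :=
  borel_measurable_wrt measurable I /\
  exists S : nat -> elementary d m,
    [/\ forall k, elementary_wf F t (S k),
        cvg0_in_probability (fun k w =>
          (\int[lebesgue_measure]_(s in `[0%R, t])
            (enorm (elementary_process (S k) s w - H s w)%R ^+ 2)%:E)%E)
      & cvg0_in_probability (fun k w =>
          (enorm (elementary_integral W (S k) w - I w))%:E)].

Definition solves_sde F (d m : nat) (W : R -> Omega -> 'cV[R]_m)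
    (mu : 'cV[R]_d -> 'cV[R]_d) (sigma : 'cV[R]_d -> 'M[R]_(d, m))
    (X : R -> Omega -> 'cV[R]_d) : Prop :=
  forall t : R, t \in `[0, T] ->
    exists2 I : Omega -> 'cV[R]_d,
      is_ito_integral F W t (fun s w => sigma (X s w)) I
    & {ae P, forall w, X t w = X 0 w +
        \col_(i < d) (\int[lebesgue_measure]_(s in `[0, t]) mu (X s w) i 0)%R
        + I w}.

End stochastic_calculus.

(* Main.v *)
(* Fix an even exponent 2q.  Running the Euler scheme with N steps along the
   increments of the scheme with NM steps, a discrete Gronwall argument bounds
   their difference at the nodes by C N^(-1/2) in L^(2q), uniformly in M.
   At the nodes the Euler schemes converge to X in probability: the
   sum obtained by putting X itself in the coefficients is close to X, by a
   Lenglart inequality for elementary integrals and the continuity of X, and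
   the Euler scheme is close to that sum by Gronwall up to the first time this
   fails.  By Fatou, X inherits the moment bounds of the schemes: its increments
   over a time h are O(h^(1/2)) and its distance to the N-step scheme at the
   nodes is O(N^(-1/2)) in L^(2q).
   Between two nodes Y^N is affine, and chaining over the dyadic refinements of
   the grid shows that X is Hoelder continuous with exponent 1/2 - 1/q.  Hence the
   C^alpha norm of X - Y^N is at most N^alpha times a random variable whose
   moment of order 2q is O(N^(1-q)), and N^(1/(2q)) is absorbed by N^eps. *)

Require Import Defs.
From HB Require Import structures.
From mathcomp Require Import all_boot all_order all_algebra.
From mathcomp Require Import all_classical all_reals all_analysis.
From mathcomp Require Import measurable_realfun.
From mathcomp Require Import ring lra.
Set Implicit Arguments.
Unset Strict Implicit.
Unset Printing Implicit Defensive.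
Import Order.TTheory GRing.Theory Num.Theory.
Import numFieldNormedType.Exports.
Local Open Scope classical_set_scope.
Local Open Scope ring_scope.

(** * Gaussian moments *)

(** The Ito integral is only a limit in probability, so nothing is known beforehand about the
    moments of [X] at positive times. All moment estimates are made on schemes, where expectations
    can be taken one step at a time. The one-step estimate does the work of the Ito formula and of
    the Burkholder-Davis-Gundy inequality: in the binomial expansion of an even power the term
    linear in the Brownian increment has mean zero, as its coefficient is known before the
    increment, and all other terms are of the order of the step. The comparison with [X] is stopped
    for the same reason: while it runs, [X] is pathwise close to the Euler sum along [X], so second
    moments exist. The Hoelder norm is a supremum over uncountably many times and is not shown to be
    measurable; its integral is bounded through a measurable majorant. This majorant is a weighted
    series of 2q-th powers of increments over all cells of all dyadic levels: a sum dominates each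
    of its terms, and its expectation is found termwise. Level n has N 2^n cells; this count costs
    the factor N and, with a further 2^-n for summability, lowers the exponent 1/2 to 1/2 - 1/q. *)

Section density.
Import HBNNSimple.
Context d (E : measurableType d) (R : realType).
Variables (mu nu : {measure set E -> \bar R}) (g : E -> R).
Hypotheses (mg : measurable_fun setT g) (g0 : forall x, 0 <= g x).
Hypothesis nuE : forall A, measurable A -> nu A = (\int[mu]_(x in A) (g x)%:E)%E.

(** [nu] is only known on sets, so the formula is checked on simple functions below [f], level set
    by level set, and passes to the limit by monotone convergence on both sides. *)
Lemma ge0_integral_density (f : E -> \bar R) :
  measurable_fun setT f -> (forall x, (0 <= f x)%E) ->
  (\int[nu]_x f x = \int[mu]_x (f x * (g x)%:E))%E.
Proof.
move=> mf f0.
have mgE : measurable_fun setT (EFin \o g) by exact/measurable_EFinP.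
pose h := nnsfun_approx measurableT mf.
have fh x : (fun n => (h n x)%:E) @ \oo --> f x.
  exact: cvg_nnsfun_approx.
have -> : (\int[nu]_x f x = limn (fun n => \int[nu]_x (h n x)%:E))%E.
  rewrite -monotone_convergence//.
  - by apply: eq_integral => x _; apply/esym/cvg_lim.
  - by move=> n; apply/measurable_EFinP.
  - by move=> n x _; rewrite lee_fin.
  - by move=> x _ a b ab; rewrite lee_fin; exact/lefP/nd_nnsfun_approx.
have -> : (\int[mu]_x (f x * (g x)%:E) =
           limn (fun n => \int[mu]_x ((h n x)%:E * (g x)%:E)))%E.
  rewrite -monotone_convergence//.
  - by apply: eq_integral => x _; apply/esym/cvg_lim => //; apply: cvgeZr.
  - by move=> n; apply: emeasurable_funM => //; apply/measurable_EFinP.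
  - by move=> n x _; rewrite mule_ge0// lee_fin.
  - move=> x _ a b ab; rewrite lee_wpmul2r ?lee_fin//.
    exact/lefP/nd_nnsfun_approx.
congr (limn _); apply/funext => n.
have indic_ge0 (y : R) x : (0 <= (y * \1_(h n @^-1` [set y]) x)%:E)%E.
  by rewrite nnfun_muleindic_ge0.
have mind (r : R) :
    measurable_fun setT (fun x => (r * \1_(h n @^-1` [set r]) x)%:E).
  by apply/measurable_EFinP; exact: measurable_funM.
transitivity (\int[nu]_x
    (\sum_(y \in range (h n)) (y * \1_(h n @^-1` [set y]) x)%:E))%E.
  by apply: eq_integral => x _; rewrite /= fimfunE -fsumEFin.
rewrite ge0_integral_fsum//.
transitivity (\int[mu]_x (\sum_(y \in range (h n))
    (y * \1_(h n @^-1` [set y]) x)%:E * (g x)%:E))%E; last first.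
  apply: eq_integral => x _.
  rewrite -ge0_mule_fsuml => [|y]; last exact: indic_ge0.
  by rewrite fsumEFin // -(fimfunE _ x).
rewrite ge0_integral_fsum//; first last.
- by move=> y x _; rewrite mule_ge0// lee_fin.
- by move=> y; apply: emeasurable_funM.
apply: eq_fsbigr => r rhn.
under eq_integral do rewrite EFinM.
rewrite integralZl_indic_nnsfun// integral_indic// setIT nuE//.
under [RHS]eq_integral do rewrite EFinM -muleA.
rewrite ge0_integralZl//.
- rewrite [in LHS]integral_mkcond; congr (_ * _)%E; apply: eq_integral => x _.
  by rewrite epatch_indic muleC.
- by apply: emeasurable_funM => //; apply/measurable_EFinP.
- by move=> x _; rewrite mule_ge0// lee_fin.
- by have := rhn; rewrite inE => -[x _ <-]; rewrite lee_fin.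
Qed.

End density.

Section normal_moments.
Context {R : realType}.
Local Notation mu := (@lebesgue_measure R).

Lemma ge0_integral_normal (s : R) (f : R -> \bar R) :
  measurable_fun setT f -> (forall x, (0 <= f x)%E) ->
  (\int[normal_prob 0 s]_x f x = \int[mu]_x (f x * (normal_pdf 0 s x)%:E))%E.
Proof.
move=> mf f0; apply: ge0_integral_density => //.
- exact: measurable_normal_pdf.
- by move=> x; exact: normal_pdf_ge0.
Qed.

Lemma lebesgue_integral_opp (f : R -> \bar R) :
  measurable_fun setT f -> (forall x, (0 <= f x)%E) ->
  (\int[mu]_x f (- x)%R = \int[mu]_x f x)%E.
Proof.
move=> mf f0.
have mN : measurable_fun setT (-%R : measurableTypeR R -> measurableTypeR R).
  exact: oppr_measurable.
rewrite -[LHS](@ge0_integral_pushforward _ _ _ _ _ _ mN mu setT f)//.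
apply: (@eq_measure_integral _ _ _ setT mu) => A mA _.
exact: lebesgue_measureN.
Qed.

(** The centred Gaussian density is even. Centering of the Brownian increments is derived from this
    symmetry. *)
Lemma normal_prob_opp (s : R) (f : R -> \bar R) : s != 0 ->
  measurable_fun setT f -> (forall x, (0 <= f x)%E) ->
  (\int[normal_prob 0 s]_x f (- x)%R = \int[normal_prob 0 s]_x f x)%E.
Proof.
move=> s0 mf f0; rewrite !ge0_integral_normal//; last first.
  exact: measurableT_comp mf _.
transitivity (\int[mu]_x (f (- x)%R * (normal_pdf 0 s (- x))%:E))%E.
  apply: eq_integral => x _; congr (_ * _%:E)%E.
  by rewrite !normal_pdfE// /normal_fun !subr0 sqrrN.
apply: (lebesgue_integral_opp (f := fun x => (f x * (normal_pdf 0 s x)%:E)%E)).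
- apply: emeasurable_funM; first exact: mf.
  by apply/measurable_EFinP; exact: measurable_normal_pdf.
- by move=> x; rewrite mule_ge0// lee_fin normal_pdf_ge0.
Qed.

(** Up to the factor [q!], the left-hand side is one term of the exponential series, whose terms are
    all nonnegative. *)
Lemma expRge_pow (x : R) (q : nat) : 0 <= x -> x ^+ q <= q`!%:R * expR x.
Proof.
move=> x0; rewrite -ler_pdivrMl ?ltr0n ?fact_gt0// mulrC.
rewrite /expR; apply: le_trans (nondecreasing_cvgn_le _ _ q.+1) => //.
- rewrite /pseries/= seriesEnat/= big_nat_recr//= lerDr.
  by apply: sumr_ge0 => i _; rewrite /exp_coeff divr_ge0 ?exprn_ge0.
- apply: nondecreasing_series => i _ _.
  by rewrite /exp_coeff divr_ge0 ?exprn_ge0.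
- exact: is_cvg_series_exp_coeff.
Qed.

(* [x^2q exp(-x^2/2s^2) <= q! (4s^2)^q exp(-x^2/4s^2)], and the right-hand
   side is a Gaussian density of variance [2s^2] up to a constant. *)
Lemma normal_pdf_moment_le (s x : R) (q : nat) : 0 < s ->
  x ^+ (2 * q) * normal_pdf 0 s x <=
  Num.sqrt 2 * q`!%:R * 4 ^+ q * s ^+ (2 * q) *
  normal_pdf 0 (Num.sqrt 2 * s) x.
Proof.
move=> s0.
have s20 : Num.sqrt 2 * s != 0 by rewrite mulf_neq0 ?gt_eqF// sqrtr_gt0.
rewrite (normal_pdfE 0 s20) normal_pdfE ?gt_eqF//.
rewrite /normal_peak /normal_fun !subr0.
have sqs : (Num.sqrt 2 * s) ^+ 2 = 2 * s ^+ 2 by rewrite exprMn sqr_sqrtr.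
rewrite sqs.
have -> : Num.sqrt (2 * s ^+ 2 * pi *+ 2) = Num.sqrt 2 * Num.sqrt (s ^+ 2 * pi *+ 2).
    by move: (pi : R) => z; rewrite -sqrtrM// mulrnAr [2 * (_ * z)]mulrA.
set y := x ^+ 2 / (4 * s ^+ 2).
have y0 : 0 <= y.
  apply: divr_ge0; first exact: sqr_ge0.
  by apply: mulr_ge0 => //; exact: sqr_ge0.
have -> : - x ^+ 2 / (s ^+ 2 *+ 2) = - y + - y.
  by rewrite /y -mulr_natr; field; rewrite gt_eqF.
have -> : - x ^+ 2 / (2 * s ^+ 2 *+ 2) = - y.
  by rewrite /y -mulr_natr; field; rewrite gt_eqF.
rewrite expRD.
have -> : x ^+ (2 * q) = y ^+ q * (4 ^+ q * s ^+ (2 * q)).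
  rewrite !exprM -!exprMn; congr (_ ^+ _); rewrite /y.
  by field; rewrite gt_eqF.
set p := Num.sqrt (s ^+ 2 * pi *+ 2).
have p0 : 0 < p by rewrite sqrtr_gt0 pmulrn_lgt0// mulr_gt0 ?pi_gt0 ?exprn_gt0.
have r2 : 0 < Num.sqrt (2 : R) by rewrite sqrtr_gt0.
set c := (X in X * ((_ * p)^-1 * _)).
have -> : c * ((Num.sqrt 2 * p)^-1 * expR (- y)) =
  (q`!%:R * expR y) * (expR (- y)) * (4 ^+ q * s ^+ (2 * q)) * (p^-1 * (expR (- y))).
  have -> : q`!%:R * expR y * expR (- y) = q`!%:R.
    by rewrite -mulrA -expRD subrr expR0 mulr1.
  by rewrite /c; field; rewrite !gt_eqF.
have -> : y ^+ q * (4 ^+ q * s ^+ (2 * q)) * (p^-1 * (expR (- y) * expR (- y)))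
  = (y ^+ q) * (expR (- y)) * (4 ^+ q * s ^+ (2 * q)) * (p^-1 * (expR (- y))).
  by ring.
do 3! (apply: ler_wpM2r; [by rewrite ?mulr_ge0 ?invr_ge0 ?expR_ge0 ?exprn_ge0// ltW|]).
exact: expRge_pow.
Qed.

(** The dominating Gaussian density has total mass one, so only its prefactor remains. What matters
    later is the scaling [s ^+ (2 * q)]. *)
Lemma normal_moment (s : R) (q : nat) : 0 < s ->
  (\int[normal_prob 0 s]_x (x ^+ (2 * q))%:E <=
   (Num.sqrt 2 * q`!%:R * 4 ^+ q * s ^+ (2 * q))%:E)%E.
Proof.
move=> s0.
rewrite ge0_integral_normal//; last 2 first.
- by apply/measurable_EFinP; exact: measurable_funX.
- by move=> x; rewrite lee_fin exprM exprn_ge0// sqr_ge0.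
set c := (X in (_ <= X%:E)%E).
have c0 : 0 <= c by rewrite /c !mulr_ge0 ?sqrtr_ge0 ?exprn_ge0 // ltW.
rewrite -(mule1 c%:E) -(integral_normal_pdf 0 (Num.sqrt 2 * s)).
rewrite -(@ge0_integralZl _ _ _ mu)//; last 2 first.
- by apply/measurable_EFinP; exact: measurable_normal_pdf.
- by move=> x _; rewrite lee_fin normal_pdf_ge0.
apply: ge0_le_integral => //.
- move=> x _; rewrite -EFinM lee_fin mulr_ge0 ?normal_pdf_ge0//.
  by rewrite exprM exprn_ge0// sqr_ge0.
- apply/measurable_EFinP; apply: measurable_funM; first exact: measurable_funX.
  exact: measurable_normal_pdf.
- apply/measurable_EFinP; apply: measurable_funM => //.
  exact: measurable_normal_pdf.
by move=> x _; rewrite -!EFinM lee_fin; exact: normal_pdf_moment_le.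
Qed.

End normal_moments.

(* [Phi 1] is the square of [enorm].  Even powers make every moment a
   polynomial expectation. *)
Definition Phi (R : realType) (q m n : nat) (A : 'M[R]_(m, n)) : R :=
  \sum_(i < m) \sum_(j < n) A i j ^+ (2 * q).

Lemma even_pow_ge0 (R : realType) q (x : R) : 0 <= x ^+ (2 * q).
Proof. by rewrite exprM exprn_ge0// sqr_ge0. Qed.

Ltac nneg := by repeat first
  [ done | exact: ler0n | exact: even_pow_ge0 | exact: sqr_ge0 | exact: normr_ge0
  | exact: ltW | exact: sqrtr_ge0 | apply: exprn_ge0 | apply: addr_ge0
  | apply: divr_ge0 | apply: mulr_ge0 | rewrite invr_ge0
  | (apply: sumr_ge0; intros) ].

(** * Even power sums of matrix entries and the Euclidean norm *)

Section matrix_power_sums.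
Context {R : realType}.
Implicit Types (m n q : nat).

Lemma Phi_ge0 q m n (A : 'M[R]_(m, n)) : 0 <= Phi q A.
Proof. by apply: sumr_ge0 => i _; apply: sumr_ge0 => j _; exact: even_pow_ge0. Qed.

Lemma Phi0 q m n : (0 < q)%N -> Phi q (0 : 'M[R]_(m, n)) = 0.
Proof.
move=> q0; apply: big1 => i _; apply: big1 => j _.
by rewrite mxE expr0n muln_eq0/= gtn_eqF.
Qed.

Lemma PhiZ q m n c (A : 'M[R]_(m, n)) : Phi q (c *: A) = c ^+ (2 * q) * Phi q A.
Proof.
rewrite /Phi mulr_sumr; apply: eq_bigr => i _; rewrite mulr_sumr.
by apply: eq_bigr => j _; rewrite mxE exprMn.
Qed.

Lemma even_pow_le q (x y : R) : `|x| <= y -> x ^+ (2 * q) <= y ^+ (2 * q).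
Proof.
move=> xy; rewrite -(ger0_norm (even_pow_ge0 q x)) normrX.
by rewrite lerXn2r ?nnegrE// (le_trans (normr_ge0 x)).
Qed.

Lemma even_powD_le q (x y : R) :
  (x + y) ^+ (2 * q) <= 2 ^+ (2 * q) * (x ^+ (2 * q) + y ^+ (2 * q)).
Proof.
wlog xy : x y / `|x| <= `|y|.
  move=> H; have [/H//|/ltW/H] := leP `|x| `|y|.
  by rewrite addrC [X in _ * X]addrC.
apply: (@le_trans _ _ ((2 * `|y|) ^+ (2 * q))).
  apply: even_pow_le; apply: le_trans (ler_normD _ _) _.
  by rewrite mulr_natl mulr2n lerD2r.
rewrite exprMn ler_wpM2l ?exprn_ge0// -normrX (ger0_norm (even_pow_ge0 _ _)).
by rewrite lerDr even_pow_ge0.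
Qed.

Lemma PhiD_le q m n (A B : 'M[R]_(m, n)) :
  Phi q (A + B) <= 2 ^+ (2 * q) * (Phi q A + Phi q B).
Proof.
rewrite /Phi -big_split mulr_sumr; apply: ler_sum => i _ /=.
rewrite -big_split mulr_sumr; apply: ler_sum => j _ /=.
by rewrite mxE even_powD_le.
Qed.

Lemma PhiN q m n (A : 'M[R]_(m, n)) : Phi q (- A) = Phi q A.
Proof. by rewrite -scaleN1r PhiZ exprM sqrrN expr1n expr1n mul1r. Qed.

Lemma enorm_ge0 m n (A : 'M[R]_(m, n)) : 0 <= enorm A.
Proof. exact: sqrtr_ge0. Qed.

Lemma enorm_sqr m n (A : 'M[R]_(m, n)) : enorm A ^+ 2 = Phi 1 A.
Proof. by rewrite sqr_sqrtr//; exact: (Phi_ge0 1). Qed.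

Lemma coord_le_enorm m n (A : 'M[R]_(m, n)) i j : `|A i j| <= enorm A.
Proof.
rewrite -(@ler_pXn2r _ 2) ?nnegrE ?enorm_ge0// enorm_sqr real_normK ?num_real//.
rewrite /Phi (bigD1 i)//= (bigD1 j)//= -addrA lerDl addr_ge0//.
  by apply: sumr_ge0 => k _; exact: even_pow_ge0.
by apply: sumr_ge0 => k _; apply: sumr_ge0 => l _; exact: even_pow_ge0.
Qed.

Lemma Phi_le_enorm q m n (A : 'M[R]_(m, n)) : (0 < q)%N ->
  Phi q A <= enorm A ^+ (2 * q).
Proof.
case: q => // q _; rewrite mulnS exprD enorm_sqr mulr_suml.
apply: ler_sum => i _; rewrite mulr_suml; apply: ler_sum => j _.
rewrite mulnS exprD ler_wpM2l ?sqr_ge0//.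
by apply: even_pow_le; exact: coord_le_enorm.
Qed.

(** Every summand is at most the largest one, and the power of the largest one occurs on the
    right. *)
Lemma sum_pow_le (I : finType) (a : I -> R) q : (forall i, 0 <= a i) ->
  (0 < q)%N ->
  (\sum_i a i) ^+ q <= #|I|%:R ^+ q * \sum_i a i ^+ q.
Proof.
move=> a0 q0; have [I0|/card_gt0P[i0 _]] := posnP #|I|.
  rewrite big1 ?expr0n ?gtn_eqF//; last by move=> i; have := card0_eq I0 i.
  by rewrite mulr_ge0 ?exprn_ge0// sumr_ge0// => i _; rewrite exprn_ge0.
pose k := [arg max_(i > i0) a i]%O.
have ak i : a i <= a k by rewrite /k; case: Order.TotalTheory.arg_maxP => //= j _; exact.
apply: (@le_trans _ _ ((#|I|%:R * a k) ^+ q)).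
  rewrite lerXn2r ?nnegrE ?mulr_ge0 ?sumr_ge0//.
  rewrite mulr_natl -sumr_const; exact: ler_sum.
rewrite exprMn ler_wpM2l ?exprn_ge0// (bigD1 k)//= lerDl.
by apply: sumr_ge0 => i _; rewrite exprn_ge0.
Qed.

Lemma enorm_le_Phi q m n (A : 'M[R]_(m, n)) : (0 < q)%N ->
  enorm A ^+ (2 * q) <= (m * n)%:R ^+ q * Phi q A.
Proof.
move=> q0; rewrite exprM enorm_sqr /Phi !pair_big/=.
have := @sum_pow_le ('I_m * 'I_n)%type (fun p => A p.1 p.2 ^+ 2) q.
rewrite card_prod !card_ord => /(_ _ q0) H.
apply: le_trans (H _) _ => [p|]; first exact: sqr_ge0.
by apply: ler_wpM2l; [rewrite exprn_ge0|apply: ler_sum => p _; rewrite exprM].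
Qed.

(** For [d = 0] the definition also admits negative constants, hence the maximum with 0. *)
Lemma lipschitz_ge0 d m n (f : 'cV[R]_d -> 'M[R]_(m, n)) :
  globally_lipschitz f ->
  exists2 L : R, 0 <= L & forall x y, enorm (f x - f y) <= L * enorm (x - y).
Proof.
move=> [L fL]; exists (Num.max 0 L); first by rewrite le_max lexx.
move=> x y; apply: le_trans (fL x y) _.
by rewrite ler_wpM2r ?enorm_ge0// le_max lexx orbT.
Qed.

Lemma Phi_lipschitz q d m n (f : 'cV[R]_d -> 'M[R]_(m, n)) :
  (0 < q)%N -> globally_lipschitz f ->
  exists2 C : R, 0 <= C & forall x y, Phi q (f x - f y) <= C * Phi q (x - y).
Proof.
move=> q0 /lipschitz_ge0[L L0 fL].
exists (L ^+ (2 * q) * (d * 1)%:R ^+ q).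
  by rewrite mulr_ge0 ?exprn_ge0.
move=> x y; apply: le_trans (Phi_le_enorm _ q0) _.
apply: (@le_trans _ _ ((L * enorm (x - y)) ^+ (2 * q))).
  by rewrite lerXn2r ?nnegrE ?mulr_ge0 ?enorm_ge0.
by rewrite exprMn -mulrA ler_wpM2l ?exprn_ge0// enorm_le_Phi.
Qed.

End matrix_power_sums.

(** * Adapted random matrices *)

Section random_matrices.
Context {disp : measure_display} {Omega : measurableType disp} {R : realType}.
Implicit Types (G H : set (set Omega)).

(* [measurable_fun] wants a sigma-algebra structure on its domain, hence the
   detour through the one generated by [G], which is [G] if [G] is one. *)
Definition gmeas G (f : Omega -> R) : Prop :=
  measurable_fun setT (f : g_sigma_algebraType G -> R).

Definition rv G (m n : nat) (Z : Omega -> 'M[R]_(m, n)) : Prop :=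
  forall i j, gmeas G (fun w => Z w i j).

Lemma gmeasP G (f : Omega -> R) : sigma_algebra setT G ->
  gmeas G f <-> forall B, measurable B -> G (f @^-1` B).
Proof.
move=> sG; split=> [mf B mB|mf _ B mB].
  by have := mf measurableT B mB; rewrite setTI /measurable/= sigma_algebra_id.
by rewrite setTI; apply: sub_sigma_algebra; exact: mf.
Qed.

Lemma gmeas_sub G H (f : Omega -> R) : G `<=` H -> gmeas G f -> gmeas H f.
Proof.
move=> GH mf _ B mB; have := mf measurableT B mB.
by rewrite /measurable/=; apply: sub_smallest2r.
Qed.

Lemma gmeas_measurable G (f : Omega -> R) : G `<=` measurable ->
  gmeas G f -> measurable_fun setT f.
Proof.
move=> GH mf _ B mB; have := mf measurableT B mB; rewrite /measurable/=.
suff : <<s G >> `<=` (measurable : set (set Omega)) by exact.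
exact: (smallest_sub (sigma_algebra_measurable Omega)).
Qed.

Lemma gmeas_bool G (b : Omega -> bool) : G [set w | b w] ->
  measurable_fun setT (b : g_sigma_algebraType G -> bool).
Proof.
move=> Gb; apply: (measurable_fun_bool true); rewrite setTI.
by apply: sub_sigma_algebra; rewrite (_ : _ @^-1` _ = [set w | b w]).
Qed.

Lemma rv_borel G m n (Z : Omega -> 'M[R]_(m, n)) : sigma_algebra setT G ->
  borel_measurable_wrt G Z -> rv G Z.
Proof.
move=> sG mZ i j; apply/gmeasP => // B mB.
apply: (mZ ((fun M : 'M[R]_(m, n) => M i j) @^-1` B)).
pose T := g_sigma_algebraType [set U : set 'M[R]_(m, n) | open U].
have : measurable_fun setT ((fun M : 'M[R]_(m, n) => M i j) : T -> R).
  apply: (measurability _ (RGenOpens.measurableE R)) => _ [_ [a [b ->]] <-].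
  apply: sub_sigma_algebra; rewrite setTI.
  apply: open_comp; last exact: interval_open.
  by move=> M _; exact: coord_continuous.
by move=> /(_ measurableT B mB); rewrite setTI.
Qed.

(** Rounding to a lattice of mesh [1 / k.+1] leaves countably many values, each taken on an event
    described by the entries alone. It serves to compose entrywise measurable matrices with
    Lipschitz maps. *)
Definition round_mx (k m n : nat) (A : 'M[R]_(m, n)) : 'M[int]_(m, n) :=
  \matrix_(i, j) Num.floor (A i j * k.+1%:R).

Definition unround_mx (k m n : nat) (C : 'M[int]_(m, n)) : 'M[R]_(m, n) :=
  \matrix_(i, j) ((C i j)%:~R / k.+1%:R).

Lemma round_mx_dist k m n (A : 'M[R]_(m, n)) :
  enorm (unround_mx k (round_mx k A) - A) ^+ 2 <= (m * n)%:R / k.+1%:R.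
Proof.
rewrite enorm_sqr /Phi natrM -mulrA [leRHS]mulr_natl.
rewrite -[X in _ *+ X](card_ord m) -sumr_const; apply: ler_sum => i _.
rewrite mulr_natl -[X in _ *+ X](card_ord n) -sumr_const; apply: ler_sum => j _.
rewrite !mxE muln1.
have k0 : 0 < k.+1%:R :> R by rewrite ltr0n.
have /andP[] := floor_itv (A i j * k.+1%:R); rewrite intrD.
set c := (Num.floor _)%:~R => c1 c2.
have b1 : c / k.+1%:R <= A i j by rewrite ler_pdivrMr.
have b2 : A i j < c / k.+1%:R + k.+1%:R^-1.
  by rewrite -[X in _ + X]mul1r -mulrDl ltr_pdivlMr.
have k1 : k.+1%:R^-1 <= 1 :> R by rewrite invf_le1// ler1n.
have ki0 : 0 < k.+1%:R^-1 :> R by rewrite invr_gt0.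
set y := A i j in b1 b2 *; set x := c / _ in b1 b2 *.
by set e := k.+1%:R^-1 in b2 k1 ki0 *; nra.
Qed.

(** The function is the pointwise limit of [f] applied to roundings of [Z]. Each of these takes
    countably many values, so its measurability only involves the entries of [Z]. *)
Lemma gmeas_lipschitz G m n p q (f : 'M[R]_(m, n) -> 'M[R]_(p, q)) i j
    (Z : Omega -> 'M[R]_(m, n)) L :
  (forall x y, enorm (f x - f y) <= L * enorm (x - y)) ->
  rv G Z -> gmeas G (fun w => f (Z w) i j).
Proof.
move=> fL mZ.
pose h k w := f (unround_mx k (round_mx k (Z w))) i j.
apply: (@measurable_fun_cvg _ (g_sigma_algebraType G) R setT h) => [k|w _].
  move=> _ B mB; rewrite setTI.
  (* The event that [Z] rounds to [C], retained only if [f] sends that lattice point into [B]. *)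
  pose E (C : 'M[int]_(m, n)) : set (g_sigma_algebraType G) :=
    if `[< B (f (unround_mx k C) i j) >] then
      \bigcap_(p in [set: 'I_m * 'I_n])
        [set w | (C p.1 p.2)%:~R <= Z w p.1 p.2 * k.+1%:R
                 < (C p.1 p.2 + 1)%:~R]
    else set0.
  have -> : h k @^-1` B = \bigcup_C E C.
    apply/seteqP; split=> [w hB|w [C _]].
      exists (round_mx k (Z w)) => //; rewrite /E asboolT// => c _ /=.
      by rewrite mxE floor_itv.
    rewrite /E; case: asboolP => // fB wC; rewrite /h /=.
    suff -> : round_mx k (Z w) = C by [].
    by apply/matrixP => a b; rewrite mxE; apply/floor_def/(wC (a, b)).
  apply: (@countable_bigcupT_measurable _ _ 'M[int]_(m, n)).
    exact: countableP.
  move=> C; rewrite /E; case: asboolP => // _.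
  apply: fin_bigcap_measurable => [|[a b] _ /=]; first exact: finite_finset.
  rewrite (_ : [set w | _] = [set: g_sigma_algebraType G] `&`
    (fun w => Z w a b * k.+1%:R) @^-1` `[(C a b)%:~R, (C a b + 1)%:~R[).
    by apply: measurable_funM => //; exact: mZ.
  by rewrite setTI; apply/seteqP; split => w; rewrite /= in_itv.
pose M := Num.max 0 L.
have L0 : 0 <= M by rewrite le_max lexx.
apply/cvgrPdist_le => e e0.
(* By [round_mx_dist] the squared distance to the rounding is at most [(m * n) / k.+1]; this
   threshold brings the distance below [e / (M + 1)]. Both additions of 1 keep the denominators
   positive. *)
have ee0 : 0 < (e / (M + 1)) ^+ 2 / ((m * n)%:R + 1).
  by rewrite divr_gt0 ?exprn_gt0 ?divr_gt0 ?ltr_wpDl.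
have [k0 _ kP] := near_infty_natSinv_lt (PosNum ee0).
exists k0 => // k /kP /= {kP}.
set N := (m * n)%:R in ee0 *.
have N0 : 0 <= N :> R by rewrite /N.
rewrite ltr_pdivlMr ?ltr_wpDl// => ke.
rewrite /h distrC.
have := coord_le_enorm (f (unround_mx k (round_mx k (Z w))) - f (Z w)) i j.
rewrite !mxE => /le_trans; apply; apply: le_trans (fL _ _) _.
set y := enorm _.
have y0 : 0 <= y by exact: enorm_ge0.
have yk : y ^+ 2 <= (m * n)%:R / k.+1%:R by exact: round_mx_dist.
have {}k0 : 0 < k.+1%:R^-1 :> R by rewrite invr_gt0.
have {yk} : y ^+ 2 <= (e / (M + 1)) ^+ 2.
  apply: le_trans yk _; rewrite -/N.
  by move: (k.+1%:R^-1) k0 ke => r k0 ke; nra.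
rewrite ler_pXn2r ?nnegrE//; last by rewrite divr_ge0 ?addr_ge0// ltW.
rewrite ler_pdivlMr ?ltr_wpDl// => yM.
have LM : L <= M by rewrite le_max lexx orbT.
by nra.
Qed.

Lemma rv_lipschitz G d m n (f : 'cV[R]_d -> 'M[R]_(m, n))
    (Z : Omega -> 'cV[R]_d) :
  globally_lipschitz f -> rv G Z -> rv G (fun w => f (Z w)).
Proof. by move=> [L fL] mZ i j; exact: gmeas_lipschitz fL mZ. Qed.

Lemma rv_sub G H m n (Z : Omega -> 'M[R]_(m, n)) : G `<=` H -> rv G Z -> rv H Z.
Proof. by move=> GH mZ i j; exact: gmeas_sub (mZ i j). Qed.

Lemma rv_cst G m n (A : 'M[R]_(m, n)) : rv G (fun=> A).
Proof. by move=> i j; exact: measurable_cst. Qed.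

Lemma rvD G m n (Z1 Z2 : Omega -> 'M[R]_(m, n)) :
  rv G Z1 -> rv G Z2 -> rv G (fun w => Z1 w + Z2 w).
Proof.
move=> m1 m2 i j; rewrite /gmeas; under eq_fun do rewrite mxE.
by apply: measurable_funD; [exact: m1|exact: m2].
Qed.

Lemma rvZ G m n (c : R) (Z : Omega -> 'M[R]_(m, n)) :
  rv G Z -> rv G (fun w => c *: Z w).
Proof.
move=> mZ i j; rewrite /gmeas; under eq_fun do rewrite mxE.
by apply: measurable_funM => //; exact: mZ.
Qed.

Lemma rvB G m n (Z1 Z2 : Omega -> 'M[R]_(m, n)) :
  rv G Z1 -> rv G Z2 -> rv G (fun w => Z1 w - Z2 w).
Proof.
move=> m1 m2 i j; rewrite /gmeas; under eq_fun do rewrite !mxE.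
by apply: measurable_funB; [exact: m1|exact: m2].
Qed.

Lemma rvM G m n p (Z1 : Omega -> 'M[R]_(m, n)) (Z2 : Omega -> 'M[R]_(n, p)) :
  rv G Z1 -> rv G Z2 -> rv G (fun w => Z1 w *m Z2 w).
Proof.
move=> m1 m2 i j; rewrite /gmeas; under eq_fun do rewrite mxE.
apply: measurable_sum => k; apply: measurable_funM; first exact: m1.
exact: m2.
Qed.

Lemma rv_sum G m n (I : Type) (r : seq I) (p : pred I)
    (Z : I -> Omega -> 'M[R]_(m, n)) :
  (forall k, p k -> rv G (Z k)) -> rv G (fun w => \sum_(k <- r | p k) Z k w).
Proof.
move=> mZ; elim: r => [|a r IH].
  by under eq_fun do rewrite big_nil; exact: rv_cst.
case pa: (p a); under eq_fun do rewrite big_cons pa; last exact: IH.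
by apply: rvD => //; exact: mZ.
Qed.

Lemma rv_if G m n (b : Omega -> bool) (Z1 Z2 : Omega -> 'M[R]_(m, n)) :
  G [set w | b w] -> rv G Z1 -> rv G Z2 -> rv G (fun w => if b w then Z1 w else Z2 w).
Proof.
move=> Gb m1 m2 i j; rewrite /gmeas; 
rewrite (_ : (fun w => _) = fun w => if b w then Z1 w i j else Z2 w i j).
  by apply: measurable_fun_ifT; [exact: gmeas_bool|exact: m1|exact: m2].
by apply/funext => w; case: ifP.
Qed.

Lemma gmeas_Phi G q m n (Z : Omega -> 'M[R]_(m, n)) :
  rv G Z -> gmeas G (fun w => Phi q (Z w)).
Proof.
move=> mZ; apply: measurable_sum => i; apply: measurable_sum => j.
by apply: measurable_funX; exact: mZ.
Qed.

Lemma gmeas_le G (f : Omega -> R) (c : R) : sigma_algebra setT G ->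
  gmeas G f -> G [set w | f w <= c].
Proof.
move=> sG /(gmeasP _ sG) mf.
rewrite (_ : [set w | _] = f @^-1` `]-oo, c]); first exact: mf.
by apply/seteqP; split => w; rewrite /= in_itv.
Qed.

Lemma rv_measurable_Phi q m n (Z : Omega -> 'M[R]_(m, n)) :
  rv measurable Z -> measurable_fun setT (fun w => Phi q (Z w)).
Proof. by move=> mZ; apply: (@gmeas_measurable measurable) => //; exact: gmeas_Phi. Qed.

Lemma measurable_sublevel (f : Omega -> R) (c : R) :
  measurable_fun setT f -> measurable [set w | f w <= c].
Proof.
move=> mf; rewrite (_ : [set w | _] = setT `&` f @^-1` `]-oo, c]); first exact: mf.
by rewrite setTI; apply/seteqP; split => w; rewrite /= in_itv.
Qed.

Lemma measurable_superlevel (f : Omega -> R) (c : R) :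
  measurable_fun setT f -> measurable [set w | c < f w].
Proof.
move=> mf; rewrite (_ : [set w | _] = setT `&` f @^-1` `]c, +oo[); first exact: mf.
by rewrite setTI; apply/seteqP; split => w; rewrite /= in_itv/= andbT.
Qed.

End random_matrices.

(** * Monotonicity of integrals without measurability, and integration under independence *)

Section integral_extra.
Context {d : measure_display} {E : measurableType d} {R : realType}.

(** The integral of a nonnegative function is the supremum of the integrals of the simple functions
    below it, and this is monotone for arbitrary integrands. *)
Lemma ge0_le_integral_nonmeas (mu : {measure set E -> \bar R})
    (f1 f2 : E -> \bar R) :
  (forall x, (0 <= f1 x)%E) -> (forall x, (f1 x <= f2 x)%E) ->
  (\int[mu]_x f1 x <= \int[mu]_x f2 x)%E.
Proof.
move=> f10 f12; have f20 x : (0 <= f2 x)%E by exact: le_trans (f10 x) (f12 x).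
rewrite !ge0_integralTE//; apply: ereal_sup_le => _ [h hf <-]/=.
exists h => // x.
exact: le_trans (hf x) (f12 x).
Qed.

(** The joint law of [phi] and [xi] agrees with a product measure on rectangles, hence everywhere,
    and Tonelli's theorem applies. *)
Lemma indep_integral d1 d2 (E1 : measurableType d1) (E2 : measurableType d2)
    (P : probability E R) (nu : probability E2 R)
    (phi : E -> E1) (xi : E -> E2) (h : E1 * E2 -> \bar R) :
  measurable_fun setT phi -> measurable_fun setT xi ->
  (forall A B, measurable A -> measurable B ->
     P (phi @^-1` A `&` xi @^-1` B) = (P (phi @^-1` A) * nu B)%E) ->
  measurable_fun setT h -> (forall z, (0 <= h z)%E) ->
  (\int[P]_w h (phi w, xi w) = \int[P]_w \int[nu]_y h (phi w, y))%E.
Proof.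
move=> mphi mxi indep mh h0.
pose phi_mix := isMeasurableFun.Build _ _ _ _ _ mphi.
pose phiM : {mfun E >-> E1} := HB.pack phi phi_mix.
have mpair : measurable_fun setT (fun w => (phi w, xi w)).
  exact: measurable_fun_pair.
pose pair_mix := isMeasurableFun.Build _ _ _ _ _ mpair.
pose pairM : {mfun E >-> (E1 * E2)%type} := HB.pack (fun w => (phi w, xi w)) pair_mix.
pose m1 : probability E1 R := distribution P phiM.
pose m12 : measure (E1 * E2)%type R := distribution P pairM.
have m12E X : measurable X -> (m1 \x nu)%E X = m12 X.
  by apply: product_measure_unique => A B mA mB; rewrite -indep.
have -> : (\int[P]_w h (phi w, xi w) = \int[m12]_z h z)%E.
  by rewrite ge0_integral_distribution.
have -> : (\int[m12]_z h z = \int[(m1 \x nu)%E]_z h z)%E.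
  by apply: eq_measure_integral => A mA _; exact/esym/m12E.
rewrite fubini_tonelli1// ge0_integral_distribution//.
- exact: measurable_fun_fubini_tonelli_F.
- by move=> x; apply: integral_ge0.
Qed.

End integral_extra.

(** * Brownian increments *)

Section brownian_increment.
Context {disp : measure_display} {Omega : measurableType disp} {R : realType}.
Variables (P : probability Omega R) (T : R) (F : R -> set (set Omega)).
Variables (m : nat) (W : R -> Omega -> 'cV[R]_m).
Hypothesis hF : is_filtration T F.
Hypothesis hW : standard_brownian_motion P T F W.

Lemma filtration_sigma t : 0 <= t <= T -> sigma_algebra setT (F t).
Proof. by case: hF => h _ _ tT; apply: h; rewrite in_itv. Qed.

Lemma filtration_measurable t : 0 <= t <= T -> F t `<=` measurable.
Proof. by case: hF => _ h _ tT; apply: h; rewrite in_itv. Qed.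

Lemma filtration_le s t : 0 <= s -> s <= t -> t <= T -> F s `<=` F t.
Proof. by case: hF => _ _; exact. Qed.

Lemma rv_filtration_le k n s t (Z : Omega -> 'M[R]_(k, n)) :
  0 <= s -> s <= t -> t <= T -> rv (F s) Z -> rv (F t) Z.
Proof. by move=> s0 st tT; apply: rv_sub; exact: filtration_le. Qed.

Lemma rv_filtration k n t (Z : Omega -> 'M[R]_(k, n)) :
  0 <= t <= T -> rv (F t) Z -> rv measurable Z.
Proof. by move=> tT; apply: rv_sub; exact: filtration_measurable. Qed.

Lemma rv_W t : 0 <= t <= T -> rv (F t) (W t).
Proof.
move=> tT; apply: rv_borel; first exact: filtration_sigma.
by case: hW => + _ _ _; apply; rewrite in_itv.
Qed.

Lemma rv_dW s t : 0 <= s -> s <= t -> t <= T -> rv (F t) (fun w => W t w - W s w).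
Proof.
move=> s0 st tT; apply: rvB; first by apply: rv_W; rewrite tT (le_trans s0 st).
apply: (rv_filtration_le s0 st tT); apply: rv_W.
by rewrite s0 (le_trans st tT).
Qed.

(** The identity of the matrix space, seen as a Borel random matrix, reduces this to [rv_borel]. *)
Lemma borel_coord k n (i : 'I_k) (j : 'I_n) (B : set R) : measurable B ->
  borel_mx ((fun M : 'M[R]_(k, n) => M i j) @^-1` B).
Proof.
move=> mB.
pose O := g_sigma_algebraType [set U : set 'M[R]_(k, n) | open U].
have : borel_measurable_wrt (measurable : set (set O)) (id : O -> 'M[R]_(k, n)).
  by move=> C.
have sO : sigma_algebra setT (measurable : set (set O)).
  exact: sigma_algebra_measurable.
move=> /(rv_borel sO) /(_ i j) /(gmeasP _ sO); exact.
Qed.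

(** The law of the increment is given on boxes; a box whose other sides are the whole line isolates
    the coordinate [k]. *)
Lemma dW_indep s t (k : 'I_m) (A : set Omega) (B : set R) :
  0 <= s -> s < t -> t <= T -> F s A -> measurable B ->
  P (A `&` [set w | B ((W t w - W s w) k 0)]) =
  (P A * normal_prob 0 (Num.sqrt (t - s)) B)%E.
Proof.
move=> s0 st tT FA mB; case: hW => _ _ ind law.
rewrite (ind _ _ s0 st tT A _ FA (borel_coord k 0 mB)); congr (_ * _)%E.
pose Bs (i : 'I_m) : set R := if i == k then B else setT.
have mBs i : measurable (Bs i) by rewrite /Bs; case: ifP.
have := law _ _ s0 st tT Bs mBs.
rewrite (bigD1 k)//= big1 ?mule1; last first.
  by move=> i /negbTE ik; rewrite /Bs ik; exact: probability_setT.
rewrite {2}/Bs eqxx => <-; congr (P _).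
apply/seteqP; split => w /=; last by move/(_ k); rewrite /Bs eqxx.
by move=> Bw i; rewrite /Bs; case: eqP => // ->.
Qed.

Lemma dW_integral2 s t (k : 'I_m) (phi : Omega -> R)
    (h : R * measurableTypeR R -> \bar R) :
  0 <= s -> s < t -> t <= T -> gmeas (F s) phi ->
  measurable_fun setT h -> (forall x, (0 <= h x)%E) ->
  (\int[P]_w h (phi w, (W t w - W s w)%R k 0%R) =
   \int[P]_w \int[normal_prob 0 (Num.sqrt (t - s))]_y h (phi w, y))%E.
Proof.
move=> s0 st tT mphi mh h0.
have sT : 0 <= s <= T by rewrite s0 (le_trans (ltW st) tT).
have tT' : 0 <= t <= T by rewrite tT (le_trans s0 (ltW st)).
apply: (indep_integral
  (xi := (fun w => (W t w - W s w) k 0) : Omega -> measurableTypeR R)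
  (nu := normal_prob 0 (Num.sqrt (t - s)))) => //.
- exact: gmeas_measurable (filtration_measurable sT) mphi.
- apply: (gmeas_measurable (filtration_measurable tT')).
  exact: (rv_dW s0 (ltW st) tT).
- move=> A B mA mB; apply: dW_indep => //.
  by move/(gmeasP _ (filtration_sigma sT)) : mphi; exact.
Qed.

Lemma dW_integral s t (k : 'I_m) (phi : Omega -> R) (g : R -> \bar R) :
  0 <= s -> s < t -> t <= T -> gmeas (F s) phi -> (forall w, 0 <= phi w) ->
  measurable_fun setT g -> (forall x, (0 <= g x)%E) ->
  (\int[P]_w ((phi w)%:E * g ((W t w - W s w)%R k 0%R)) =
   (\int[P]_w (phi w)%:E) *
   \int[normal_prob 0 (Num.sqrt (t - s))]_x g x)%E.
Proof.
move=> s0 st tT mphi phi0 mg g0.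
have sT : 0 <= s <= T by rewrite s0 (le_trans (ltW st) tT).
(* The absolute value changes nothing at the values of [phi] and makes [h] nonnegative everywhere,
   as [dW_integral2] asks. *)
pose h (z : R * measurableTypeR R) := (`|z.1|%:E * g z.2)%E.
transitivity (\int[P]_w h (phi w, (W t w - W s w)%R k 0%R))%E.
  by apply: eq_integral => w _; rewrite /h /= ger0_norm.
have h0 z : (0 <= h z)%E by rewrite mule_ge0.
rewrite dW_integral2//; last first.
  apply: emeasurable_funM.
    by apply/measurable_EFinP; apply: measurableT_comp.
  exact: (measurableT_comp mg (@measurable_snd _ _ R (measurableTypeR R))).
rewrite /h/=; under eq_integral do rewrite ge0_integralZl//.
rewrite ge0_integralZr//; last by apply: integral_ge0.
- by congr (_ * _)%E; apply: eq_integral => w _; rewrite ger0_norm.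
- apply/measurable_EFinP; apply: measurableT_comp => //.
  exact: gmeas_measurable (filtration_measurable sT) mphi.
Qed.

Lemma dW_moment s t (k : 'I_m) (phi : Omega -> R) (q : nat) (c : R) :
  0 <= s -> s < t -> t <= T -> gmeas (F s) phi -> (forall w, 0 <= phi w) ->
  (\int[P]_w (phi w)%:E <= c%:E)%E ->
  (\int[P]_w (phi w * ((W t w - W s w) k 0) ^+ (2 * q))%:E <=
   (c * (Num.sqrt 2 * q`!%:R * 4 ^+ q * (t - s) ^+ q))%:E)%E.
Proof.
move=> s0 st tT mphi phi0 phic.
under eq_integral do rewrite EFinM.
rewrite (dW_integral k (g := fun x => (x ^+ (2 * q))%:E) s0 st)//; first last.
- by move=> x; rewrite lee_fin even_pow_ge0.
- by apply/measurable_EFinP; exact: measurable_funX.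
rewrite EFinM lee_pmul//.
- by apply: integral_ge0 => w _; rewrite lee_fin.
- by apply: integral_ge0 => w _; rewrite lee_fin even_pow_ge0.
apply: le_trans (normal_moment q _) _; first by rewrite sqrtr_gt0 subr_gt0.
by rewrite exprM sqr_sqrtr// subr_ge0 ltW.
Qed.

(** With the value of [phi] fixed, the symmetry of the Gaussian law gives the positive and the
    negative part of the product the same integral. Both are finite, so they cancel. *)
Lemma dW_centered s t (k : 'I_m) (phi : Omega -> R) :
  0 <= s -> s < t -> t <= T -> gmeas (F s) phi ->
  P.-integrable setT (EFin \o phi) ->
  P.-integrable setT (fun w => (phi w * (W t w - W s w) k 0)%:E) /\
  (\int[P]_w (phi w * (W t w - W s w) k 0)%:E = 0)%E.
Proof.
move=> s0 st tT mphi iphi.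
have sT : 0 <= s <= T by rewrite s0 (le_trans (ltW st) tT).
have tT' : 0 <= t <= T by rewrite tT (le_trans s0 (ltW st)).
have mxi : gmeas (F t) (fun w => (W t w - W s w) k 0).
  exact: (rv_dW s0 (ltW st) tT).
have mphi' : gmeas (F t) phi.
  exact: (gmeas_sub (filtration_le s0 (ltW st) tT)).
have mprod : measurable_fun setT (fun w => phi w * (W t w - W s w) k 0).
  apply: (gmeas_measurable (filtration_measurable tT')).
  exact: measurable_funM.
have iprod : P.-integrable setT (fun w => (phi w * (W t w - W s w) k 0)%:E).
  apply/integrableP; split; first exact/measurable_EFinP.
  have [_ iphi1] := integrableP _ _ _ iphi.
  have mabs : gmeas (F s) (fun w => `|phi w|) by exact: measurableT_comp.
  pose M := fine (\int[P]_w (`|phi w|)%:E)%E.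
  have phiM : (\int[P]_w (`|phi w|)%:E = M%:E)%E.
    rewrite fineK// ge0_fin_numE//.
    by apply: integral_ge0 => w _; rewrite lee_fin.
  have M2 := dW_moment k 1 s0 st tT mabs (fun=> normr_ge0 _) _.
  have {}M2 := M2 M (eq_ind _ (fun x => (_ <= x)%E) (lexx _) _ phiM).
  have mT f : gmeas (F t) f -> measurable_fun setT f.
    exact: (gmeas_measurable (filtration_measurable tT')).
  (* From [|x| <= 1 + x ^+ 2]: the second moment of the increment controls its first absolute
     moment. *)
  apply: (@le_lt_trans _ _ (\int[P]_w (`|phi w|%:E +
      (`|phi w| * ((W t w - W s w) k 0) ^+ (2 * 1))%:E))%E).
    apply: ge0_le_integral_nonmeas => // w.
    rewrite /= normrM -EFinD lee_fin muln1.
    move: ((W t w - W s w) k 0) (phi w) => x p.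
    have := normr_ge0 p; have := sqr_ge0 (`|x| - 1).
    by rewrite -(real_normK (num_real x)); nra.
  rewrite ge0_integralD//.
  - by rewrite phiM; apply: (@le_lt_trans _ _ (M%:E + _)%E); [exact: leeD2l M2|rewrite ltry].
  - by apply/measurable_EFinP; apply: mT; exact: measurableT_comp.
  - by move=> w _; rewrite lee_fin mulr_ge0// even_pow_ge0.
  - apply/measurable_EFinP; apply: mT; apply: measurable_funM.
      exact: measurableT_comp.
    by apply: measurable_funX.
split => //.
rewrite integralE.
(* [hp] and [hn] are the two parts of the product as functions of the past and of the increment;
   being nonnegative, they can be integrated by [dW_integral2]. *)
pose hp (z : R * measurableTypeR R) := (maxe ((z.1 * z.2)%R)%:E 0)%E.
pose hn (z : R * measurableTypeR R) := (maxe (- (z.1 * z.2)%:E) 0)%E.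
have mz : measurable_fun setT (fun z : R * measurableTypeR R => (z.1 * z.2)%R%:E).
  apply/measurable_EFinP; apply: measurable_funM; first exact: measurable_fst.
  exact: (@measurable_snd _ _ R (measurableTypeR R)).
have mhp : measurable_fun setT hp by apply: measurable_maxe.
have mhn : measurable_fun setT hn.
  by apply: measurable_maxe => //; exact: measurableT_comp.
have Ep := dW_integral2 k s0 st tT mphi mhp _.
have En := dW_integral2 k s0 st tT mphi mhn _.
have hp0 z : (0 <= hp z)%E by rewrite /hp le_max lexx orbT.
have hn0 z : (0 <= hn z)%E by rewrite /hn le_max lexx orbT.
have {}Ep := Ep hp0; have {}En := En hn0.
have pn : (\int[P]_w hn (phi w, (W t w - W s w)%R k 0%R) =
           \int[P]_w hp (phi w, (W t w - W s w)%R k 0%R))%E.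
  rewrite Ep En; apply: eq_integral => w _.
  have mhpw : measurable_fun setT (fun y : R => hp (phi w, y)).
    apply: measurable_maxe; last exact: measurable_cst.
    apply/measurable_EFinP; apply: (@measurable_funM _ _ _ _ (fun=> phi w) id).
      exact: measurable_cst.
    exact: measurable_id.
  have sn0 : Num.sqrt (t - s) != 0 by rewrite gt_eqF// sqrtr_gt0 subr_gt0.
  transitivity (\int[normal_prob 0 (Num.sqrt (t - s))]_y hp (phi w, - y)%R)%E.
    by apply: eq_integral => y _; rewrite /hp /hn /= mulrN EFinN.
  exact: (normal_prob_opp sn0 mhpw (fun y => hp0 _)).
have fin := integrable_pos_fin_num measurableT iprod.
rewrite [X in (_ - X)%E](_ : _ =
  \int[P]_w ((fun w => (phi w * (W t w - W s w) k 0)%:E) ^\+ w))%E.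
  by rewrite subee.
transitivity (\int[P]_w hn (phi w, (W t w - W s w)%R k 0%R))%E.
  by apply: eq_integral => w _; rewrite /hn funenegE.
by rewrite pn; apply: eq_integral => w _; rewrite /hp funeposE.
Qed.

End brownian_increment.

(** * Moments of one step of a scheme *)

Section moment_step_pathwise.
Context {R : realType}.
Implicit Types x y v a : R.

(** Replacing the smaller of the two numbers by the larger one turns the product into a pure
    power. *)
Lemma young_pow (n i : nat) x y : (i <= n)%N ->
  `|x| ^+ (n - i) * `|y| ^+ i <= `|x| ^+ n + `|y| ^+ n.
Proof.
move=> ni; have [xy|/ltW yx] := leP `|x| `|y|.
  apply: (@le_trans _ _ (`|y| ^+ n)); last by rewrite lerDr exprn_ge0.
  rewrite -{2}(subnK ni) exprD ler_wpM2r ?exprn_ge0//.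
  by rewrite lerXn2r ?nnegrE.
apply: (@le_trans _ _ (`|x| ^+ n)); last by rewrite lerDl exprn_ge0.
rewrite -{2}(subnK ni) exprD ler_wpM2l ?exprn_ge0//.
by rewrite lerXn2r ?nnegrE.
Qed.

Lemma young_pow2 (n i : nat) x v : (2 <= i <= n)%N ->
  `|x| ^+ (n - i) * `|v| ^+ i <= `|x| ^+ (n - 2) * v ^+ 2 + `|v| ^+ n.
Proof.
move=> /andP[i2 ni]; rewrite -(real_normK (num_real v)).
have -> : (n - i = (n - 2) - (i - 2))%N by rewrite subnBA// subnK// (leq_trans i2).
rewrite -{2}(subnK i2) -{3}(subnK (leq_trans i2 ni)) !exprD mulrA -mulrDl.
by rewrite ler_wpM2r ?exprn_ge0// young_pow// leq_sub2r.
Qed.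

(** The linear term is kept exactly because its expectation will vanish. Every later term of the
    binomial expansion has at least two factors [v] and is absorbed by [young_pow2]. *)
Lemma pow_expand_le (n : nat) x v :
  (x + v) ^+ n.+2 <= x ^+ n.+2 + n.+2%:R * x ^+ n.+1 * v +
    2 ^+ n.+2 * (`|x| ^+ n * v ^+ 2 + `|v| ^+ n.+2).
Proof.
rewrite exprDn 2!big_ord_recl/= subn0 expr0 mulr1 bin0 mulr1n subn1 bin1 expr1.
rewrite -mulrnAl -mulr_natl addrA lerD2l.
set K := `|x| ^+ n * v ^+ 2 + `|v| ^+ n.+2.
have K0 : 0 <= K by nneg.
apply: (@le_trans _ _ (\sum_(i < n.+1) 'C(n.+2, i.+2)%:R * K)).
  apply: ler_sum => i _; rewrite /bump/= !add1n.
  rewrite -mulr_natl ler_wpM2l// (le_trans (ler_norm _))// normrM !normrX.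
  have := @young_pow2 n.+2 i.+2 x v; rewrite subn2; apply.
  by rewrite /= -ltnS; have := ltn_ord i; rewrite !ltnS.
rewrite -mulr_suml ler_wpM2r//.
(* [2 ^+ n.+2] is the sum of all binomial coefficients, of which the first two are dropped. *)
have -> : 2 = 1 + 1 :> R by [].
rewrite exprDn [leRHS]big_ord_recl [X in _ <= _ + X]big_ord_recl/=.
apply: (@le_trans _ _ (\sum_(i < n.+1) 'C(n.+2, i.+2)%:R)) => //.
rewrite addrA -[X in X <= _]add0r lerD//.
apply: ler_sum => i _; rewrite /bump/= !add1n !expr1n mulr1.
by [].
Qed.

Lemma sum_even_pow_le (m q : nat) (c : 'I_m -> R) : (0 < q)%N ->
  (\sum_k c k) ^+ (2 * q) <= m%:R ^+ (2 * q) * \sum_k c k ^+ (2 * q).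
Proof.
move=> q0; apply: (@le_trans _ _ ((\sum_k `|c k|) ^+ (2 * q))).
  by apply: even_pow_le; exact: ler_norm_sum.
have := @sum_pow_le R 'I_m (fun k => `|c k|) (2 * q).
rewrite card_ord muln_gt0/= => /(_ _ q0) H.
apply: le_trans (H _) _ => [//|]; rewrite ler_wpM2l ?exprn_ge0//.
by apply: ler_sum => k _; rewrite -normrX ger0_norm// even_pow_ge0.
Qed.

(** Here [a] is the square root of the step in rescaled time: the drift carries [a ^+ 2] and the
    noise carries [a]. Hence every contribution except the linear noise term has a factor
    [a ^+ 2]. *)
Lemma scaled_step (q m : nat) : (0 < q)%N ->
  exists2 C : R, 0 <= C & forall a x A (B xi : 'I_m -> R), 0 <= a -> a <= 1 ->
  (x + a ^+ 2 * A + a * \sum_k B k * xi k) ^+ (2 * q) <=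
  x ^+ (2 * q) + (2 * q)%:R * a * x ^+ (2 * q).-1 * (\sum_k B k * xi k) +
  C * a ^+ 2 * (x ^+ (2 * q) + A ^+ (2 * q) +
    \sum_k (x ^+ (2 * q) + B k ^+ (2 * q)) * (1 + xi k ^+ (2 * q))).
Proof.
case: q => // q _; pose n := (2 * q)%N.
have nE : (2 * q.+1 = n.+2)%N by rewrite mulnS.
(* [M] is the cost of moving the powers 2 and [n.+2] inside the sum over the [m] noise
   coordinates. *)
pose M : R := m%:R ^+ 2 + m%:R ^+ n.+2.
exists (n.+2%:R + 2 ^+ n.+2 * (2 + 2 * M + 2 ^+ n.+2 * (1 + M))).
  by rewrite /M; nneg.
move=> a x A B xi a0 a1; set eta := \sum_k B k * xi k.
have ev_ge0 (y : R) : 0 <= y ^+ (2 * q.+1) by exact: even_pow_ge0.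
have ev_norm (y : R) : `|y| ^+ n.+2 = y ^+ (2 * q.+1).
  by rewrite -normrX -nE ger0_norm.
set S := \sum_k _.
have S0 : 0 <= S.
  by rewrite /S; nneg.
set U := x ^+ (2 * q.+1) + A ^+ (2 * q.+1).
have U0 : 0 <= U by rewrite addr_ge0.
rewrite -addrA; set v := a ^+ 2 * A + a * eta.
have M0 : 0 <= M by rewrite addr_ge0 ?exprn_ge0.
have MS : m%:R ^+ n.+2 <= M by rewrite lerDr exprn_ge0.
have M2 : m%:R ^+ 2 <= M by rewrite lerDl exprn_ge0.
have a20 : 0 <= a ^+ 2 by rewrite exprn_ge0.
have a21 : a ^+ 2 <= 1 by rewrite exprn_ile1.
have lin : x ^+ n.+1 * (a ^+ 2 * A) <= a ^+ 2 * U.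
  rewrite mulrCA ler_wpM2l// (le_trans (ler_norm _))// normrM normrX.
  have := @young_pow n.+2 1 x A; rewrite subn1/= expr1 => /(_ isT).
  by rewrite !ev_norm.
have etan : eta ^+ (2 * q.+1) <= M * S.
  apply: le_trans (sum_even_pow_le _ _) _ => //; rewrite nE.
  apply: (@le_trans _ _ (m%:R ^+ n.+2 * S)); last by rewrite ler_wpM2r.
  rewrite ler_wpM2l ?exprn_ge0//; apply: ler_sum => k _; rewrite -nE exprMn.
  have := ev_ge0 x; have := ev_ge0 (B k); have := ev_ge0 (xi k).
  by nra.
have quad : `|x| ^+ n * eta ^+ 2 <= M * S.
  have := @sum_even_pow_le m 1 (fun k => B k * xi k) isT; rewrite muln1 -/eta => e2.
  apply: (@le_trans _ _ (`|x| ^+ n * (m%:R ^+ 2 * \sum_(k < m) (B k * xi k) ^+ 2))).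
    by rewrite ler_wpM2l ?exprn_ge0.
  rewrite mulrCA; apply: (@le_trans _ _ (m%:R ^+ 2 * S)); last by rewrite ler_wpM2r.
  rewrite ler_wpM2l ?exprn_ge0// mulr_sumr; apply: ler_sum => k _.
  rewrite exprMn mulrA; apply: ler_pM; [nneg|nneg| |].
    have := @young_pow n.+2 2 x (B k); rewrite !subSS subn0 => /(_ isT).
    by rewrite !ev_norm real_normK ?num_real.
  have := @young_pow n.+2 2 1 (xi k); rewrite !subSS subn0 => /(_ isT).
  by rewrite !normr1 !expr1n mul1r ev_norm real_normK ?num_real.
have quadA : `|x| ^+ n * A ^+ 2 <= U.
  have := @young_pow n.+2 2 x A; rewrite !subSS subn0 => /(_ isT).
  by rewrite !ev_norm real_normK ?num_real.
have v2 : `|x| ^+ n * v ^+ 2 <= a ^+ 2 * (2 * U + 2 * (M * S)).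
  have xn0 : 0 <= `|x| ^+ n by rewrite exprn_ge0.
  apply: (@le_trans _ _ (`|x| ^+ n * (a ^+ 2 * (2 * A ^+ 2 + 2 * eta ^+ 2)))).
    rewrite ler_wpM2l//.
    have : v ^+ 2 <= 2 * (a ^+ 2 * A) ^+ 2 + 2 * (a * eta) ^+ 2.
      by rewrite /v; have := sqr_ge0 (a ^+ 2 * A - a * eta); nra.
    move=> /le_trans; apply; rewrite !exprMn [leRHS]mulrDr mulrCA [X in _ + X]mulrCA.
    by rewrite lerD2r -mulrA ler_wpM2l// ler_piMl//; nneg.
  rewrite mulrCA ler_wpM2l// mulrDr mulrCA [X in _ + X]mulrCA.
  by rewrite lerD// ler_wpM2l.
have vn : `|v| ^+ n.+2 <= a ^+ 2 * (2 ^+ n.+2 * (U + M * S)).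
  rewrite ev_norm; apply: le_trans (even_powD_le _ _ _) _.
  rewrite nE mulrCA ler_wpM2l ?exprn_ge0// -nE !exprMn mulrDr lerD//.
    apply: ler_pM; [nneg|nneg| |by rewrite lerDr].
    have an : a ^+ (2 * q.+1) <= a ^+ 2 by rewrite mulnS exprD ler_piMr// exprn_ile1.
    apply: le_trans an; rewrite ler_piMl// (le_trans _ a21)//.
    by rewrite mulnS exprD ler_piMr// exprn_ile1.
  apply: ler_pM; [nneg|nneg| |exact: etan].
  by rewrite mulnS exprD ler_piMr// exprn_ile1.
have E1 := pow_expand_le n x v; rewrite nE.
apply: le_trans E1 _; rewrite -addrA -[leRHS]addrA lerD2l /=.
apply: (@le_trans _ _ (n.+2%:R * (a ^+ 2 * U) + n.+2%:R * a * x ^+ n.+1 * eta + 2 ^+ n.+2 * (a ^+ 2 * (2 * U + 2 * (M * S)) + a ^+ 2 * (2 ^+ n.+2 * (U + M * S))))).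
  apply: lerD; last by rewrite ler_wpM2l ?exprn_ge0// lerD.
  have -> : n.+2%:R * x ^+ n.+1 * v = n.+2%:R * (x ^+ n.+1 * (a ^+ 2 * A)) + n.+2%:R * a * x ^+ n.+1 * eta.
    by rewrite /v; ring.
  by rewrite lerD2r ler_wpM2l.
rewrite [X in X + _]addrC -addrA lerD2l.
have -> : n.+2%:R * (a ^+ 2 * U) = n.+2%:R * a ^+ 2 * U by rewrite mulrA.
set c1 := n.+2%:R; set c2 := 2 ^+ n.+2.
have c10 : 0 <= c1 by rewrite /c1.
have c20 : 0 <= c2 by rewrite /c2 exprn_ge0.
move: (a ^+ 2) a20 => a2 a20.
rewrite -subr_ge0.
have -> : (c1 + c2 * (2 + 2 * M + c2 * (1 + M))) * a2 * (U + S) -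
    (c1 * a2 * U + c2 * (a2 * (2 * U + 2 * (M * S)) + a2 * (c2 * (U + M * S)))) =
    a2 * (c1 * S + c2 * (2 * S + 2 * (M * U) + c2 * (S + M * U))) by ring.
nneg.
Qed.

End moment_step_pathwise.

Section step_bound.
Context {R : realType}.

(** [scaled_step] in units where time [h] is one: the state is divided by the root [H] of [h], the
    drift multiplied by it, the noise divided by the root [e] of [dt], and [a = e / H]. With [h] the
    total time of [K] equal steps, the factor [dt / h] is [1 / K], as the Gronwall argument
    wants. *)
Lemma step_bound (q m : nat) : (0 < q)%N ->
  exists2 C : R, 0 <= C & forall h dt x A (B w : 'I_m -> R), 0 < dt -> dt <= h ->
  (x + dt * A + \sum_k B k * w k) ^+ (2 * q) <=
  x ^+ (2 * q) + (2 * q)%:R * x ^+ (2 * q).-1 * (\sum_k B k * w k) +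
  C * (dt / h) * (x ^+ (2 * q) + h ^+ (2 * q) * A ^+ (2 * q) +
    \sum_k (x ^+ (2 * q) + h ^+ q * B k ^+ (2 * q)) *
           (1 + w k ^+ (2 * q) / dt ^+ q)).
Proof.
move=> q0; have [C C0 HC] := @scaled_step R q m q0.
exists C => // h dt x A B w dt0 dth.
have h0 : 0 < h by exact: lt_le_trans dth.
pose H := Num.sqrt h; pose e := Num.sqrt dt.
have H0 : 0 < H by rewrite sqrtr_gt0.
have e0 : 0 < e by rewrite sqrtr_gt0.
have HH : H ^+ 2 = h by rewrite sqr_sqrtr// ltW.
have ee : e ^+ 2 = dt by rewrite sqr_sqrtr// ltW.
have a0 : 0 <= e / H by rewrite divr_ge0// ltW.
have a1 : e / H <= 1 by rewrite ler_pdivrMr// mul1r ler_wsqrtr.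
have := HC (e / H) (x / H) (A * H) B (fun k => w k / e) a0 a1.
have HnE : H != 0 by rewrite gt_eqF.
have enE : e != 0 by rewrite gt_eqF.
have Hq0 : 0 < H ^+ (2 * q) by rewrite exprn_gt0.
rewrite -(ler_pM2l Hq0) -exprMn.
have sumE : \sum_k B k * (w k / e) = (\sum_k B k * w k) / e.
  by rewrite mulr_suml; apply: eq_bigr => k _; rewrite mulrA.
rewrite sumE.
have -> : H * (x / H + (e / H) ^+ 2 * (A * H) + e / H * ((\sum_k B k * w k) / e)) =
    x + dt * A + \sum_k B k * w k.
  by rewrite -ee; field; rewrite HnE enE.
move=> /le_trans; apply; rewrite !mulrDr.
apply: lerD; first apply: lerD.
- by rewrite -exprMn mulrC divfK.
- have -> : H ^+ (2 * q) = H * H ^+ (2 * q).-1.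
    by rewrite -exprS prednK// muln_gt0.
  have -> : x ^+ (2 * q).-1 = (x / H) ^+ (2 * q).-1 * H ^+ (2 * q).-1.
    by rewrite -exprMn divfK.
  rewrite le_eqVlt; apply/orP; left; apply/eqP.
  by field; rewrite HnE enE.
have -> : (e / H) ^+ 2 = dt / h by rewrite expr_div_n HH ee.
have Hh : H ^+ (2 * q) = h ^+ q by rewrite exprM HH.
have eq1 : H ^+ (2 * q) * (C * (dt / h) * (x / H) ^+ (2 * q)) =
    C * (dt / h) * x ^+ (2 * q).
  by rewrite mulrCA -exprMn [H * _]mulrC divfK.
have eq2 : H ^+ (2 * q) * (C * (dt / h) * (A * H) ^+ (2 * q)) =
    C * (dt / h) * (h ^+ (2 * q) * A ^+ (2 * q)).
  by rewrite mulrCA -!exprMn -HH; congr (_ * _ ^+ _); ring.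
rewrite eq1 eq2 lerD2l mulrCA ler_wpM2l//; first nneg.
rewrite mulr_sumr; apply: ler_sum => k _.
have eq3 : H ^+ (2 * q) * (x / H) ^+ (2 * q) = x ^+ (2 * q).
  by rewrite -exprMn [H * _]mulrC divfK.
rewrite [_ ^+ (2 * q) * (_ * (1 + _))]mulrA [_ ^+ (2 * q) * (_ + _)]mulrDr eq3 Hh.
by rewrite expr_div_n [e ^+ _]exprM ee.
Qed.

(** [step_bound] summed over the coordinates of the state. The linear term is regrouped by noise
    coordinate, so that each increment is multiplied by a single quantity depending on the past. *)
Lemma step_bound_mx (q m : nat) : (0 < q)%N ->
  exists2 C : R, 0 <= C &
  forall d h dt (D A : 'cV[R]_d) (B : 'M[R]_(d, m)) (w : 'cV[R]_m),
  0 < dt -> dt <= h ->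
  Phi q (D + dt *: A + B *m w) <=
  Phi q D + \sum_k (\sum_i (2 * q)%:R * D i 0 ^+ (2 * q).-1 * B i k) * w k 0 +
  C * (dt / h) * (Phi q D + h ^+ (2 * q) * Phi q A +
    \sum_k (Phi q D + h ^+ q * Phi q B) * (1 + w k 0 ^+ (2 * q) / dt ^+ q)).
Proof.
move=> q0; have [C C0 HC] := step_bound m q0.
exists C => // d h dt D A B w dt0 dth.
have h0 : 0 < h by exact: lt_le_trans dth.
have PhicV (Z : 'cV[R]_d) : Phi q Z = \sum_i Z i 0 ^+ (2 * q).
  by apply: eq_bigr => i _; rewrite big_ord1.
rewrite {1}PhicV.
have stp i : (D + dt *: A + B *m w) i 0 ^+ (2 * q) <=
    D i 0 ^+ (2 * q) +
    (2 * q)%:R * D i 0 ^+ (2 * q).-1 * (\sum_k B i k * w k 0) +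
    C * (dt / h) * (D i 0 ^+ (2 * q) + h ^+ (2 * q) * A i 0 ^+ (2 * q) +
    \sum_k (D i 0 ^+ (2 * q) + h ^+ q * B i k ^+ (2 * q)) *
           (1 + w k 0 ^+ (2 * q) / dt ^+ q)).
  by rewrite !mxE; exact: HC.
apply: le_trans (ler_sum _ (fun i _ => stp i)) _.
rewrite !big_split/= -mulr_sumr !big_split/= -!PhicV -mulr_sumr -PhicV.
apply: lerD; first rewrite lerD2l.
  rewrite le_eqVlt; apply/orP; left; apply/eqP.
  under eq_bigr do rewrite mulr_sumr.
  rewrite exchange_big/=; apply: eq_bigr => k _; rewrite mulr_suml.
  by apply: eq_bigr => i _; rewrite !mulrA.
rewrite ler_wpM2l//; first by apply: mulr_ge0 => //; apply: divr_ge0; exact: ltW.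
rewrite lerD2l exchange_big/=; apply: ler_sum => k _.
rewrite -mulr_suml ler_wpM2r//.
  by apply: addr_ge0 => //; apply: divr_ge0; [nneg|apply: exprn_ge0; exact: ltW].
rewrite big_split/= -PhicV lerD2l -mulr_sumr ler_wpM2l//; first by rewrite exprn_ge0// ltW.
by apply: ler_sum => i _; rewrite (bigD1 k)//= lerDl; nneg.
Qed.

End step_bound.

(** * Calculus of bounds on expectations *)

Section expectation_bounds.
Context {d : measure_display} {E : measurableType d} {R : realType}.
Variable P : probability E R.

Definition ebound (f : E -> R) (c : R) : Prop :=
  [/\ measurable_fun setT f, forall w, 0 <= f w &
      (\int[P]_w (f w)%:E <= c%:E)%E].

Lemma eboundD f g a b : ebound f a -> ebound g b ->
  ebound (fun w => f w + g w) (a + b).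
Proof.
move=> [mf f0 fa] [mg g0 gb]; split; first exact: measurable_funD.
- by move=> w; rewrite addr_ge0.
- under eq_integral do rewrite EFinD.
  rewrite ge0_integralD//; first (by rewrite EFinD leeD); try exact/measurable_EFinP.
  + by move=> w _; rewrite lee_fin.
  + by move=> w _; rewrite lee_fin.
Qed.

Lemma eboundZ c f a : 0 <= c -> ebound f a -> ebound (fun w => c * f w) (c * a).
Proof.
move=> c0 [mf f0 fa]; split; first exact: measurable_funM.
- by move=> w; rewrite mulr_ge0.
- under eq_integral do rewrite EFinM.
  rewrite ge0_integralZl ?lee_fin//;
    do ?[exact/measurable_EFinP | by move=> w _; rewrite lee_fin].
  by rewrite EFinM lee_wpmul2l.
Qed.

Lemma ebound_sum (I : Type) (r : seq I) (f : I -> E -> R) (a : I -> R) :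
  (forall i, ebound (f i) (a i)) ->
  ebound (fun w => \sum_(i <- r) f i w) (\sum_(i <- r) a i).
Proof.
move=> H; elim: r => [|i r IH].
  rewrite big_nil (_ : (fun w => _) = fun=> 0); last first.
    by apply/funext => w; rewrite big_nil.
  by split => //; rewrite integral0.
rewrite big_cons (_ : (fun w => _) = fun w => f i w + \sum_(j <- r) f j w).
  exact: eboundD.
by apply/funext => w; rewrite big_cons.
Qed.

Lemma ebound_integrable f c : ebound f c -> P.-integrable setT (EFin \o f).
Proof.
move=> [mf f0 fc]; apply/integrableP; split; first exact/measurable_EFinP.
under eq_integral do rewrite /= ger0_norm//.
exact: le_lt_trans fc (ltry _).
Qed.

Lemma ebound_le f a b : a <= b -> ebound f a -> ebound f b.
Proof. by move=> ab [mf f0 fa]; split=> //; apply: le_trans fa _; rewrite lee_fin. Qed.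

Lemma integral_centered_sum (I : Type) (r : seq I) (f : I -> E -> R) :
  (forall i, P.-integrable setT (EFin \o f i) /\ (\int[P]_w (f i w)%:E = 0)%E) ->
  P.-integrable setT (fun w => (\sum_(i <- r) f i w)%:E) /\
  (\int[P]_w (\sum_(i <- r) f i w)%:E = 0)%E.
Proof.
move=> H; elim: r => [|i r [IH1 IH2]].
  rewrite (_ : (fun w => _) = fun=> 0%E); last first.
    by apply/funext => w; rewrite big_nil.
  by split; [exact: integrable0|rewrite integral0].
have [H1 H2] := H i.
rewrite (_ : (fun w => _) = fun w => ((f i w)%:E + (\sum_(j <- r) f j w)%:E)%E).
  split; first exact: integrableD.
  by rewrite integralD// IH2 H2 adde0.
by apply/funext => w; rewrite big_cons EFinD.
Qed.

End expectation_bounds.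

Section moment_step.
Context {disp : measure_display} {Omega : measurableType disp} {R : realType}.
Variables (P : probability Omega R).

Definition mom_le (q k n : nat) (Z : Omega -> 'M[R]_(k, n)) (c : R) : Prop :=
  (\int[P]_w (Phi q (Z w))%:E <= c%:E)%E.

Variables (T : R) (F : R -> set (set Omega)).
Variables (m : nat) (W : R -> Omega -> 'cV[R]_m).
Hypothesis hF : is_filtration T F.
Hypothesis hW : standard_brownian_motion P T F W.

(** The expectation of [step_bound_mx]. The linear term vanishes by [dW_centered], and the powers of
    the increments, divided by [dt ^+ q], contribute the constant [cq]. *)
Lemma one_step (q : nat) : (0 < q)%N ->
  exists2 C : R, 0 <= C &
    forall d h s t (D A : Omega -> 'cV[R]_d) (B : Omega -> 'M[R]_(d, m)) x a b,
    0 <= s -> s < t -> t <= T -> t - s <= h ->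
    rv (F s) D -> rv (F s) A -> rv (F s) B ->
    mom_le q D x -> mom_le q A a -> mom_le q B b ->
    mom_le q (fun w => D w + (t - s) *: A w + B w *m (W t w - W s w))
      ((1 + C * ((t - s) / h)) * x +
       C * ((t - s) / h) * (h ^+ (2 * q) * a + h ^+ q * b)).
Proof.
move=> q0; have [C C0 HC] := @step_bound_mx R q m q0.
pose cq : R := Num.sqrt 2 * q`!%:R * 4 ^+ q.
have cq0 : 0 <= cq by rewrite /cq; nneg.
exists (C * (1 + m%:R * (1 + cq))); first nneg.
move=> d h s t D A B x a b s0 st tT sh mD mA mB Dx Aa Bb.
have sT : 0 <= s <= T by rewrite s0 (le_trans (ltW st) tT).
have dt0 : 0 < t - s by rewrite subr_gt0.
have h0 : 0 < h by exact: lt_le_trans sh.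
have toM f : gmeas (F s) f -> measurable_fun setT f.
  exact: (gmeas_measurable (filtration_measurable hF sT)).
have bD : ebound P (fun w => Phi q (D w)) x.
  by split=> // [|w]; [apply: toM; exact: gmeas_Phi|exact: Phi_ge0].
have bA : ebound P (fun w => Phi q (A w)) a.
  by split=> // [|w]; [apply: toM; exact: gmeas_Phi|exact: Phi_ge0].
have bB : ebound P (fun w => Phi q (B w)) b.
  by split=> // [|w]; [apply: toM; exact: gmeas_Phi|exact: Phi_ge0].
have hq0 : 0 <= h ^+ q by rewrite exprn_ge0// ltW.
have h2q0 : 0 <= h ^+ (2 * q) by nneg.
pose r := C * ((t - s) / h).
have r0 : 0 <= r by rewrite /r mulr_ge0// divr_ge0// ltW.
(* [psi] is known at time [s] and multiplies only powers of the increment, so [dW_moment] separates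
   the two. *)
pose psi w := Phi q (D w) + h ^+ q * Phi q (B w).
have bpsi : ebound P psi (x + h ^+ q * b) by apply: eboundD => //; exact: eboundZ.
have mpsi : gmeas (F s) psi.
  apply: measurable_funD; first exact: gmeas_Phi.
  by apply: measurable_funM => //; exact: gmeas_Phi.
have bk k : ebound P (fun w => psi w * (1 + (W t w - W s w) k 0 ^+ (2 * q) / (t - s) ^+ q))
    ((x + h ^+ q * b) * (1 + cq)).
  rewrite (_ : (fun w => _) = fun w => psi w + (t - s) ^- q *
      (psi w * (W t w - W s w) k 0 ^+ (2 * q))); last first.
    by apply/funext => w; rewrite mulrDr mulr1 [in RHS]mulrC mulrA.
  rewrite mulrDr mulr1; apply: eboundD => //.
  have -> : (x + h ^+ q * b) * cq = (t - s) ^- q * ((x + h ^+ q * b) * (cq * (t - s) ^+ q)).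
    by rewrite [RHS]mulrC !mulrA mulfK// expf_neq0// gt_eqF.
  apply: eboundZ; first by rewrite invr_ge0 exprn_ge0// ltW.
  have [mp p0 ip] := bpsi; split.
  - apply: measurable_funM => //; apply: measurable_funX.
    have tT' : 0 <= t <= T by rewrite tT (le_trans s0 (ltW st)).
    apply: (gmeas_measurable (filtration_measurable hF tT')).
    exact: (rv_dW hF hW s0 (ltW st) tT).
  - by move=> w; rewrite mulr_ge0// even_pow_ge0.
  - exact: (dW_moment hF hW).
pose G w := Phi q (D w) + r * (Phi q (D w) + h ^+ (2 * q) * Phi q (A w) +
  \sum_k psi w * (1 + (W t w - W s w) k 0 ^+ (2 * q) / (t - s) ^+ q)).
have bG : ebound P G (x + r * (x + h ^+ (2 * q) * a +
    \sum_(k < m) (x + h ^+ q * b) * (1 + cq))).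
  apply: eboundD => //; apply: eboundZ => //; apply: eboundD.
    by apply: eboundD => //; exact: eboundZ.
  exact: ebound_sum.
pose phi k w := \sum_i (2 * q)%:R * D w i 0 ^+ (2 * q).-1 * B w i k.
have mphi k : gmeas (F s) (phi k).
  apply: measurable_sum => i; apply: measurable_funM; last exact: mB.
  by apply: measurable_funM => //; apply: measurable_funX; exact: mD.
(* By [young_pow], [|D ^+ (2 * q).-1 * B|] is at most [D ^+ (2 * q) + B ^+ (2 * q)] entrywise, so
   the assumed moments make the coefficient integrable. *)
have iphi k : P.-integrable setT (EFin \o phi k).
  have := eboundZ (ler0n R (2 * q)) (eboundD bD bB).
  move=> /ebound_integrable; apply: le_integrable => //.
    by apply/measurable_EFinP; exact: toM.
  move=> w _ /=; rewrite lee_fin.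
  rewrite [leRHS]ger0_norm; last by rewrite mulr_ge0// addr_ge0 ?Phi_ge0.
  rewrite /phi; under eq_bigr do rewrite -mulrA.
  rewrite -mulr_sumr normrM ger0_norm// ler_wpM2l//.
  apply: le_trans (ler_norm_sum _ _ _) _.
  rewrite /Phi -big_split/=; apply: ler_sum => i _.
  rewrite big_ord1 (bigD1 k)//= addrA.
  apply: (@le_trans _ _ (D w i 0 ^+ (2 * q) + B w i k ^+ (2 * q))); last first.
    by rewrite lerDl; nneg.
  rewrite normrM normrX.
  have := @young_pow R (2 * q) 1 (D w i 0) (B w i k).
  rewrite subn1 expr1 muln_gt0/= => /(_ q0) H; apply: le_trans H _.
  by rewrite -!normrX !ger0_norm ?even_pow_ge0.
have [iL L0] := integral_centered_sum (P := P) (index_enum 'I_m)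
  (fun k => dW_centered hF hW k s0 st tT (mphi k) (iphi k)).
have iG := ebound_integrable bG.
apply: (@le_trans _ _ (\int[P]_w ((G w)%:E +
    (\sum_k phi k w * (W t w - W s w) k 0)%:E))%E).
  apply: ge0_le_integral_nonmeas => w; first by rewrite lee_fin Phi_ge0.
  rewrite -EFinD lee_fin; apply: le_trans (HC _ _ _ _ _ _ _ dt0 sh) _.
  by rewrite /G /r addrAC.
rewrite integralD// L0 adde0.
have [_ _ /le_trans] := bG; apply; rewrite lee_fin.
rewrite sumr_const card_ord -[_ *+ m]mulr_natl.
have -> : C * (1 + m%:R * (1 + cq)) * ((t - s) / h) = r * (1 + m%:R * (1 + cq)).
  by rewrite /r; ring.
have a0 : 0 <= a by have [_ f0 fa] := bA; rewrite -lee_fin (le_trans _ fa)// integral_ge0// => w _; rewrite lee_fin.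
rewrite -subr_ge0.
have -> : (1 + r * (1 + m%:R * (1 + cq))) * x + r * (1 + m%:R * (1 + cq)) *
    (h ^+ (2 * q) * a + h ^+ q * b) - (x + r * (x + h ^+ (2 * q) * a +
    m%:R * ((x + h ^+ q * b) * (1 + cq)))) =
    r * (h ^+ q * b) + r * (m%:R * (1 + cq)) * (h ^+ (2 * q) * a) by ring.
have b0 : 0 <= b by have [_ f0 fa] := bB; rewrite -lee_fin (le_trans _ fa)// integral_ge0// => w _; rewrite lee_fin.
nneg.
Qed.

End moment_step.

Section ebound_extra.
Context {d : measure_display} {E : measurableType d} {R : realType}.
Variable P : probability E R.

Lemma ebound_cst (c : R) : 0 <= c -> ebound P (fun=> c) c.
Proof.
move=> c0; split => //.
have -> : (\int[P]_w c%:E = c%:E)%E; last by [].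
by rewrite integral_cst//= probability_setT mule1.
Qed.

Lemma ebound_ge0 f c : ebound P f c -> 0 <= c.
Proof.
move=> [_ f0 fc]; rewrite -lee_fin (le_trans _ fc)// integral_ge0// => w _.
by rewrite lee_fin.
Qed.

Lemma ebound_markov f (c e : R) : 0 < e -> ebound P f c ->
  (P [set w | (e < f w)%R] <= (c / e)%:E)%E.
Proof.
move=> e0 [mf f0 fc].
have mA : measurable [set w | e < f w] by exact: measurable_superlevel.
rewrite EFinM lee_pdivlMr// muleC.
apply: le_trans fc.
have -> : P [set w | e < f w] = (\int[P]_w (\1_[set w | e < f w] w)%:E)%E.
  by rewrite integral_indic// setIT.
rewrite -ge0_integralZl ?lee_fin ?(ltW e0)//; first last.
  by apply/measurable_EFinP; exact: measurable_indic.
apply: ge0_le_integral_nonmeas => w; rewrite -EFinM lee_fin.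
  by rewrite mulr_ge0// ltW.
rewrite indicE; case: (boolP (w \in _)) => [/set_mem /= ew|_].
  by rewrite mulr1 ltW.
by rewrite mulr0.
Qed.

Lemma ebound_Phi q k n (Z : E -> 'M[R]_(k, n)) c : rv measurable Z ->
  mom_le P q Z c -> ebound P (fun w => Phi q (Z w)) c.
Proof.
by move=> mZ Zc; split => // [|w]; [exact: rv_measurable_Phi|exact: Phi_ge0].
Qed.

Lemma mom_le_dom q k n (Z : E -> 'M[R]_(k, n)) (g : E -> R) c :
  (forall w, Phi q (Z w) <= g w) -> ebound P g c -> mom_le P q Z c.
Proof.
move=> Zg [_ _ gc]; apply: le_trans gc; apply: ge0_le_integral_nonmeas => w.
  by rewrite lee_fin Phi_ge0.
by rewrite lee_fin.
Qed.

Lemma mom_le_ge0 q k n (Z : E -> 'M[R]_(k, n)) c : mom_le P q Z c -> 0 <= c.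
Proof.
move=> Zc; rewrite -lee_fin (le_trans _ Zc)// integral_ge0// => w _.
by rewrite lee_fin Phi_ge0.
Qed.

Lemma mom_le_trans q k n (Z : E -> 'M[R]_(k, n)) a b : a <= b ->
  mom_le P q Z a -> mom_le P q Z b.
Proof. by move=> ab Za; apply: le_trans Za _; rewrite lee_fin. Qed.

Lemma mom_le0 q k n : (0 < q)%N -> mom_le P q (fun=> 0 : 'M[R]_(k, n)) 0.
Proof.
move=> q0; rewrite /mom_le; under eq_integral do rewrite Phi0//.
by rewrite integral0.
Qed.

Lemma mom_leD q k n (Z1 Z2 : E -> 'M[R]_(k, n)) a b :
  rv measurable Z1 -> rv measurable Z2 -> mom_le P q Z1 a -> mom_le P q Z2 b ->
  mom_le P q (fun w => Z1 w + Z2 w) (2 ^+ (2 * q) * (a + b)).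
Proof.
move=> m1 m2 Za Zb; apply: (mom_le_dom (fun w => PhiD_le q (Z1 w) (Z2 w))).
by apply: eboundZ; [nneg|apply: eboundD; exact: ebound_Phi].
Qed.

Lemma mom_le_lipschitz q (k1 n1 n2 : nat) (f : 'cV[R]_k1 -> 'M[R]_(n1, n2)) C
    (Z1 Z2 : E -> 'cV[R]_k1) a :
  0 <= C -> (forall x y, Phi q (f x - f y) <= C * Phi q (x - y)) ->
  rv measurable Z1 -> rv measurable Z2 ->
  mom_le P q (fun w => Z1 w - Z2 w) a ->
  mom_le P q (fun w => f (Z1 w) - f (Z2 w)) (C * a).
Proof.
move=> C0 HC m1 m2 Za; apply: (mom_le_dom (fun w => HC (Z1 w) (Z2 w))).
by apply: eboundZ => //; apply: ebound_Phi => //; exact: rvB.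
Qed.

End ebound_extra.

Lemma one_plus_pow_le_expR (R : realType) (k : R) (K i : nat) : 0 <= k ->
  (i <= K)%N -> (1 + k / K%:R) ^+ i <= expR k.
Proof.
(* For [K = 0] the quotient [k / 0] is 0 by convention and the base is 1. *)
move=> k0 iK; have [->|K0] := posnP K.
  by rewrite invr0 mulr0 addr0 expr1n -expR0 ler_expR.
have kK : 0 <= k / K%:R by rewrite divr_ge0.
apply: (@le_trans _ _ ((1 + k / K%:R) ^+ K)).
  by rewrite ler_weXn2l// lerDl.
apply: (@le_trans _ _ (expR (k / K%:R) ^+ K)).
  by rewrite lerXn2r ?nnegrE ?expR_ge0 ?addr_ge0// expR_ge1Dx.
by rewrite -expRM_natr divfK// pnatr_eq0 -lt0n.
Qed.

(** * Discrete Gronwall inequality for moments *)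

Section gronwall.
Context {disp : measure_display} {Omega : measurableType disp} {R : realType}.
Variables (P : probability Omega R) (T : R) (F : R -> set (set Omega)).
Variables (m : nat) (W : R -> Omega -> 'cV[R]_m).
Hypothesis hF : is_filtration T F.
Hypothesis hW : standard_brownian_motion P T F W.

(** The coefficients usually are functions of the current state, so their measurability is asked for
    only once that of [D i] is known. *)
Lemma rv_scheme d K (tau : nat -> R) (dt : R) (D A : nat -> Omega -> 'cV[R]_d)
    (B : nat -> Omega -> 'M[R]_(d, m)) :
  0 <= tau 0%N -> tau K <= T -> 0 <= dt ->
  (forall i, (i < K)%N -> tau i.+1 = tau i + dt) ->
  rv (F (tau 0%N)) (D 0%N) ->
  (forall i, (i < K)%N -> rv (F (tau i)) (D i) ->
     rv (F (tau i)) (A i) /\ rv (F (tau i)) (B i)) ->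
  (forall i w, (i < K)%N -> D i.+1 w =
     D i w + dt *: A i w + B i w *m (W (tau i.+1) w - W (tau i) w)) ->
  forall i, (i <= K)%N -> [/\ 0 <= tau i, tau i <= T & rv (F (tau i)) (D i)].
Proof.
move=> t0 tK dt0 tauS D0 AB DS.
have tau_ge0 i : (i <= K)%N -> 0 <= tau i.
  elim: i => // i IH iK; rewrite tauS// addr_ge0//; exact: IH (ltnW iK).
have tau_le i : (i <= K)%N -> tau i <= tau K.
  move=> iK; rewrite -(subnK iK); have : (K - i + i <= K)%N by rewrite subnK.
  elim: (K - i)%N => // n IH niK; rewrite addSn tauS//.
  by apply: le_trans (IH (ltnW niK)) _; rewrite lerDl.
have tauT i : (i <= K)%N -> tau i <= T by move=> iK; exact: le_trans (tau_le i iK) tK.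
move=> i iK; split; [exact: tau_ge0|exact: tauT|].
elim: i iK => // i IH iK; have Di := IH (ltnW iK).
have [rA rB] := AB i iK Di.
have tt : tau i <= tau i.+1 by rewrite tauS// lerDl.
have ti := tau_ge0 i (ltnW iK).
rewrite (_ : D i.+1 = fun w => D i w + dt *: A i w + B i w *m (W (tau i.+1) w - W (tau i) w)); last first.
  by apply/funext => w; exact: DS.
have up p q (Z : Omega -> 'M[R]_(p, q)) : rv (F (tau i)) Z -> rv (F (tau i.+1)) Z.
  by move=> rZ; apply: (rv_filtration_le hF ti tt _ rZ); exact: tauT.
apply: rvD; first by apply: rvD; [exact: up|apply: rvZ; exact: up].
apply: rvM; first exact: up.
by apply: (rv_dW hF hW) => //; exact: tauT.
Qed.

(* [fl i] is the index at which the coefficients of step [i] were frozen, so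
   their moments are controlled by those of an earlier [D]. *)
Lemma gronwall_frozen (q : nat) (c : R) : (0 < q)%N -> 0 <= c ->
  exists2 C : R, 0 <= C & forall d K (tau : nat -> R) (dt b : R) (fl : nat -> nat)
    (D A : nat -> Omega -> 'cV[R]_d) (B : nat -> Omega -> 'M[R]_(d, m)),
  0 <= tau 0%N -> tau K <= T -> 0 < dt -> 0 <= b ->
  (forall i, (i < K)%N -> tau i.+1 = tau i + dt) ->
  (forall i, (i < K)%N -> (fl i <= i)%N) ->
  rv (F (tau 0%N)) (D 0%N) ->
  (forall i, (i < K)%N -> rv (F (tau i)) (D i) ->
     rv (F (tau i)) (A i) /\ rv (F (tau i)) (B i)) ->
  (forall i w, (i < K)%N -> D i.+1 w =
     D i w + dt *: A i w + B i w *m (W (tau i.+1) w - W (tau i) w)) ->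
  mom_le P q (D 0%N) b ->
  (forall i x, (i < K)%N -> 0 <= x -> mom_le P q (D (fl i)) x ->
     mom_le P q (A i) (c * (b + x) / (K%:R * dt) ^+ (2 * q)) /\
     mom_le P q (B i) (c * (b + x) / (K%:R * dt) ^+ q)) ->
  forall i, (i <= K)%N -> mom_le P q (D i) (C * b).
Proof.
move=> q0 c0; have [C1 C10 HC] := one_step hF hW q0.
(* As [b <= z i], the two coefficient bounds add at most [2 * c * (b + z i) <= 4 * c * z i], with
   weight [C1 / K]; each step multiplies the bound by at most [1 + kap / K]. *)
pose kap := C1 * (1 + 4 * c).
have kap0 : 0 <= kap by rewrite /kap; nneg.
exists (expR kap); first exact: expR_ge0.
move=> d K tau dt b fl D A B t0 tK dt0 b0 tauS flP rD0 rAB DS D0 DAB.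
pose z i := b * (1 + kap / K%:R) ^+ i.
have kK0 : 0 <= kap / K%:R by nneg.
have zb i : b <= z i by rewrite /z ler_peMr// exprn_ege1// lerDl.
have z_mono i j : (i <= j)%N -> z i <= z j.
  by move=> ij; rewrite /z ler_wpM2l// ler_weXn2l// lerDl.
have rvD := rv_scheme t0 tK (ltW dt0) tauS rD0 rAB DS.
suff main i : (i <= K)%N -> mom_le P q (D i) (z i).
  move=> i iK; apply: (mom_le_trans _ (main i iK)).
  by rewrite /z mulrC ler_wpM2r// one_plus_pow_le_expR.
(* Strong induction, because step [i] refers to the bound at the earlier index [fl i]; [z] is
   nondecreasing, so that bound can be weakened to [z i]. *)
elim/ltn_ind: i => -[_ _|i IH iK]; first by rewrite /z expr0 mulr1.
have Di := IH i (ltnSn i) (ltnW iK).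
have fi := flP i iK.
have Dfi : mom_le P q (D (fl i)) (z i).
  apply: (mom_le_trans (z_mono _ _ fi)); apply: IH; first by rewrite ltnS.
  exact: leq_trans fi (ltnW iK).
have [Ai Bi] := DAB i (z i) iK (le_trans b0 (zb i)) Dfi.
have [ti0 tiT rDi] := rvD i (ltnW iK).
have [_ ti1T _] := rvD i.+1 iK.
have [rA rB] := rAB i iK rDi.
have K0 : (0 < K)%N by exact: leq_ltn_trans iK.
have KR0 : 0 < K%:R :> R by rewrite ltr0n.
have h0 : 0 < K%:R * dt by rewrite mulr_gt0.
have tlt : tau i < tau i.+1 by rewrite tauS// ltrDl.
have tdt : tau i.+1 - tau i = dt by rewrite tauS// addrC addKr.
have dth : tau i.+1 - tau i <= K%:R * dt by rewrite tdt ler_peMl ?ler1n// ltW.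
have := HC d (K%:R * dt) (tau i) (tau i.+1) (D i) (A i) (B i) _ _ _ ti0 tlt ti1T dth rDi rA rB Di Ai Bi.
rewrite tdt; under eq_fun do rewrite -DS//.
apply: mom_le_trans.
have -> : dt / (K%:R * dt) = K%:R^-1 by field; rewrite !gt_eqF.
have hq : (K%:R * dt) ^+ q != 0 by rewrite expf_neq0// gt_eqF.
have h2q : (K%:R * dt) ^+ (2 * q) != 0 by rewrite expf_neq0// gt_eqF.
have cancel X : X != 0 -> X * (c * (b + z i) / X) = c * (b + z i).
  by move=> X0; rewrite mulrC divfK.
rewrite !cancel//.
have -> : z i.+1 = (1 + kap * K%:R^-1) * z i by rewrite /z exprSr; ring.
have Ki0 : 0 <= K%:R^-1 :> R by rewrite invr_ge0.
rewrite -subr_ge0 /kap.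
have -> : (1 + C1 * (1 + 4 * c) * K%:R^-1) * z i -
   ((1 + C1 * K%:R^-1) * z i +
    C1 * K%:R^-1 * (c * (b + z i) + c * (b + z i))) =
   2 * (C1 * K%:R^-1 * c * (z i - b)) by ring.
have : 0 <= z i - b by rewrite subr_ge0.
by move=> zb0; nneg.
Qed.

End gronwall.

(** * Moments of the Euler scheme *)

Section euler.
Context {disp : measure_display} {Omega : measurableType disp} {R : realType}.
Variables (P : probability Omega R) (T : R) (F : R -> set (set Omega)).
Variables (d m : nat) (W : R -> Omega -> 'cV[R]_m).
Hypotheses (T0 : 0 < T) (hF : is_filtration T F).
Hypothesis hW : standard_brownian_motion P T F W.
Variables (mu : 'cV[R]_d -> 'cV[R]_d) (sigma : 'cV[R]_d -> 'M[R]_(d, m)).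
Hypotheses (hmu : globally_lipschitz mu) (hsigma : globally_lipschitz sigma).
Variable (X0 : Omega -> 'cV[R]_d).
Hypothesis rX0 : rv (F 0) X0.

Definition grid (K i : nat) : R := i%:R * T / K%:R.

Definition dW (K i : nat) (w : Omega) : 'cV[R]_m :=
  W (grid K i.+1) w - W (grid K i) w.

Fixpoint euler (K i : nat) (w : Omega) : 'cV[R]_d :=
  if i is j.+1 then
    euler K j w + (T / K%:R) *: mu (euler K j w) + sigma (euler K j w) *m dW K j w
  else X0 w.

Lemma grid0 K : grid K 0 = 0.
Proof. by rewrite /grid !mul0r. Qed.

Lemma gridK K : (0 < K)%N -> grid K K = T.
Proof. by move=> K0; rewrite /grid mulrC mulKf// pnatr_eq0 -lt0n. Qed.

Lemma gridS K i : grid K i.+1 = grid K i + T / K%:R.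
Proof. by rewrite /grid -natr1; ring. Qed.

Lemma gridD K i j : grid K (i + j) = grid K i + j%:R * (T / K%:R).
Proof. by rewrite /grid natrD; ring. Qed.

Lemma grid_ge0 K i : 0 <= grid K i.
Proof. by rewrite /grid divr_ge0// mulr_ge0// ltW. Qed.

Lemma grid_le K i j : (i <= j)%N -> grid K i <= grid K j.
Proof.
move=> ij; rewrite /grid ler_wpM2r ?invr_ge0// ler_wpM2r ?ler_nat//.
exact: ltW.
Qed.

Lemma grid_leT K i : (0 < K)%N -> (i <= K)%N -> grid K i <= T.
Proof. by move=> K0 iK; rewrite -(gridK K0) grid_le. Qed.

Lemma grid_refine N M i : (0 < M)%N -> grid (N * M) (i * M) = grid N i.
Proof.
move=> M0; rewrite /grid !natrM.
have [->|N0] := eqVneq (N%:R : R) 0; first by rewrite mul0r invr0 !mulr0.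
by field; rewrite N0 pnatr_eq0 -lt0n M0.
Qed.

Lemma rv_drift G (Z : Omega -> 'cV[R]_d) : rv G Z -> rv G (fun w => mu (Z w)).
Proof. exact: rv_lipschitz. Qed.

Lemma rv_diffusion G (Z : Omega -> 'cV[R]_d) : rv G Z -> rv G (fun w => sigma (Z w)).
Proof. exact: rv_lipschitz. Qed.

Lemma rv_euler K i : (0 < K)%N -> (i <= K)%N -> rv (F (grid K i)) (euler K i).
Proof.
move=> K0 iK.
have dt0 : 0 <= T / K%:R by rewrite divr_ge0// ltW.
suff : [/\ 0 <= grid K i, grid K i <= T & rv (F (grid K i)) (euler K i)] by case.
apply: (rv_scheme (dt := T / K%:R) (A := fun i w => mu (euler K i w))
  (B := fun i w => sigma (euler K i w)) hF hW _ _ dt0 _ _ _ _ iK).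
- by rewrite grid0.
- by rewrite gridK.
- by move=> j _; rewrite gridS.
- by rewrite grid0.
- by move=> j _ rj; split; [exact: rv_drift|exact: rv_diffusion].
- by [].
Qed.

Lemma rv_euler_measurable K i : (0 < K)%N -> (i <= K)%N -> rv measurable (euler K i).
Proof.
move=> K0 iK; apply: (rv_filtration hF _ (rv_euler K0 iK)).
by rewrite grid_ge0 grid_leT.
Qed.

Section fixed_exponent.
Variables (q : nat) (c0 : R).
Hypotheses (q0 : (0 < q)%N) (X0c : mom_le P q X0 c0).

(** A Lipschitz map grows at most linearly: compare [f (Z w)] with [f 0]. *)
Lemma linear_growth p (f : 'cV[R]_d -> 'M[R]_(d, p)) : globally_lipschitz f ->
  exists2 C : R, 0 <= C & forall (Z : Omega -> 'cV[R]_d) x,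
    rv measurable Z -> mom_le P q Z x -> mom_le P q (fun w => f (Z w)) (C * (1 + x)).
Proof.
move=> /(Phi_lipschitz q0)[L L0 HL].
pose a := Phi q (f 0); have a0 : 0 <= a by exact: Phi_ge0.
exists (2 ^+ (2 * q) * (L + a)); first nneg.
move=> Z x mZ Zx.
have bZ := ebound_Phi mZ Zx; have x0 := ebound_ge0 bZ.
apply: (mom_le_trans (a := 2 ^+ (2 * q) * (L * x + a))).
  by rewrite -mulrA ler_wpM2l ?exprn_ge0//; nra.
apply: (@mom_le_dom _ _ _ _ _ _ _ _ (fun w => 2 ^+ (2 * q) * (L * Phi q (Z w) + a))).
  move=> w; rewrite -[f (Z w)](subrK (f 0)); apply: le_trans (PhiD_le _ _ _) _.
  rewrite ler_wpM2l ?exprn_ge0// lerD2r; apply: le_trans (HL _ _) _.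
  by rewrite subr0.
apply: eboundZ; first nneg.
by apply: eboundD; [exact: eboundZ|exact: ebound_cst].
Qed.

Lemma euler_moment : exists2 C : R, 0 <= C &
  forall K i, (0 < K)%N -> (i <= K)%N -> mom_le P q (euler K i) C.
Proof.
have [Cm Cm0 Hm] := linear_growth hmu.
have [Cs Cs0 Hs] := linear_growth hsigma.
(* The powers of [T] compensate the divisions by [(K * dt) ^+ (2 * q)] and [(K * dt) ^+ q], since
   [K * dt = T] here. *)
pose c := Cm * T ^+ (2 * q) + Cs * T ^+ q.
have Tn0 := ltW T0.
have c_ge0 : 0 <= c by rewrite /c; nneg.
have [C C0 HC] := gronwall_frozen hF hW q0 c_ge0.
have c00 : 0 <= c0 by exact: mom_le_ge0 X0c.
(* The added 1 lets [b = c0 + 1] dominate the constant in the linear growth bound: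
   [1 + x <= b + x]. *)
exists (C * (c0 + 1)); first nneg.
move=> K i K0 iK.
have KT : K%:R * (T / K%:R) = T by rewrite mulrC divfK// pnatr_eq0 -lt0n.
apply: (HC d K (grid K) (T / K%:R) (c0 + 1) id (euler K)
  (fun i w => mu (euler K i w)) (fun i w => sigma (euler K i w))) => //.
- by rewrite grid0.
- by rewrite gridK.
- by rewrite divr_gt0// ltr0n.
- by rewrite addr_ge0.
- by move=> j _; rewrite gridS.
- by rewrite grid0.
- by move=> j _ rj; split; [exact: rv_drift|exact: rv_diffusion].
- by apply: (mom_le_trans _ X0c); rewrite lerDl.
move=> j x jK x0 Dx; rewrite KT.
have mj := rv_euler_measurable K0 (ltnW jK).
split.
- apply: (mom_le_trans _ (Hm _ _ mj Dx)).
  rewrite ler_pdivlMr ?exprn_gt0// mulrAC ler_pM//; [nneg|nneg| |].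
    by rewrite /c lerDl; nneg.
  by rewrite lerD2r lerDr.
- apply: (mom_le_trans _ (Hs _ _ mj Dx)).
  rewrite ler_pdivlMr ?exprn_gt0// mulrAC ler_pM//; [nneg|nneg| |].
    by rewrite /c lerDr; nneg.
  by rewrite lerD2r lerDr.
Qed.

(** The scheme restarted at node [i], minus its value there, starts from 0 and has coefficients with
    bounded moments by [euler_moment]. Gronwall is then run with the target order itself as [b]. *)
Lemma euler_increment_moment : exists2 C : R, 0 <= C &
  forall K i j, (0 < K)%N -> (i + j <= K)%N ->
  mom_le P q (fun w => euler K (i + j) w - euler K i w) (C * (j%:R / K%:R) ^+ q).
Proof.
have [C0 C00 H0] := euler_moment.
have [Cm Cm0 Hm] := linear_growth hmu.
have [Cs Cs0 Hs] := linear_growth hsigma.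
have Tn0 := ltW T0.
pose c := (Cm + Cs) * (1 + C0) * (1 + T ^+ q).
have c_ge0 : 0 <= c by rewrite /c; nneg.
have [C C_ge0 HC] := gronwall_frozen hF hW q0 c_ge0.
exists (C * T ^+ q); first nneg.
move=> K i j K0 ijK.
have [->|j0] := posnP j.
  rewrite addn0 mul0r expr0n gtn_eqF// mulr0.
  under eq_fun do rewrite subrr; exact: mom_le0.
(* With elapsed time [h], [b = h ^+ q] and [h ^+ (2 * q) = b * b]. Constant coefficient bounds must
   fit under [c * (b + x) / b] and [c * (b + x) / (b * b)]; the factor [1 + T ^+ q] in [c] ensures
   this, as [b <= T ^+ q]. Division by [b] is why [j = 0] was treated apart. *)
pose b := (j%:R * (T / K%:R)) ^+ q.
have dt0 : 0 < T / K%:R by rewrite divr_gt0// ltr0n.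
have h0 : 0 < j%:R * (T / K%:R) by rewrite mulr_gt0// ltr0n.
have b0 : 0 < b by rewrite exprn_gt0.
have -> : C * T ^+ q * (j%:R / K%:R) ^+ q = C * b.
  by rewrite /b -mulrA -exprMn; congr (_ * _ ^+ _); ring.
have bT : b <= T ^+ q.
  rewrite /b; apply: lerXn2r; rewrite ?nnegrE; [exact: ltW|exact: ltW|].
  rewrite mulrCA ger_pMr// ler_pdivrMr ?ltr0n// mul1r.
  by rewrite ler_nat (leq_trans (leq_addl i j)).
have rE l : (l <= j)%N -> rv measurable (euler K (i + l)).
  by move=> lj; apply: rv_euler_measurable => //; apply: leq_trans ijK; rewrite leq_add2l.
apply: (HC d j (fun l => grid K (i + l)) (T / K%:R) b id
  (fun l w => euler K (i + l) w - euler K i w)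
  (fun l w => mu (euler K (i + l) w)) (fun l w => sigma (euler K (i + l) w))) => //.
- by rewrite grid_ge0.
- by rewrite grid_leT.
- exact: ltW.
- by move=> l _; rewrite addnS gridS.
- by rewrite addn0; under eq_fun do rewrite subrr; exact: rv_cst.
- move=> l lj _.
  have rl : rv (F (grid K (i + l))) (euler K (i + l)).
    apply: rv_euler => //; apply: leq_trans ijK; rewrite leq_add2l; exact: ltnW.
  by split; [exact: rv_drift|exact: rv_diffusion].
- by move=> l w lj; rewrite addnS /= /dW; rewrite -!addrA [- _ + _]addrC !addrA.
- by rewrite addn0; under eq_fun do rewrite subrr; apply: (mom_le_trans (ltW b0)); exact: mom_le0.
move=> l x lj x0 _.
have lK : (i + l <= K)%N by apply: leq_trans ijK; rewrite leq_add2l ltnW.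
have b1 : 1 <= (1 + T ^+ q) / b by rewrite ler_pdivlMr// mul1r (le_trans bT)// lerDr.
have bb : (j%:R * (T / K%:R)) ^+ (2 * q) = b * b by rewrite mul2n -addnn exprD.
have key : (Cm + Cs) * (1 + C0) <= c * (b + x) / (b * b).
  have -> : c * (b + x) / (b * b) = (Cm + Cs) * (1 + C0) * ((1 + T ^+ q) / b * ((b + x) / b)).
    by rewrite /c; field; rewrite gt_eqF.
  apply: ler_peMr; first nneg.
  by apply: mulr_ege1 => //; rewrite ler_pdivlMr// mul1r lerDl.
have key2 : (Cm + Cs) * (1 + C0) <= c * (b + x) / b.
  have -> : c * (b + x) / b = (Cm + Cs) * (1 + C0) * ((1 + T ^+ q) * ((b + x) / b)).
    by rewrite /c; field; rewrite gt_eqF.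
  apply: ler_peMr; first nneg.
  apply: mulr_ege1; first by rewrite lerDl; nneg.
  by rewrite ler_pdivlMr// mul1r lerDl.
rewrite bb; split.
- apply: (mom_le_trans _ (Hm _ _ (rE l (ltnW lj)) (H0 K _ K0 lK))).
  by apply: le_trans key; rewrite ler_wpM2r ?lerDl// addr_ge0.
- apply: (mom_le_trans _ (Hs _ _ (rE l (ltnW lj)) (H0 K _ K0 lK))).
  by apply: le_trans key2; rewrite ler_wpM2r ?lerDr// addr_ge0.
Qed.

End fixed_exponent.
End euler.

(** * The Euler scheme under refinement of the grid *)

Section refinement.
Context {disp : measure_display} {Omega : measurableType disp} {R : realType}.
Variables (P : probability Omega R) (T : R) (F : R -> set (set Omega)).
Variables (d m : nat) (W : R -> Omega -> 'cV[R]_m).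
Hypotheses (T0 : 0 < T) (hF : is_filtration T F).
Hypothesis hW : standard_brownian_motion P T F W.
Variables (mu : 'cV[R]_d -> 'cV[R]_d) (sigma : 'cV[R]_d -> 'M[R]_(d, m)).
Hypotheses (hmu : globally_lipschitz mu) (hsigma : globally_lipschitz sigma).
Variable (X0 : Omega -> 'cV[R]_d).
Hypothesis rX0 : rv (F 0) X0.

Local Notation grid := (grid T).
Local Notation dW := (dW T W).
Local Notation euler := (euler T W mu sigma X0).

(** The coarse scheme continued between its nodes along the fine Brownian increments, its
    coefficients frozen at the last coarse node. It is not the interpolation [Y], which is affine
    there and not adapted. *)
Fixpoint frozen (N M i : nat) (w : Omega) : 'cV[R]_d :=
  if i is j.+1 then
    frozen N M j w + (T / (N * M)%:R) *: mu (euler N (j %/ M) w) +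
    sigma (euler N (j %/ M) w) *m dW (N * M) j w
  else X0 w.

(** Inside a coarse cell the coefficients are constant, so the fine time steps and increments
    telescope to the coarse ones. *)
Lemma frozen_coarse N M j w : (0 < N)%N -> (0 < M)%N ->
  frozen N M (j * M) w = euler N j w.
Proof.
move=> N0 M0.
have step k : frozen N M (k * M) w = euler N k w -> forall l, (l <= M)%N ->
    frozen N M (k * M + l) w = euler N k w +
      (l%:R * (T / (N * M)%:R)) *: mu (euler N k w) +
      sigma (euler N k w) *m (W (grid (N * M) (k * M + l)) w - W (grid (N * M) (k * M)) w).
  move=> Hk; elim=> [_|l IH lM].
    by rewrite addn0 Hk mul0r scale0r subrr mulmx0 !addr0.
  rewrite addnS /= IH ?(ltnW lM)// divnMDl// divn_small// addn0 -natr1.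
  rewrite mulrDl mul1r scalerDl.
  have -> : W (grid (N * M) (k * M + l).+1) w - W (grid (N * M) (k * M)) w =
      (W (grid (N * M) (k * M + l)) w - W (grid (N * M) (k * M)) w) +
      dW (N * M) (k * M + l) w by rewrite /dW [RHS]addrC subrKA.
  rewrite [in RHS]mulmxDr [RHS]addrA; congr (_ + _).
  by rewrite [LHS]addrAC -[in LHS](addrA (euler N k w)).
elim: j => [|j IH]; first by rewrite mul0n.
rewrite mulSn addnC step// /= /dW (grid_refine _ _ _ M0).
rewrite -[X in grid _ X]mulSnr (grid_refine _ _ _ M0).
congr (_ + _ *: _ + _).
rewrite natrM; field.
by rewrite !pnatr_eq0 -!lt0n N0 M0.
Qed.

Lemma coarse_lt N M i : (0 < M)%N -> (i < N * M)%N -> (i %/ M < N)%N.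
Proof. by move=> M0; rewrite ltn_divLR. Qed.

Lemma rv_euler_coarse N M i : (0 < N)%N -> (0 < M)%N -> (i < N * M)%N ->
  rv (F (grid (N * M) i)) (euler N (i %/ M)).
Proof.
move=> N0 M0 iNM; have iN := ltnW (coarse_lt M0 iNM).
apply: (rv_filtration_le hF _ _ _ (rv_euler T0 hF hW hmu hsigma rX0 N0 iN)).
- exact: grid_ge0.
- by rewrite -(grid_refine _ _ _ M0) grid_le// leq_trunc_div.
- by rewrite grid_leT// ?muln_gt0 ?N0// ltnW.
Qed.

Section fixed_exponent.
Variables (q : nat) (c0 : R).
Hypotheses (q0 : (0 < q)%N) (X0c : mom_le P q X0 c0).

(* The refined scheme is compared with the coarse coefficients run along the
   fine Brownian increments, so both sides are driven by the same noise. *)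
Lemma euler_refinement_moment : exists2 C : R, 0 <= C &
  forall N M j, (0 < N)%N -> (0 < M)%N -> (j <= N)%N ->
  mom_le P q (fun w => euler (N * M) (j * M) w - euler N j w) (C * N%:R ^- q).
Proof.
have [C1 C10 H1] := euler_increment_moment T0 hF hW hmu hsigma rX0 q0 X0c.
have [Lm Lm0 Hm] := Phi_lipschitz q0 hmu.
have [Ls Ls0 Hs] := Phi_lipschitz q0 hsigma.
have Tn0 := ltW T0.
pose c2 := 2 ^+ (2 * q) * (C1 + 1).
pose c := (Lm + Ls) * c2 * (T ^+ (2 * q) + T ^+ q).
have c20 : 0 <= c2 by rewrite /c2; nneg.
have c_ge0 : 0 <= c by rewrite /c; nneg.
have [C C_ge0 HC] := gronwall_frozen hF hW q0 c_ge0.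
exists C => // N M j N0 M0 jN.
pose K := (N * M)%N; have K0 : (0 < K)%N by rewrite muln_gt0 N0.
have KR0 : 0 < K%:R :> R by rewrite ltr0n.
have KT : K%:R * (T / K%:R) = T by rewrite mulrC divfK// gt_eqF.
pose D i w := euler K i w - frozen N M i w.
pose A i w := mu (euler K i w) - mu (euler N (i %/ M) w).
pose B i w := sigma (euler K i w) - sigma (euler N (i %/ M) w).
have D0 : D 0%N = fun=> 0 by apply/funext => w; rewrite /D subrr.
pose b : R := N%:R ^- q.
have b0 : 0 <= b by rewrite /b; nneg.
pose fl i := (i %/ M * M)%N.
rewrite (_ : (fun w => _) = D (j * M)%N); last first.
  by apply/funext => w; rewrite /D frozen_coarse.
have jK : (j * M <= K)%N by rewrite leq_mul2r jN orbT.
have rfine i : (i <= K)%N -> rv (F (grid K i)) (euler K i).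
  by move=> iK; exact: (rv_euler T0 hF hW hmu hsigma rX0).
have rcoarse i : (i < K)%N -> rv (F (grid K i)) (euler N (i %/ M)).
  exact: rv_euler_coarse.
have meas i k n (Z : Omega -> 'M[R]_(k, n)) : (i <= K)%N -> rv (F (grid K i)) Z -> rv measurable Z.
  by move=> iK; apply: (rv_filtration hF); rewrite grid_ge0// grid_leT.
apply: (HC d K (grid K) (T / K%:R) b fl D A B) => //.
- by rewrite grid0.
- by rewrite gridK.
- by rewrite divr_gt0.
- by move=> i _; rewrite gridS.
- by move=> i _; exact: leq_trunc_div.
- by rewrite D0; exact: rv_cst.
- move=> i iK _; split; apply: rvB.
  + exact: rv_drift (rfine i (ltnW iK)).
  + exact: rv_drift (rcoarse i iK).
  + exact: rv_diffusion (rfine i (ltnW iK)).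
  + exact: rv_diffusion (rcoarse i iK).
- move=> i w iK; rewrite /D /A /B /= scalerBr mulmxBl -/K /dW.
  by rewrite !opprD addrACA [X in X + _]addrACA.
- by apply: (mom_le_trans b0); rewrite D0; exact: mom_le0.
move=> i x iK x0 Dx.
have fliK : (fl i < K)%N by exact: leq_ltn_trans (leq_trunc_div _ _) iK.
(* Since the last coarse node the fine scheme has made fewer than [M] of its [N * M] steps; its
   displacement is therefore of order [N%:R ^- q], uniformly in [M]. *)
have incr : mom_le P q (fun w => euler K i w - euler K (fl i) w) (C1 * b).
  have := H1 K (fl i) (i %% M)%N K0; rewrite /fl -divn_eq => /(_ (ltnW iK)).
  apply: mom_le_trans; rewrite ler_wpM2l// /b -exprVn.
  apply: lerXn2r; rewrite ?nnegrE; [nneg|nneg|].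
  rewrite ler_pdivrMr// /K natrM mulKf ?pnatr_eq0 -?lt0n// ler_nat ltnW//.
  exact: ltn_pmod.
(* The gap in the arguments of the coefficients is this displacement plus the difference [D] at the
   last coarse node: this is where the freezing index [fl] enters. *)
have tot : mom_le P q (fun w => euler K i w - euler N (i %/ M) w) (2 ^+ (2 * q) * (C1 * b + x)).
  rewrite (_ : (fun w => _) = fun w => (euler K i w - euler K (fl i) w) + D (fl i) w).
    apply: mom_leD => //.
    - apply: (meas i) => //; first exact: ltnW.
      apply: rvB; first by apply: rfine; exact: ltnW.
      apply: (rv_filtration_le hF _ _ _ (rfine _ (ltnW fliK))).
      + exact: grid_ge0.
      + by rewrite grid_le// leq_trunc_div.
      + by rewrite grid_leT// ltnW.
    - apply: (meas (fl i)); first exact: ltnW.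
      rewrite (_ : D (fl i) = fun w => euler K (fl i) w - euler N (i %/ M) w).
        apply: rvB; first by apply: rfine; exact: ltnW.
        by have := rcoarse _ fliK; rewrite /fl mulnK.
      by apply/funext => w; rewrite /D /fl frozen_coarse.
  by apply/funext => w; rewrite /D /fl frozen_coarse// subrKA.
have mi := meas i _ _ _ (ltnW iK) (rfine i (ltnW iK)).
have mc := meas i _ _ _ (ltnW iK) (rcoarse i iK).
have tot2 : 2 ^+ (2 * q) * (C1 * b + x) <= c2 * (b + x).
  rewrite /c2 -mulrA ler_wpM2l ?exprn_ge0//.
  by have := mulr_ge0 C10 x0; nra.
have tot20 : 0 <= 2 ^+ (2 * q) * (C1 * b + x) by nneg.
have cb0 : 0 <= c2 * (b + x) by nneg.
rewrite KT; split.
- apply: (mom_le_trans _ (mom_le_lipschitz Lm0 Hm mi mc tot)).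
  rewrite ler_pdivlMr ?exprn_gt0//.
  apply: (@le_trans _ _ (Lm * (c2 * (b + x)) * T ^+ (2 * q))).
    by rewrite ler_wpM2r ?exprn_ge0// ler_wpM2l.
  rewrite -subr_ge0 /c.
  have -> : (Lm + Ls) * c2 * (T ^+ (2 * q) + T ^+ q) * (b + x) -
      Lm * (c2 * (b + x)) * T ^+ (2 * q) =
      Ls * (c2 * (b + x)) * T ^+ (2 * q) + (Lm + Ls) * (c2 * (b + x)) * T ^+ q by ring.
  nneg.
- apply: (mom_le_trans _ (mom_le_lipschitz Ls0 Hs mi mc tot)).
  rewrite ler_pdivlMr ?exprn_gt0//.
  apply: (@le_trans _ _ (Ls * (c2 * (b + x)) * T ^+ q)).
    by rewrite ler_wpM2r ?exprn_ge0// ler_wpM2l.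
  rewrite -subr_ge0 /c.
  have -> : (Lm + Ls) * c2 * (T ^+ (2 * q) + T ^+ q) * (b + x) -
      Ls * (c2 * (b + x)) * T ^+ q =
      Lm * (c2 * (b + x)) * T ^+ q + (Lm + Ls) * (c2 * (b + x)) * T ^+ (2 * q) by ring.
  nneg.
Qed.

End fixed_exponent.
End refinement.

(** * Elementary stochastic integrals *)

Section lenglart.
Context {disp : measure_display} {Omega : measurableType disp} {R : realType}.
Variables (P : probability Omega R) (T : R) (F : R -> set (set Omega)).
Variables (m : nat) (W : R -> Omega -> 'cV[R]_m).
Hypotheses (T0 : 0 < T) (hF : is_filtration T F).
Hypothesis hW : standard_brownian_motion P T F W.

Definition msum d (tau : nat -> R) (V : nat -> Omega -> 'M[R]_(d, m)) (n : nat)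
    (w : Omega) : 'cV[R]_d :=
  \sum_(i < n) V i w *m (W (tau i.+1) w - W (tau i) w).

(** The predictable quadratic variation of [msum], traced over the coordinates; [Phi 1] is the
    squared Hilbert-Schmidt norm. *)
Definition bracket d (tau : nat -> R) (V : nat -> Omega -> 'M[R]_(d, m)) (n : nat)
    (w : Omega) : R :=
  \sum_(i < n) Phi 1 (V i w) * (tau i.+1 - tau i).

(* Each term is switched off once the bracket, which is known one step ahead,
   would exceed [e]; the switched-off sum has second moment at most [C * e]. *)
Lemma lenglart : exists2 C : R, 0 <= C &
  forall d n (tau : nat -> R) (V : nat -> Omega -> 'M[R]_(d, m)) (e delta : R),
  0 < e -> 0 < delta -> 0 <= tau 0%N -> tau n <= T ->
  (forall i, (i < n)%N -> tau i < tau i.+1) ->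
  (forall i, (i < n)%N -> rv (F (tau i)) (V i)) ->
  measurable [set w | bracket tau V n w <= e /\ delta < Phi 1 (msum tau V n w)] /\
  (P [set w | (bracket tau V n w <= e)%R /\ (delta < Phi 1 (msum tau V n w))%R] <=
   (C * e / delta)%:E)%E.
Proof.
have [C1 C10 H1] := one_step hF hW (q := 1) isT.
exists (expR C1 * C1); first by rewrite mulr_ge0 ?expR_ge0.
move=> d n tau V e delta e0 delta0 tau0 tauT tauS rV.
have tau_ge0 i : (i <= n)%N -> 0 <= tau i.
  elim: i => // i IH iK; apply: le_trans (IH (ltnW iK)) _; exact/ltW/tauS.
have tau_mono i j : (i <= j)%N -> (j <= n)%N -> tau i <= tau j.
  move=> ij; rewrite -(subnK ij); elim: (j - i)%N => // l IH ln.
  by rewrite addSn; apply: le_trans (IH (ltnW ln)) _; exact/ltW/tauS.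
have tau_leT i : (i <= n)%N -> tau i <= T by move=> iK; exact: le_trans (tau_mono _ _ iK (leqnn n)) tauT.
have dt0 i : (i < n)%N -> 0 < tau i.+1 - tau i by move=> iK; rewrite subr_gt0 tauS.
have term0 i w : (i < n)%N -> 0 <= Phi 1 (V i w) * (tau i.+1 - tau i).
  by move=> iK; rewrite mulr_ge0 ?Phi_ge0// ltW// dt0.
have brS i w : bracket tau V i.+1 w = bracket tau V i w + Phi 1 (V i w) * (tau i.+1 - tau i).
  by rewrite /bracket big_ord_recr.
have br_mono w i : (i <= n)%N -> bracket tau V i w <= bracket tau V n w.
  move=> iK; rewrite -(subnK iK); have : (n - i + i <= n)%N by rewrite subnK.
  elim: (n - i)%N => // l IH niK; rewrite addSn brS.
  by apply: le_trans (IH (ltnW niK)) _; rewrite lerDl term0.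
have br0 w i : (i <= n)%N -> 0 <= bracket tau V i w.
  by move=> iK; apply: sumr_ge0 => l _; rewrite term0// (leq_trans (ltn_ord l)).
have sF i : (i <= n)%N -> sigma_algebra setT (F (tau i)).
  by move=> iK; apply: (filtration_sigma hF); rewrite tau_ge0// tau_leT.
have upF i j k1 k2 (Z : Omega -> 'M[R]_(k1, k2)) : (i <= j)%N -> (j <= n)%N ->
    rv (F (tau i)) Z -> rv (F (tau j)) Z.
  move=> ij jn; apply: (rv_filtration_le hF); last exact: tau_leT.
    by rewrite tau_ge0// (leq_trans ij).
  exact: tau_mono.
have gbr i : (i < n)%N -> gmeas (F (tau i)) (bracket tau V i.+1).
  move=> iK; rewrite /gmeas /bracket.
  have := @measurable_sum _ (g_sigma_algebraType (F (tau i))) R setT _ (index_enum 'I_i.+1)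
    (fun l w => Phi 1 (V l w) * (tau l.+1 - tau l)); apply => l.
  apply: measurable_funM => //; apply: gmeas_Phi.
  have li : (l <= i)%N by rewrite -ltnS.
  by apply: (upF l) => //; [exact: ltnW|apply: rV; exact: leq_ltn_trans iK].
pose V' i w := if bracket tau V i.+1 w <= e then V i w else 0.
have rV' i : (i < n)%N -> rv (F (tau i)) (V' i).
  move=> iK; apply: rv_if; [|exact: rV|exact: rv_cst].
  by apply: gmeas_le; [apply: sF; exact: ltnW|exact: gbr].
(* The bracket up to [i.+1] contains the term of [V i], so a term that is left on is bounded. This
   yields second moments for [V'] without any moment assumption on [V]. *)
have V'le i w : (i < n)%N -> Phi 1 (V' i w) <= e / (tau i.+1 - tau i).
  move=> iK; rewrite /V'; case: ifPn => [bre|_].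
    rewrite ler_pdivlMr ?dt0//; apply: le_trans bre.
    by rewrite brS lerDr br0// ltnW.
  by rewrite Phi0// divr_ge0// ltW// dt0.
have rmeas i k1 k2 (Z : Omega -> 'M[R]_(k1, k2)) : (i <= n)%N ->
    rv (F (tau i)) Z -> rv measurable Z.
  by move=> iK; apply: (rv_filtration hF); rewrite tau_ge0// tau_leT.
pose c i := fine (\int[P]_w (Phi 1 (V' i w))%:E)%E.
have cE i : (i < n)%N -> (\int[P]_w (Phi 1 (V' i w))%:E = (c i)%:E)%E.
  move=> iK; rewrite fineK// ge0_fin_numE; last first.
    by apply: integral_ge0 => w _; rewrite lee_fin Phi_ge0.
  have e1 : 0 <= e / (tau i.+1 - tau i) by rewrite divr_ge0// ltW// dt0.
  have [_ _ le1] := @ebound_cst _ _ _ P _ e1.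
  apply: le_lt_trans (ltry (e / (tau i.+1 - tau i))).
  apply: le_trans le1; apply: ge0_le_integral_nonmeas => w; rewrite lee_fin.
    exact: Phi_ge0.
  exact: V'le.
have c0 i : 0 <= c i.
  by rewrite fine_ge0// integral_ge0// => w _; rewrite lee_fin Phi_ge0.
have sumc : \sum_(i < n) c i * (tau i.+1 - tau i) <= e.
  rewrite -lee_fin -sumEFin.
  have -> : (\sum_(i < n) (c i * (tau i.+1 - tau i))%:E =
      \sum_(i < n) \int[P]_w (Phi 1 (V' i w) * (tau i.+1 - tau i))%:E)%E.
    apply: eq_bigr => i _; under eq_integral do rewrite EFinM.
    rewrite ge0_integralZr//.
    + by rewrite cE// EFinM.
    + apply/measurable_EFinP; apply: rv_measurable_Phi; apply: (rmeas i) => //.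
        exact: ltnW.
      exact: rV'.
    + by move=> w _; rewrite lee_fin Phi_ge0.
    + by rewrite lee_fin ltW// dt0.
  rewrite -ge0_integral_sum//; first last.
  - by move=> i w _; rewrite lee_fin mulr_ge0 ?Phi_ge0// ltW// dt0.
  - move=> i; apply/measurable_EFinP; apply: measurable_funM => //.
    apply: rv_measurable_Phi; apply: (rmeas i) => //; first exact: ltnW.
    exact: rV'.
  have [_ _ le1] := @ebound_cst _ _ _ P _ (ltW e0).
  apply: le_trans le1; apply: ge0_le_integral_nonmeas => w; rewrite sumEFin lee_fin.
    by apply: sumr_ge0 => i _; rewrite mulr_ge0 ?Phi_ge0// ltW// dt0.
  (* A term that is on occurs while the bracket is at most [e], and a term that is off adds nothing,
     so the running sum stays below both. *)
  suff H k : (k <= n)%N -> \sum_(i < k) Phi 1 (V' i w) * (tau i.+1 - tau i) <=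
      Num.min (bracket tau V k w) e by have := H n (leqnn n); rewrite le_min => /andP[].
  elim: k => [_|k IH kn].
    by rewrite /bracket !big_ord0 le_min lexx ltW.
  have {}IH := IH (ltnW kn); rewrite big_ord_recr/= {2}/V'.
  move: IH; rewrite !le_min => /andP[IH1 IH2].
  case: ifPn => bre.
    rewrite brS lerD2r IH1/=; apply: le_trans bre.
    by rewrite brS lerD2r.
  rewrite Phi0// mul0r addr0 IH2 andbT (le_trans IH1)// brS lerDl term0//.
have rM U : (forall i, (i < n)%N -> rv (F (tau i)) (U i)) ->
    forall i, (i <= n)%N -> rv (F (tau i)) (msum (d := d) tau U i).
  move=> rU i iK; apply: rv_sum => l _.
  have li : (l < i)%N by [].
  have ln : (l < n)%N by exact: leq_trans iK.
  apply: rvM; first by apply: (upF l) => //; [exact: ltnW|exact: rU].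
  apply: (upF l.+1) => //; apply: (rv_dW hF hW).
  + by rewrite tau_ge0// ltnW.
  + by rewrite ltW// tauS.
  + by rewrite tau_leT.
pose S i := \sum_(l < i) c l * (tau l.+1 - tau l).
(* [one_step] with [q = 1], no drift and [h = T]: the factors [1 + C1 * (D / T)] of the steps are
   absorbed by the exponential, whose exponent never exceeds [C1], however many steps there are. *)
have main i : (i <= n)%N -> mom_le P 1 (msum tau V' i)
    (expR (C1 * ((tau i - tau 0%N) / T)) * (C1 * S i)).
  elim: i => [_|i IH iK].
    rewrite /S big_ord0 !mulr0 (_ : msum _ _ _ = fun=> 0); first exact: mom_le0.
    by apply/funext => w; rewrite /msum big_ord0.
  have {}IH := IH (ltnW iK).
  have dtT : tau i.+1 - tau i <= T.
    by rewrite (le_trans _ (tau_leT _ iK))// gerBl tau_ge0// ltnW.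
  have rA0 : rv (F (tau i)) (fun=> 0 : 'cV[R]_d) by exact: rv_cst.
  have mV : mom_le P 1 (V' i) (c i) by rewrite /mom_le cE.
  have := H1 d T (tau i) (tau i.+1) (msum tau V' i) (fun=> 0) (V' i) _ 0 (c i)
    (tau_ge0 _ (ltnW iK)) (tauS i iK) (tau_leT _ iK) dtT (rM _ rV' _ (ltnW iK))
    rA0 (rV' i iK) IH (@mom_le0 _ _ _ P 1 d 1 isT) mV.
  rewrite (_ : (fun w => _) = msum tau V' i.+1); last first.
    by apply/funext => w; rewrite /msum big_ord_recr/= scaler0 addr0.
  apply: mom_le_trans.
  rewrite mulr0 add0r expr1 /S big_ord_recr/= -/(S i).
  set x := S i; set D := tau i.+1 - tau i.
  have D0 : 0 <= D by rewrite ltW// dt0.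
  have -> : C1 * (D / T) * (T * c i) = C1 * D * c i by field; rewrite gt_eqF.
  have -> : C1 * ((tau i.+1 - tau 0%N) / T) =
      C1 * ((tau i - tau 0%N) / T) + C1 * (D / T) by rewrite /D; ring.
  rewrite expRD.
  set E := expR (C1 * ((tau i - tau 0%N) / T)).
  have E1 : 1 <= E.
    rewrite -expR0 ler_expR mulr_ge0// divr_ge0 ?(ltW T0)// subr_ge0.
    exact: tau_mono (leq0n i) (ltnW iK).
  have G1 : 1 + C1 * (D / T) <= expR (C1 * (D / T)) by exact: expR_ge1Dx.
  have u0 : 0 <= C1 * (D / T) by rewrite mulr_ge0// divr_ge0// ltW.
  have x0 : 0 <= x.
    by apply: sumr_ge0 => l _; rewrite mulr_ge0// ltW// dt0// (ltn_trans (ltn_ord l)).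
  set G := expR _ in G1 *.
  have -> : E * G * (C1 * (x + c i * D)) =
      G * (E * (C1 * x)) + E * G * (C1 * (c i * D)) by ring.
  apply: lerD.
    by rewrite ler_wpM2r// mulr_ge0 ?expR_ge0//; nneg.
  have GE : 1 <= E * G by rewrite mulr_ege1// (le_trans _ G1)// lerDl.
  have -> : C1 * (c i * D) = C1 * D * c i by ring.
  by rewrite ler_peMl//; nneg.
have mE : measurable [set w | bracket tau V n w <= e /\ delta < Phi 1 (msum tau V n w)].
  rewrite (_ : [set w | _] = [set w | bracket tau V n w <= e] `&`
    [set w | delta < Phi 1 (msum tau V n w)]) //.
  apply: measurableI; last first.
    apply: measurable_superlevel; apply: rv_measurable_Phi.
    by apply: (rmeas n) => //; exact: rM.
  apply: measurable_sublevel; apply: measurable_sum => l.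
  apply: measurable_funM => //; apply: rv_measurable_Phi.
  by apply: (rmeas l); [exact: ltnW|exact: rV].
split => //.
have bM := ebound_Phi (rmeas n _ _ _ (leqnn n) (rM _ rV' n (leqnn n))) (main n (leqnn n)).
have mk := ebound_markov delta0 bM.
have mE' : measurable [set w | delta < Phi 1 (msum tau V' n w)].
  by have [mf _ _] := bM; exact: measurable_superlevel.
apply: (@le_trans _ _ (P [set w | delta < Phi 1 (msum tau V' n w)])).
  apply: le_measure; rewrite ?inE// => w /= [bre].
  (* The bracket is nondecreasing, so on this event no term has been switched off. *)
  suff -> : msum tau V' n w = msum tau V n w by [].
  apply: eq_bigr => i _; rewrite /V' ifT//.
  by apply: le_trans bre; exact: br_mono.
apply: le_trans mk _; rewrite lee_fin ler_wpM2r ?invr_ge0 ?(ltW delta0)//.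
have S0 : 0 <= S n by apply: sumr_ge0 => l _; rewrite mulr_ge0// ltW// dt0.
rewrite -mulrA ler_pM ?expR_ge0//; [nneg| |by rewrite ler_wpM2l].
rewrite ler_expR ler_piMr// ler_pdivrMr// mul1r lerBlDr (le_trans tauT)//.
by rewrite lerDl.
Qed.

End lenglart.

Lemma ge0_le_integral_nonmeas_in d (E : measurableType d) (R : realType)
    (mu : {measure set E -> \bar R}) (D : set E) (f1 f2 : E -> \bar R) :
  (forall x, D x -> (0 <= f1 x)%E) -> (forall x, D x -> (f1 x <= f2 x)%E) ->
  (\int[mu]_(x in D) f1 x <= \int[mu]_(x in D) f2 x)%E.
Proof.
move=> f10 f12; rewrite integral_mkcond [leRHS]integral_mkcond.
apply: ge0_le_integral_nonmeas => x; rewrite !patchE; case: ifPn => // /set_mem Dx.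
  exact: f10.
exact: f12.
Qed.

(** * Elementary processes on a common partition *)

Section merge.
Context {disp : measure_display} {Omega : measurableType disp} {R : realType}.
Variables (T : R) (F : R -> set (set Omega)).
Variables (d m : nat) (W : R -> Omega -> 'cV[R]_m).
Hypothesis hF : is_filtration T F.

(** Boundedness of the values is left out so that the Riemann sums of [sigma (X s)], whose
    coefficients may be unbounded, are covered. *)
Definition elementary_adapted (t : R) (S : elementary (Omega := Omega) (R := R) d m) : Prop :=
  [/\ forall i, (i <= es_size S)%N -> es_node S i \in `[0, t],
      forall i, (i < es_size S)%N -> es_node S i <= es_node S i.+1
    & forall i, (i < es_size S)%N -> rv (F (es_node S i)) (es_val S i)].

Lemma elementary_wf_adapted t S : t <= T -> elementary_wf F t S -> elementary_adapted t S.
Proof.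
move=> tT [S1 S2 S3 _]; split => // i iS; apply: rv_borel (S3 i iS).
have := S1 i (ltnW iS); rewrite in_itv/= => /andP[n0 nt].
by apply: (filtration_sigma hF); rewrite n0 (le_trans nt tT).
Qed.

(** The constant value of the process on the cell from [tau i] to [tau i.+1]. The process lives on
    left-open intervals, so its value there is decided by the position of the left endpoint in the
    right-open ones. *)
Definition coef (tau : nat -> R) (S : elementary d m) (i : nat) (w : Omega) : 'M[R]_(d, m) :=
  \sum_(j < es_size S)
    (if (es_node S j <= tau i) && (tau i < es_node S j.+1) then es_val S j w else 0).

Section partition.
Variables (n : nat) (tau : nat -> R).
Hypothesis tau_mono : forall i j, (i <= n)%N -> (j <= n)%N -> (tau i < tau j) = (i < j)%N.

Lemma tau_monoW i j : (i <= n)%N -> (j <= n)%N -> (tau i <= tau j) = (i <= j)%N.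
Proof. by move=> iN jN; rewrite leNgt tau_mono// -leqNgt. Qed.

Lemma telescope_partition (V : zmodType) (f : R -> V) (a b : R) :
  a <= b -> (exists2 i, (i <= n)%N & a = tau i) -> (exists2 i, (i <= n)%N & b = tau i) ->
  f b - f a = \sum_(i < n) (if (a <= tau i) && (tau i < b)
                            then f (tau i.+1) - f (tau i) else 0).
Proof.
move=> ab [ia iaN aE] [ib ibN bE]; rewrite {}aE {}bE in ab *.
have iab : (ia <= ib)%N by rewrite -tau_monoW.
rewrite -(telescope_sumr (fun i => f (tau i))) //.
rewrite (big_nat_widen _ _ n)// (big_nat_widenl _ 0%N)// big_mkord big_mkcond/=.
apply: eq_bigr => i _; rewrite tau_monoW// ?(ltnW (ltn_ord i))// tau_mono//.
  by rewrite andbC.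
exact: ltnW.
Qed.

Variable S : elementary (Omega := Omega) (R := R) d m.
Hypothesis S_nodes : forall j, (j <= es_size S)%N -> exists2 i, (i <= n)%N & es_node S j = tau i.
Hypothesis S_mono : forall i, (i < es_size S)%N -> es_node S i <= es_node S i.+1.

Lemma elementary_integral_partition w :
  elementary_integral W S w = msum W tau (coef tau S) n w.
Proof.
rewrite /elementary_integral /msum.
under [RHS]eq_bigr do rewrite mulmx_suml.
rewrite exchange_big/=; apply: eq_bigr => j _.
rewrite (telescope_partition (fun t => W t w) (S_mono (ltn_ord j))
  (S_nodes (ltnW (ltn_ord j))) (S_nodes (ltn_ord j))).
rewrite mulmx_sumr; apply: eq_bigr => i _.
by case: ifP => _; rewrite ?mulmx0 ?mul0mx.
Qed.

Lemma elementary_process_partition w i s : (i < n)%N -> tau i < s -> s <= tau i.+1 ->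
  elementary_process S s w = coef tau S i w.
Proof.
move=> iN ts st; apply: eq_bigr => j _.
have [ia iaN aE] := S_nodes (ltnW (ltn_ord j)).
have [ib ibN bE] := S_nodes (ltn_ord j).
rewrite indicE; have -> : (s \in `]es_node S j, es_node S j.+1]%classic) =
    (es_node S j <= tau i) && (tau i < es_node S j.+1).
  rewrite mem_setE in_itv/= aE bE tau_monoW ?tau_mono// ?(ltnW iN)//.
  apply/andP/andP => -[H1 H2]; split.
  - rewrite leqNgt; apply/negP => ii; move: H1; rewrite ltNge.
    by rewrite (le_trans st)// tau_monoW.
  - rewrite ltnNge; apply/negP => ii; move: H2; rewrite leNgt.
    by rewrite (le_lt_trans _ ts)// tau_monoW// ltnW.
  - by rewrite (le_lt_trans _ ts)// tau_monoW// ltnW.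
  - by rewrite (le_trans st)// tau_monoW.
by case: ifP => _; rewrite ?scale1r ?scale0r.
Qed.

End partition.

Lemma rv_coef t tau S i : t <= T -> elementary_adapted t S -> 0 <= tau i <= t ->
  rv (F (tau i)) (coef tau S i).
Proof.
move=> tT [S1 S2 S3] /andP[ti0 tit]; apply: rv_sum => j _.
case E : ((es_node S j <= tau i) && (tau i < es_node S j.+1)); last exact: rv_cst.
have /andP[aj _] := E.
have := S1 j (ltnW (ltn_ord j)); rewrite in_itv/= => /andP[n0 nt].
apply: (rv_filtration_le hF n0 aj); first exact: le_trans tT.
exact: S3.
Qed.

(** On a common refinement of both node sets the difference of the two integrals is a single sum to
    which [lenglart] applies, with a bracket bounded by the squared L^2 distance of the
    processes. *)
Lemma elementary_merge t (S1 S2 : elementary d m) : 0 <= t -> t <= T ->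
  elementary_adapted t S1 -> elementary_adapted t S2 ->
  exists n (tau : nat -> R) (V : nat -> Omega -> 'M[R]_(d, m)),
  [/\ 0 <= tau 0%N, tau n <= T, forall i, (i < n)%N -> tau i < tau i.+1,
      forall i, (i < n)%N -> rv (F (tau i)) (V i)
   & forall w, elementary_integral W S1 w - elementary_integral W S2 w = msum W tau V n w /\
     ((bracket tau V n w)%:E <= \int[lebesgue_measure]_(s in `]0%R, t])
        (enorm (elementary_process S1 s w - elementary_process S2 s w)%R ^+ 2)%:E)%E].
Proof.
move=> t0 tT A1 A2.
pose nodes (S : elementary (Omega := Omega) (R := R) d m) := mkseq (es_node S) (es_size S).+1.
(* Repeated nodes are removed because [lenglart] needs strictly increasing times; 0 is added so that
   the list is visibly nonempty. *)
pose pi := sort <=%O (undup (0 :: nodes S1 ++ nodes S2)).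
pose n := (size pi).-1; pose tau i := nth 0 pi i.
have pi0 : (0 < size pi)%N.
  rewrite size_sort; case E : (undup _) => //.
  by have := mem_undup (0 :: nodes S1 ++ nodes S2) 0; rewrite E in_cons eqxx.
have sizepi : size pi = n.+1 by rewrite /n prednK.
have spi : sorted <%O pi by rewrite sort_lt_sorted undup_uniq.
have tau_mono i j : (i <= n)%N -> (j <= n)%N -> (tau i < tau j) = (i < j)%N.
  by move=> iN jN; rewrite /tau lt_sorted_ltn_nth// inE sizepi ltnS.
have mempi x : (x \in pi) = (x \in 0 :: nodes S1 ++ nodes S2).
  by rewrite mem_sort mem_undup.
have node_tau x : x \in pi -> exists2 i, (i <= n)%N & x = tau i.
  move=> xpi; exists (index x pi); last by rewrite /tau nth_index.
  by rewrite -ltnS -sizepi index_mem.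
have N1 j : (j <= es_size S1)%N -> exists2 i, (i <= n)%N & es_node S1 j = tau i.
  move=> jS; apply: node_tau; rewrite mempi in_cons mem_cat; apply/orP; right.
  by apply/orP; left; apply/mapP; exists j => //; rewrite mem_iota ltnS.
have N2 j : (j <= es_size S2)%N -> exists2 i, (i <= n)%N & es_node S2 j = tau i.
  move=> jS; apply: node_tau; rewrite mempi in_cons mem_cat; apply/orP; right.
  by apply/orP; right; apply/mapP; exists j => //; rewrite mem_iota ltnS.
have tau_in i : (i <= n)%N -> 0 <= tau i <= t.
  move=> iN; have : tau i \in pi by rewrite mem_nth// sizepi ltnS.
  rewrite mempi in_cons mem_cat => /or3P[/eqP ->|/mapP[j]|/mapP[j]].
  - by rewrite lexx.
  - rewrite mem_iota ltnS => /= jS ->; case: A1 => + _ _ => /(_ j jS).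
    by rewrite in_itv.
  - rewrite mem_iota ltnS => /= jS ->; case: A2 => + _ _ => /(_ j jS).
    by rewrite in_itv.
pose V i w := coef tau S1 i w - coef tau S2 i w.
exists n, tau, V; split.
- by have /andP[] := tau_in 0%N isT.
- by have /andP[_ /le_trans] := tau_in n (leqnn n); apply.
- by move=> i iN; rewrite tau_mono// ltnW.
- move=> i iN; have ti := tau_in i (ltnW iN).
  by apply: rvB; exact: (rv_coef tT).
move=> w; have [_ M1 _] := A1; have [_ M2 _] := A2; split.
  rewrite (elementary_integral_partition tau_mono N1 M1).
  rewrite (elementary_integral_partition tau_mono N2 M2).
  by rewrite /msum -sumrB; apply: eq_bigr => i _; rewrite mulmxBl.
pose g i (s : R) : \bar R := (Phi 1 (V i w) * \1_`]tau i, tau i.+1]%classic s)%:E.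
have g0 i s : (0 <= g i s)%E by rewrite lee_fin mulr_ge0 ?Phi_ge0.
have mg i : measurable_fun setT (g i).
  apply/measurable_EFinP; apply: measurable_funM => //.
have -> : ((bracket tau V n w)%:E = \int[lebesgue_measure]_(s in `]0%R, t]) \sum_(i < n) g i s)%E.
  have mI : measurable (`]0%R, t]%classic : set R) by exact: measurable_itv.
  have := @ge0_integral_sum _ _ R lebesgue_measure `]0%R, t]%classic mI 'I_n
    (fun i s => g i s) _ _ (index_enum 'I_n).
  move=> -> => [|i|i s _]; [|exact: measurable_funTS (mg i)|exact: g0].
  rewrite /bracket -sumEFin; apply: eq_bigr => i _.
  rewrite /g; under eq_integral do rewrite EFinM.
  rewrite ge0_integralZl//; last 2 first.
  - by apply/measurable_EFinP/measurable_funTS.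
  - by rewrite lee_fin Phi_ge0.
  rewrite integral_indic// EFinM; congr (_ * _)%E.
  have /andP[ti0 _] := tau_in i (ltnW (ltn_ord i)).
  have /andP[_ tit] := tau_in i.+1 (ltn_ord i).
  have tii : tau i < tau i.+1 by rewrite tau_mono// ltnW.
  rewrite (_ : _ `&` _ = `]tau i, tau i.+1]%classic); last first.
    apply/setIidPl => s /=; rewrite !in_itv/= => /andP[s1 s2].
    by rewrite (le_lt_trans ti0 s1) (le_trans s2 tit).
  have E := lebesgue_measure_itv (R := R) `]tau i, tau i.+1].
  by move: E; rewrite /= lte_fin tii EFinB => E; exact/esym.
(* A point [s] lies in at most one cell; there the sum of the [g i] is the squared distance of the
   processes, and outside the cells it is 0. *)
apply: ge0_le_integral_nonmeas_in => [s _|s]; first exact: sume_ge0.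
rewrite /= in_itv/= => /andP[s0 st].
have [[i tsi]|noi] := pselect (exists i : 'I_n, tau i < s /\ s <= tau i.+1).
  have [ts st1] := tsi.
  rewrite (bigD1 i)//= big1 ?adde0; last first.
    move=> j ji; rewrite /g indicE memNset ?mulr0//= in_itv/= => /andP[tj sj].
    have : (i < j.+1)%N by rewrite -tau_mono ?(ltnW (ltn_ord i))//; exact: lt_le_trans sj.
    have : (j < i.+1)%N by rewrite -tau_mono ?(ltnW (ltn_ord j))//; exact: lt_le_trans st1.
    rewrite !ltnS => ij1 ij2; move/eqP : ji; apply.
    by apply/val_inj/eqP; rewrite eqn_leq ij1.
  rewrite (elementary_process_partition tau_mono N1 w (ltn_ord i) ts st1).
  rewrite (elementary_process_partition tau_mono N2 w (ltn_ord i) ts st1).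
  rewrite /g indicE mem_set ?mulr1/= ?in_itv/= ?ts//.
  by rewrite enorm_sqr.
rewrite big1 ?lee_fin ?sqr_ge0// => i _.
rewrite /g indicE memNset ?mulr0//= in_itv/= => /andP[ti si].
by apply: noi; exists i.
Qed.

End merge.

(** * Modulus of continuity of the solution *)

Section uniform_continuity.
Context {R : realType}.

Lemma within_continuousP (f : R -> R) (a b : R) :
  {within `[a, b], continuous f} -> forall p, a <= p <= b -> forall e, 0 < e ->
  exists2 r, 0 < r & forall t, a <= t <= b -> `|p - t| < r -> `|f p - f t| < e.
Proof.
move=> /subspace_continuousP cf p pab e e0.
have pin : `[a, b]%classic p by rewrite /= in_itv.
have /cvgrPdist_lt /(_ e e0) := cf p pin.
rewrite /prop_near1/= /within/= => /nbhs_ballP[r /= r0 H].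
by exists r => // t tab ptr; apply: H => //=; rewrite in_itv.
Qed.

(** Otherwise there are pairs of points at distance below [1 / n.+1] whose values are [e] apart, and
    a cluster point of their first components contradicts continuity. *)
Lemma heine_cantor (f : R -> R) (a b : R) : {within `[a, b], continuous f} ->
  forall e, 0 < e -> exists2 r, 0 < r &
  forall s t, a <= s <= b -> a <= t <= b -> `|s - t| < r -> `|f s - f t| < e.
Proof.
move=> cf e e0; apply: contrapT => H.
have H' n : exists st : R * R, [/\ a <= st.1 <= b, a <= st.2 <= b,
    `|st.1 - st.2| < n.+1%:R^-1 & e <= `|f st.1 - f st.2|].
  apply: contrapT => Hn; apply: H; exists n.+1%:R^-1; first by rewrite invr_gt0.
  move=> s t sab tab st; rewrite real_ltNge ?num_real//; apply/negP => est.
  by apply: Hn; exists (s, t).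
have [u uP] := choice H'.
pose s n := (u n).1.
have := @segment_compact R a b (s @ \oo) _.
have FA : (s @ \oo) `[a, b]%classic.
  by exists 0%N => // n _; rewrite /= in_itv/=; have [] := uP n.
move=> /(_ _ FA) [p [pab cl]].
rewrite /= in_itv/= in pab.
have e20 : 0 < e / 2 by rewrite divr_gt0.
have [r r0 rP] := within_continuousP cf pab e20.
have r20 : 0 < r / 2 by rewrite divr_gt0.
have [n0 _ n0P] := near_infty_natSinv_lt (PosNum r20).
have U : (s @ \oo) [set s k | k in [set k | (n0 <= k)%N]].
  by exists n0 => // k /= k0; exists k.
have V : nbhs p (ball p (r / 2)) by exact: nbhsx_ballx.
have [_ [[k /= k0 <-] pk]] := cl _ _ U V.
have [sab tab st est] := uP k.
have kr : k.+1%:R^-1 < r / 2 by exact: (n0P k k0).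
have ps : `|p - s k| < r / 2 by exact: pk.
have d1 : `|f p - f (s k)| < e / 2.
  by apply: rP => //; apply: lt_trans ps _; rewrite ltr_pdivrMr// ltr_pMr// ltr1n.
have d2 : `|f p - f (u k).2| < e / 2.
  apply: rP => //; rewrite -(subrK (s k) p) -addrA.
  apply: le_lt_trans (ler_normD _ _) _; rewrite (splitr r) ltrD//.
  exact: lt_trans st kr.
move: est; rewrite leNgt => /negP; apply.
rewrite -/(s k) -(subrK (f p) (f (s k))) -addrA.
by apply: le_lt_trans (ler_normD _ _) _; rewrite (splitr e) ltrD// distrC.
Qed.

Lemma common_radius (I : finType) (Q : I -> R -> Prop) :
  (forall i, exists2 r, 0 < r & forall x, x < r -> Q i x) ->
  exists2 r, 0 < r & forall i x, x < r -> Q i x.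
Proof.
move=> H.
have H2 i : exists ri, 0 < ri /\ forall x, x < ri -> Q i x.
  by have [ri r0 rQ] := H i; exists ri.
have [r rP] := choice H2.
exists (\big[Num.min/1]_i r i).
  by elim/big_ind: _ => // [x y x0 y0|i _]; [rewrite lt_min x0|case: (rP i)].
move=> i x xr; have [_] := rP i; apply; apply: lt_le_trans xr _.
by rewrite (bigD1 i)//= ge_min lexx.
Qed.

Lemma within_continuous_coord (k : nat) (T : R) (f : R -> 'cV[R]_k) (i : 'I_k) :
  {within `[0, T], continuous f} -> {within `[0, T], continuous (fun t => f t i 0)}.
Proof.
move=> cf x; apply: (@continuous_comp _ _ _ (f : subspace `[0, T] -> _)
  (fun M : 'cV[R]_k => M i 0)); first exact: cf.
exact: coord_continuous.
Qed.

Lemma uniform_modulus_mx (k : nat) (T : R) (f : R -> 'cV[R]_k) :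
  {within `[0, T], continuous f} -> forall e, 0 < e ->
  exists2 r, 0 < r & forall s t, 0 <= s <= T -> 0 <= t <= T -> `|s - t| < r ->
    Phi 1 (f s - f t) <= e.
Proof.
move=> cf e e0.
pose e' := e / k.+1%:R; have e'0 : 0 < e' by rewrite divr_gt0.
have sq0 : 0 < Num.sqrt e' by rewrite sqrtr_gt0.
have Hi (i : 'I_k) : exists2 r, 0 < r & forall x, x < r ->
    forall s t, 0 <= s <= T -> 0 <= t <= T -> `|s - t| <= x ->
      `|f s i 0 - f t i 0| < Num.sqrt e'.
  have ci := within_continuous_coord (i := i) cf.
  have [r r0 rP] := heine_cantor ci sq0.
  by exists r => // x xr s t s0 t0 stx; apply: rP => //; exact: le_lt_trans xr.
have [r r0 rP] := common_radius Hi.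
exists r => // s t s0 t0 str.
rewrite /Phi; apply: (@le_trans _ _ (\sum_(i < k) e')).
  apply: ler_sum => i _; rewrite big_ord1 muln1 !mxE -real_normK ?num_real//.
  rewrite -[leRHS]sqr_sqrtr ?(ltW e'0)//.
  by rewrite lerXn2r ?nnegrE// ltW//; exact: (rP i _ str _ _ s0 t0).
rewrite sumr_const card_ord -mulr_natr /e' -mulrA ger_pMr//.
by rewrite ler_pdivrMl// mulr1 ler_nat.
Qed.

End uniform_continuity.

Section grid_index.
Context {R : realType}.
Variable T : R.
Hypothesis T0 : 0 < T.

Definition grid_idx (K : nat) (s : R) : nat := Num.truncn (s * K%:R / T).

Lemma grid_idx_itv K s : (0 < K)%N -> 0 <= s ->
  grid T K (grid_idx K s) <= s < grid T K (grid_idx K s).+1.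
Proof.
move=> K0 s0; have KR0 : 0 < K%:R :> R by rewrite ltr0n.
have x0 : 0 <= s * K%:R / T by rewrite divr_ge0 ?mulr_ge0// ltW.
have := truncn_itv x0; rewrite -/(grid_idx K s) => /andP[h1 h2].
by rewrite /grid ler_pdivrMr// ltr_pdivlMr// -ler_pdivlMr// -ltr_pdivrMr// h1 h2.
Qed.

Lemma grid_idx_le K s : (0 < K)%N -> 0 <= s -> s <= T -> (grid_idx K s <= K)%N.
Proof.
move=> K0 s0 sT; rewrite -[leqRHS](@natrK R); apply: le_truncn.
by rewrite ler_pdivrMr// mulrC ler_wpM2l.
Qed.

Lemma grid_idx_dist K s : (0 < K)%N -> 0 <= s ->
  0 <= s - grid T K (grid_idx K s) < T / K%:R.
Proof.
move=> K0 s0; have /andP[h1 h2] := grid_idx_itv K0 s0.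
by rewrite subr_ge0 h1 ltrBlDl -gridS.
Qed.

Lemma small_mesh (e : R) : 0 < e ->
  exists2 K0, (0 < K0)%N & forall K, (K0 <= K)%N -> T / K%:R < e.
Proof.
move=> e0; exists (Num.truncn (T / e)).+1 => // K KK.
have K0 : 0 < K%:R :> R by rewrite ltr0n (leq_trans _ KK).
rewrite ltr_pdivrMr// mulrC -ltr_pdivrMr//.
by apply: lt_le_trans (truncnS_gt _) _; rewrite ler_nat.
Qed.

End grid_index.

Section good_event.
Context {disp : measure_display} {Omega : measurableType disp} {R : realType}.
Variables (P : probability Omega R) (T : R) (F : R -> set (set Omega)).
Hypotheses (T0 : 0 < T) (hF : is_filtration T F).
Variables (d : nat) (X : R -> Omega -> 'cV[R]_d).
Hypotheses (hXa : adapted T F X) (hXc : continuous_paths T X).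

Lemma rv_X t : 0 <= t <= T -> rv (F t) (X t).
Proof.
move=> tT; apply: rv_borel; first exact: (filtration_sigma hF).
by apply: hXa; rewrite in_itv.
Qed.

Lemma rv_X_measurable t : 0 <= t <= T -> rv measurable (X t).
Proof. by move=> tT; apply: (rv_filtration hF tT); exact: rv_X. Qed.

(* Only the countably many grid points enter, so that the event is measurable;
   [goodP] recovers all times by continuity, at the price of a factor. *)
Definition good (delta e : R) : set Omega :=
  \bigcap_(K : nat) \bigcap_(i : nat) \bigcap_(j : nat)
    (if [&& (0 < K)%N, (i <= K)%N, (j <= K)%N & `|grid T K i - grid T K j| < delta]
     then [set w | Phi 1 (X (grid T K i) w - X (grid T K j) w) <= e] else setT).

Lemma measurable_good delta e : measurable (good delta e).
Proof.
apply: bigcapT_measurable => K; apply: bigcapT_measurable => i.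
apply: bigcapT_measurable => j; case: ifP => // /and4P[K0 iK jK _].
apply: measurable_sublevel; apply: rv_measurable_Phi; apply: rvB.
- by apply: rv_X_measurable; rewrite grid_ge0//= grid_leT.
- by apply: rv_X_measurable; rewrite grid_ge0//= grid_leT.
Qed.

Lemma good_le delta delta' e : delta' <= delta -> good delta e `<=` good delta' e.
Proof.
move=> dd w gw K _ i _ j _; case: ifP => // /and4P[K0 iK jK Hd].
have := gw K I i I j I; rewrite K0 iK jK /=.
by rewrite (lt_le_trans Hd dd).
Qed.

Lemma goodP delta e w s t : 0 < e -> good delta e w ->
  0 <= s <= T -> 0 <= t <= T -> `|s - t| < delta ->
  Phi 1 (X s w - X t w) <= 20 * e.
Proof.
move=> e0 gw s0T t0T std.
have /andP[s0 sT] := s0T; have /andP[t0 tT] := t0T.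
(* With [e / 5] at both ends, two uses of [PhiD_le] give
   [4 * (e / 5 + 4 * (e + e / 5)) = 20 * e]. *)
have e5 : 0 < e / 5 by rewrite divr_gt0.
have [r r0 rP] := uniform_modulus_mx (@hXc w) e5.
(* A mesh below this gap keeps the two rounded times within [delta] of each other. *)
have gap : 0 < delta - `|s - t| by rewrite subr_gt0.
have min0 : 0 < Num.min r (delta - `|s - t|) by rewrite lt_min r0 gap.
have [K K0 /(_ K (leqnn K)) Kmesh] := small_mesh T min0.
move: Kmesh; rewrite lt_min => /andP[Kr Kgap].
set si := grid_idx T K s; set ti := grid_idx T K t.
have siK := grid_idx_le T0 K0 s0 sT; have tiK := grid_idx_le T0 K0 t0 tT.
have /andP[ds1 ds2] := grid_idx_dist T0 K0 s0.
have /andP[dt1 dt2] := grid_idx_dist T0 K0 t0.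
rewrite -/si in ds1 ds2; rewrite -/ti in dt1 dt2.
have gsi : 0 <= grid T K si <= T by rewrite grid_ge0//= grid_leT.
have gti : 0 <= grid T K ti <= T by rewrite grid_ge0//= grid_leT.
have h1 : Phi 1 (X s w - X (grid T K si) w) <= e / 5.
  by apply: rP => //; rewrite ger0_norm// (lt_trans ds2).
have h2 : Phi 1 (X (grid T K ti) w - X t w) <= e / 5.
  by apply: rP => //; rewrite distrC ger0_norm// (lt_trans dt2).
have h3 : Phi 1 (X (grid T K si) w - X (grid T K ti) w) <= e.
  have := gw K I si I ti I; rewrite K0 siK tiK/= ifT//.
  have : `|grid T K si - grid T K ti| <= `|s - t| + T / K%:R.
    have := ler_norm (s - t); have := ler_norm (t - s); rewrite [`|t - s|]distrC.
    by rewrite ler_norml; move: `|s - t| => a; lra.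
  by move=> /le_lt_trans; apply; lra.
have -> : X s w - X t w = (X s w - X (grid T K si) w) +
    ((X (grid T K si) w - X (grid T K ti) w) + (X (grid T K ti) w - X t w)).
  by rewrite subrKA subrKA.
apply: le_trans (PhiD_le _ _ _) _.
have := PhiD_le 1 (X (grid T K si) w - X (grid T K ti) w) (X (grid T K ti) w - X t w).
by rewrite muln1; lra.
Qed.

(** As [delta] decreases to 0 the events increase, and their union is everything because each path
    is uniformly continuous; continuity from below concludes. *)
Lemma good_probability e eta : 0 < e -> 0 < eta ->
  exists2 delta, 0 < delta & (P (~` good delta e) <= eta%:E)%E.
Proof.
move=> e0 eta0.
pose G n := good n.+1%:R^-1 e.
have mG n : measurable (G n) by exact: measurable_good.
have Gmono : {homo G : n m / (n <= m)%N >-> (n <= m)%O}.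
  move=> n k nk; apply/subsetPset; apply: good_le.
  by rewrite lef_pV2 ?posrE// ler_nat.
have GU : \bigcup_n G n = setT.
  apply/seteqP; split=> // w _.
  have [r r0 rP] := uniform_modulus_mx (@hXc w) e0.
  have [n0 _ n0P] := near_infty_natSinv_lt (PosNum r0).
  exists n0 => // K _ i _ j _; case: ifP => // /and4P[K0 iK jK Hd].
  apply: rP; [by rewrite grid_ge0//= grid_leT|by rewrite grid_ge0//= grid_leT|].
  apply: lt_trans Hd _; exact: (n0P n0 (leqnn n0)).
have cv : P (G n) @[n --> \oo] --> 1%:E.
  rewrite -(probability_setT P) -GU.
  by apply: nondecreasing_cvg_mu => //; exact: bigcupT_measurable.
have e1 : (fun r : R => r - eta) 1 < 1 by rewrite ltrBlDr ltrDl.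
have [n _ /(_ n (leqnn n)) /= nP] := cv _ (@nbhs_open_ereal_gt _ 1 (fun r : R => r - eta) e1).
exists n.+1%:R^-1; first by rewrite invr_gt0.
rewrite probability_setC//; last exact: mG.
move: nP; rewrite -(fineK (fin_num_measure P _ (mG n))).
by rewrite lte_fin -EFinB lee_fin; lra.
Qed.

End good_event.

Import HBNNSimple.

(** Neither [f] nor [a] has to be measurable: for a simple [h] below [f], the positive part of
    [h - g] divided by [k] is measurable and below [a]. *)
Lemma ge0_integral_le_nonmeas d (E : measurableType d) (R : realType)
    (mu : {measure set E -> \bar R}) (f a g : E -> R) (k : R) :
  0 < k -> (forall x, 0 <= f x) -> (forall x, 0 <= a x) -> (forall x, 0 <= g x) ->
  measurable_fun setT g -> (forall x, f x <= k * a x + g x) ->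
  (\int[mu]_x (f x)%:E <= k%:E * \int[mu]_x (a x)%:E + \int[mu]_x (g x)%:E)%E.
Proof.
move=> k0 f0 a0 g0 mg fag.
rewrite [leLHS]ge0_integralTE; last by move=> x; rewrite lee_fin.
apply: ge_ereal_sup => _ [h hf <-]/=.
pose b x := Num.max (h x - g x) 0 / k.
have mb : measurable_fun setT b.
  apply: measurable_funM => //; apply: measurable_maxr => //.
  exact: measurable_funB.
have b0 x : 0 <= b x by rewrite divr_ge0 ?(ltW k0)// le_max lexx orbT.
have ba x : b x <= a x.
  rewrite ler_pdivrMr// ge_max mulr_ge0 ?(ltW k0)// andbT lerBlDr mulrC.
  by have := hf x; rewrite lee_fin => /le_trans; apply.
have hb x : h x <= k * b x + g x.
  rewrite /b mulrC divfK ?gt_eqF// -lerBlDr le_max lexx//.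
apply: (@le_trans _ _ (\int[mu]_x (h x)%:E)%E); first by rewrite integralT_nnsfun.
apply: (@le_trans _ _ (\int[mu]_x ((k * b x)%:E + (g x)%:E))%E).
  by apply: ge0_le_integral_nonmeas => x; rewrite ?lee_fin.
rewrite ge0_integralD//; last 4 first.
- by move=> x _; rewrite lee_fin mulr_ge0// ltW.
- by apply/measurable_EFinP; exact: measurable_funM.
- by move=> x _; rewrite lee_fin.
- exact/measurable_EFinP.
apply: leeD => //; under eq_integral do rewrite EFinM.
rewrite ge0_integralZl//; last 3 first.
- exact/measurable_EFinP.
- by move=> x _; rewrite lee_fin.
- by rewrite lee_fin ltW.
apply: lee_wpmul2l; first by rewrite lee_fin ltW.
by apply: ge0_le_integral_nonmeas => x; rewrite lee_fin.
Qed.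

Lemma ge0_integral_le_nonmeas_cst disp (E : measurableType disp) (R : realType)
    (mu : {measure set E -> \bar R}) (D D' : set E) (f a : E -> R) (k c : R) :
  0 < k -> 0 <= c -> measurable D -> D `<=` D' ->
  (forall x, D x -> 0 <= f x) -> (forall x, D' x -> 0 <= a x) ->
  (forall x, D x -> f x <= k * a x + c) ->
  (\int[mu]_(x in D) (f x)%:E <=
   k%:E * \int[mu]_(x in D') (a x)%:E + c%:E * mu D)%E.
Proof.
move=> k0 c0 mD DD f0 a0 fac.
have <- : (\int[mu]_(x in D) c%:E = c%:E * mu D)%E.
  exact: (integral_cst mu mD c%:E).
rewrite !(integral_mkcond D) (integral_mkcond D').
have pE (A : set E) (u : E -> R) : (EFin \o u) \_ A = (fun x => ((u \_ A) x)%:E).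
  by apply/funext => x; rewrite !patchE; case: ifP.
rewrite -!/(EFin \o _) !pE.
apply: ge0_integral_le_nonmeas => //.
- by move=> x; rewrite patchE; case: ifPn => // /set_mem; exact: f0.
- by move=> x; rewrite patchE; case: ifPn => // /set_mem; exact: a0.
- by move=> x; rewrite patchE; case: ifPn.
- by apply/(measurable_restrictT _ _).1 => //; exact: measurable_cst.
- move=> x; rewrite !patchE; case: ifPn => [/set_mem Dx|_].
    by rewrite mem_set; [exact: fac|exact: DD].
  by case: ifPn => [/set_mem Dx|_]; rewrite ?mulr0 addr0// mulr_ge0 ?(ltW k0)//; exact: a0.
Qed.

Lemma cvg0_in_probability_near d (Omega : measurableType d) (R : realType)
    (P : probability Omega R) (Z1 Z2 : nat -> Omega -> \bar R) (e1 e2 eta : R) :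
  cvg0_in_probability P Z1 -> cvg0_in_probability P Z2 ->
  0 < e1 -> 0 < e2 -> 0 < eta ->
  exists k, (P [set w | (e1%:E <= Z1 k w)%E] <= eta%:E)%E /\
            (P [set w | (e2%:E <= Z2 k w)%E] <= eta%:E)%E.
Proof.
move=> [m1 c1] [m2 c2] e10 e20 eta0.
have H (Z : nat -> Omega -> \bar R) (e : R) : 0 < e -> (forall e, 0 < e -> P [set w | (e%:E <= Z k w)%E] @[k --> \oo] --> 0%E) ->
    \forall k \near \oo, (P [set w | (e%:E <= Z k w)%E] <= eta%:E)%E.
  move=> e0 /(_ e e0) /(_ _ (@nbhs_open_ereal_lt _ 0 (fun=> eta) eta0)).
  by move=> H; near=> k; apply: ltW; near: k; exact: H.
have [n _ nP] := filterI (H Z1 e1 e10 c1) (H Z2 e2 e20 c2).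
by exists n; exact: (nP n (leqnn n)).
Unshelve. all: by end_near. Qed.

Lemma sqr_coord_le_Phi (R : realType) m n (A : 'M[R]_(m, n)) i j : A i j ^+ 2 <= Phi 1 A.
Proof.
rewrite -enorm_sqr -real_normK ?num_real// lerXn2r ?nnegrE ?enorm_ge0//.
exact: coord_le_enorm.
Qed.

(** * Riemann sums of the stochastic integral *)

Section riemann_sum.
Context {R : realType}.
Variables (T : R).
Hypothesis T0 : 0 < T.

(** Each cell contributes at most its length times the oscillation [kappa]. *)
Lemma riemann_sum_error (f : R -> R) (K j : nat) (kappa : R) :
  (0 < K)%N -> (j <= K)%N -> 0 <= kappa -> {within `[0, T], continuous f} ->
  (forall s t, 0 <= s <= T -> 0 <= t <= T -> `|s - t| <= T / K%:R -> `|f s - f t| <= kappa) ->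
  `|(\int[lebesgue_measure]_(s in `[0, grid T K j]) f s)%R -
    \sum_(l < j) T / K%:R * f (grid T K l)| <= T * kappa.
Proof.
move=> K0 jK k0 cf fk.
have intf : lebesgue_measure.-integrable `[0, T] (EFin \o f).
  exact: continuous_compact_integrable (@segment_compact _ _ _) cf.
suff : `|(\int[lebesgue_measure]_(s in `[0, grid T K j]) f s)%R -
    \sum_(l < j) T / K%:R * f (grid T K l)| <= j%:R * (T / K%:R) * kappa.
  move=> /le_trans; apply; apply: ler_wpM2r => //.
  by rewrite mulrA; exact: grid_leT.
elim: j jK => [|j IH] jK.
  rewrite grid0 big_ord0 set_itv1 Rintegral_set1 subrr normr0.
  by rewrite !mul0r.
set a := grid T K j; set b := grid T K j.+1.
have a0 : 0 <= a by exact: grid_ge0.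
have ab : a <= b by exact: grid_le.
have bT : b <= T by exact: grid_leT.
have bE : b - a = T / K%:R by rewrite /b gridS addrAC subrr add0r.
have split0 : (\int[lebesgue_measure]_(s in `[0, b]) f s)%R =
    (\int[lebesgue_measure]_(s in `[0, a]) f s)%R +
    (\int[lebesgue_measure]_(s in `]a, b]) f s)%R.
  rewrite -Rintegral_setU//.
  - by rewrite -itv_bndbnd_setU// bnd_simp.
  - rewrite -itv_bndbnd_setU ?bnd_simp//.
    apply: integrableS intf => //.
    by apply: subset_itvl; rewrite bnd_simp.
  - apply/disj_setPS => x [/=]; rewrite !in_itv/= => /andP[_ xa] /andP[ax _].
    by have := lt_le_trans ax xa; rewrite ltxx.
have inta : lebesgue_measure.-integrable `]a, b] (EFin \o f).
  apply: integrableS intf => // x /=; rewrite !in_itv/= => /andP[ax xb].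
  by rewrite (le_trans a0 (ltW ax))/= (le_trans xb bT).
have muE : fine (lebesgue_measure (`]a, b]%classic : set R)) = b - a.
  rewrite lebesgue_measure_itv/= lte_fin; case: ltP => // ba.
  by rewrite (@le_anti _ _ a b) ?ab// subrr.
have err : `|(\int[lebesgue_measure]_(s in `]a, b]) f s)%R - T / K%:R * f a| <=
    T / K%:R * kappa.
  have intc (c : R) : lebesgue_measure.-integrable `]a, b] (EFin \o cst c).
    have : lebesgue_measure.-integrable `[0, T] (EFin \o cst c).
      apply: continuous_compact_integrable (@segment_compact _ _ _) _.
      by apply: continuous_subspaceT => x; exact: cvg_cst.
    move=> /integrableS; apply => // x /=; rewrite !in_itv/= => /andP[ax xb].
    by rewrite (le_trans a0 (ltW ax))/= (le_trans xb bT).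
  rewrite -bE [_ * f a]mulrC -muE -Rintegral_cst//= -RintegralB//; last exact: intc.
  have intB : lebesgue_measure.-integrable `]a, b] (EFin \o (fun s => f s - f a)).
    have := integrableB _ inta (intc (f a)); apply => //.
  apply: le_trans (le_normr_Rintegral _ intB) _ => //.
  rewrite mulrC -Rintegral_cst//; apply: le_Rintegral => //.
  - exact: integrable_norm intB.
  - exact: intc.
  - move=> s /=; rewrite in_itv/= => /andP[sa sb]; apply: fk.
    + by rewrite (le_trans a0 (ltW sa)) (le_trans sb bT).
    + by rewrite a0 (le_trans ab bT).
    + by rewrite -bE gtr0_norm ?subr_gt0// lerB.
rewrite big_ord_recr/= split0 opprD addrACA.
apply: le_trans (ler_normD _ _) _.
rewrite -natr1 mulrDl mul1r mulrDl; apply: lerD; last exact: err.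
exact: IH (ltnW jK).
Qed.

End riemann_sum.

Section ito_riemann.
Context {disp : measure_display} {Omega : measurableType disp} {R : realType}.
Variables (P : probability Omega R) (T : R) (F : R -> set (set Omega)).
Variables (d m : nat) (W : R -> Omega -> 'cV[R]_m).
Hypotheses (T0 : 0 < T) (hF : is_filtration T F).
Hypothesis hW : standard_brownian_motion P T F W.
Variables (mu : 'cV[R]_d -> 'cV[R]_d) (sigma : 'cV[R]_d -> 'M[R]_(d, m)).
Hypotheses (hmu : globally_lipschitz mu) (hsigma : globally_lipschitz sigma).
Variable X : R -> Omega -> 'cV[R]_d.
Hypotheses (hXa : adapted T F X) (hXc : continuous_paths T X).

Local Notation grid := (grid T).
Local Notation dW := (dW T W).
Local Notation good := (good T X).

Definition riemann_ito (K j : nat) (w : Omega) : 'cV[R]_d :=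
  \sum_(l < j) sigma (X (grid K l) w) *m dW K l w.

Definition riemann_elementary (K j : nat) : elementary d m :=
  Elementary j (grid K) (fun l w => sigma (X (grid K l) w)).

Lemma grid_itv K l : (0 < K)%N -> (l <= K)%N -> 0 <= grid K l <= T.
Proof. by move=> K0 lK; rewrite grid_ge0//= grid_leT. Qed.

Lemma rv_X_grid K l : (0 < K)%N -> (l <= K)%N -> rv (F (grid K l)) (X (grid K l)).
Proof. by move=> K0 lK; apply: (rv_X hF hXa); exact: grid_itv. Qed.

Lemma riemann_elementary_adapted K j : (0 < K)%N -> (j <= K)%N ->
  elementary_adapted F (grid K j) (riemann_elementary K j).
Proof.
move=> K0 jK; split=> /= i ij.
- by rewrite in_itv/= grid_ge0//= grid_le.
- exact: grid_le.
- by apply: rv_lipschitz hsigma _; apply: rv_X_grid => //; exact: leq_trans (ltnW ij) jK.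
Qed.

Lemma grid_cell K j s : 0 < s -> s <= grid K j ->
  exists2 l, (l < j)%N & grid K l < s <= grid K l.+1.
Proof.
elim: j => [|j IH] s0 sj; first by rewrite grid0 in sj; have := lt_le_trans s0 sj; rewrite ltxx.
have [/(IH s0)[l lj ls]|js] := leP s (grid K j).
  by exists l => //; exact: ltnW.
by exists j => //; rewrite js.
Qed.

Lemma riemann_elementary_process K j l s w : (l < j)%N ->
  grid K l < s <= grid K l.+1 ->
  elementary_process (riemann_elementary K j) s w = sigma (X (grid K l) w).
Proof.
move=> lj /andP[ls sl].
rewrite /elementary_process (bigD1 (Ordinal lj))//= big1 ?addr0.
  by rewrite indicE mem_set ?scale1r//= in_itv/= ls.
move=> i /eqP il; rewrite indicE memNset ?scale0r//= in_itv/= => /andP[i1 i2].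
have [|ne] := boolP (i == l :> nat); last first.
  move: ne; rewrite neq_ltn => /orP[h|h].
    by have := lt_le_trans ls (le_trans i2 (grid_le T0 K h)); rewrite ltxx.
  by have := lt_le_trans i1 (le_trans sl (grid_le T0 K h)); rewrite ltxx.
by move=> /eqP il'; apply: il; exact: val_inj.
Qed.

Lemma good_mesh delta e K l s w : 0 < e -> (0 < K)%N -> (l < K)%N -> T / K%:R < delta ->
  grid K l < s <= grid K l.+1 -> good delta e w ->
  Phi 1 (X (grid K l) w - X s w) <= 20 * e.
Proof.
move=> e0 K0 lK Kd /andP[ls sl] gw.
apply: (goodP T0 hXc e0 gw); first exact: grid_itv (ltnW lK).
  rewrite (le_trans _ (ltW ls)) ?grid_ge0//=.
  by apply: le_trans sl _; exact: grid_leT.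
rewrite distrC gtr0_norm ?subr_gt0//; apply: le_lt_trans Kd.
by rewrite lerBlDr addrC -gridS.
Qed.

Lemma rv_riemann_ito K j : (0 < K)%N -> (j <= K)%N -> rv measurable (riemann_ito K j).
Proof.
move=> K0 jK; apply: rv_sum => l _; have lK := leq_trans (ltn_ord l) jK.
apply: rvM.
  apply: rv_lipschitz hsigma _; apply: (rv_X_measurable hF hXa); exact: grid_itv (ltnW lK).
apply: (rv_filtration hF (grid_itv K0 lK)); apply: (rv_dW hF hW) => //.
- exact: grid_ge0.
- exact: grid_le.
- exact: grid_leT.
Qed.

(** An elementary process [S k] close to [sigma (X s)], with integral close to [I], is merged with
    the Riemann process. On [good] the two processes are close in L^2, so [lenglart] bounds the
    difference of their integrals. *)
Lemma ito_riemann_probability : exists2 C : R, 0 <= C &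
  forall K j (delta e theta : R) I, (0 < K)%N -> (j <= K)%N -> 0 < e -> 0 < theta ->
  T / K%:R < delta -> is_ito_integral P F W (grid K j) (fun s w => sigma (X s w)) I ->
  measurable [set w | theta < Phi 1 (I w - riemann_ito K j w)] /\
  (P (good delta e `&` [set w | (theta < Phi 1 (I w - riemann_ito K j w))%R]) <=
     (C * e / theta)%:E)%E.
Proof.
have [CL CL0 HL] := lenglart T0 hF hW.
have [L L0 HS] := Phi_lipschitz (q := 1) isT hsigma.
(* The squared distance to [S k] is at most [4] times that from [S k] to [sigma (X s)], of integral
   at most [e], plus [4 * (L * (20 * e))], integrated over a time of at most [T]. *)
pose c1 := 4 + 80 * L * T.
have c10 : 0 < c1.
  by rewrite /c1 ltr_wpDr// mulr_ge0 ?(ltW T0)// mulr_ge0.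
exists (8 * CL * c1); first by rewrite !mulr_ge0// ltW.
move=> K j delta e theta I K0 jK e0 th0 Kd [mI [S [wfS cvH cvI]]].
have rI : rv measurable I by exact: rv_borel (sigma_algebra_measurable _) mI.
have rR := rv_riemann_ito K0 jK.
have mset : measurable [set w | theta < Phi 1 (I w - riemann_ito K j w)].
  by apply: measurable_superlevel; apply: rv_measurable_Phi; exact: rvB.
(* The arbitrary [eta] pays for the two events where the approximation by [S k] fails. *)
split=> //; apply/lee_addgt0Pr => eta eta0.
have eta20 : 0 < eta / 2 by rewrite divr_gt0.
have th80 : 0 < theta / 8 by rewrite divr_gt0.
have r0 : 0 < Num.sqrt (theta / 8) by rewrite sqrtr_gt0.
have [k [HkH HkI]] := cvg0_in_probability_near cvH cvI e0 r0 eta20.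
have t0 : 0 <= grid K j by exact: grid_ge0.
have tT : grid K j <= T by exact: grid_leT.
have [n [tau [V [tau0 tauT tauS rV HV]]]] := elementary_merge W hF t0 tT
  (elementary_wf_adapted hF tT (wfS k)) (riemann_elementary_adapted K0 jK).
have [mB PB] := HL _ n tau V (c1 * e) (theta / 8) (mulr_gt0 c10 e0) th80 tau0 tauT tauS rV.
set ZH := fun w => (\int[lebesgue_measure]_(s in `[0%R, grid K j])
            (enorm (elementary_process (S k) s w - sigma (X s w))%R ^+ 2)%:E)%E in HkH.
have [mZ _] := cvH; have [mZI _] := cvI.
have mA1 : measurable [set w | (e%:E <= ZH w)%E].
  by rewrite -[X in measurable X]setTI; apply: emeasurable_fun_c_infty => //; exact: mZ.
have mA2 : measurable [set w | ((Num.sqrt (theta / 8))%:E <=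
   (enorm (elementary_integral W (S k) w - I w))%:E)%E].
  by rewrite -[X in measurable X]setTI; apply: emeasurable_fun_c_infty => //; exact: mZI.
have mG : measurable (good delta e) by exact: (measurable_good T0 hF hXa).
set A1 := [set w | (e%:E <= ZH w)%E] in HkH mA1.
set A2 := [set w | _] in HkI mA2.
set B := [set w | _] in mB PB.
apply: (@le_trans _ _ (P (B `|` (A1 `|` A2)))).
  apply: le_measure; rewrite ?inE.
  - exact: measurableI.
  - by do 2 apply: measurableU => //.
  move=> w [gw /= thw].
  have [eA1|nA1] := leP e%:E (ZH w); first by right; left.
  have [eA2|nA2] := leP (Num.sqrt (theta / 8))%:E
    (enorm (elementary_integral W (S k) w - I w))%:E; first by right; right.
  left; have [HVi HVb] := HV w; split.
    rewrite -lee_fin; apply: le_trans HVb _.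
    have L20 : 0 <= 80 * L * e by rewrite !mulr_ge0// ltW.
    apply: le_trans (ge0_integral_le_nonmeas_cst (D' := `[0, grid K j])
      (a := fun s => enorm (elementary_process (S k) s w - sigma (X s w)) ^+ 2)
      lebesgue_measure (k := 4) _ L20 _ _ _ _ _) _ => //.
    - by move=> x /=; rewrite !in_itv/= => /andP[/ltW-> ->].
    - by move=> x _; rewrite sqr_ge0.
    - by move=> x _; rewrite sqr_ge0.
    - move=> s /=; rewrite in_itv/= => /andP[s0 sj].
      have [l lj ls] := grid_cell s0 sj.
      rewrite (riemann_elementary_process w lj ls) !enorm_sqr.
      have lK : (l < K)%N := leq_trans lj jK.
      have h1 := good_mesh e0 K0 lK Kd ls gw.
      have h2 := le_trans (HS _ _) (ler_wpM2l L0 h1).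
      rewrite -(subrKA (sigma (X s w))); apply: le_trans (PhiD_le _ _ _) _.
      rewrite -opprB PhiN in h2.
      by rewrite (_ : 2 ^+ (2 * 1) = 4); [lra|rewrite -natrX].
    - apply: (@le_trans _ _ (4%:E * e%:E + (80 * L * e)%:E * T%:E)%E).
        apply: leeD; first by apply: lee_wpmul2l; [rewrite lee_fin|exact: ltW nA1].
        apply: lee_wpmul2l; first by rewrite lee_fin.
        rewrite [leLHS](@lebesgue_measure_itv R `]0, grid K j])/= lte_fin; case: ifP => _.
          by rewrite sube0 lee_fin.
        by rewrite lee_fin ltW.
      by rewrite -!EFinM -EFinD lee_fin /c1; lra.
  have PhiI : Phi 1 (I w - elementary_integral W (S k) w) < theta / 8.
    rewrite -opprB PhiN -enorm_sqr -[ltRHS]sqr_sqrtr ?(ltW th80)//.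
    by rewrite ltrXn2r ?nnegrE ?enorm_ge0//; apply/andP; split.
  rewrite ltNge; apply/negP => Hle; move: thw; apply/negP; rewrite -leNgt.
  have -> : I w - riemann_ito K j w = (I w - elementary_integral W (S k) w) +
     (elementary_integral W (S k) w - elementary_integral W (riemann_elementary K j) w).
    by rewrite subrKA.
  apply: le_trans (PhiD_le _ _ _) _; rewrite HVi.
  by rewrite (_ : 2 ^+ (2 * 1) = 4); [lra|rewrite -natrX].
apply: le_trans (measureU2 _ mB (measurableU _ _ mA1 mA2)) _.
apply: (@le_trans _ _ ((CL * (c1 * e) / (theta / 8))%:E + (eta%:E))%E).
  apply: leeD; first exact: PB.
  apply: le_trans (measureU2 _ mA1 mA2) _.
  by rewrite [eta]splitr EFinD; apply: leeD.
rewrite -!EFinD lee_fin lerD2r invf_div.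
by have th := gt_eqF th0; rewrite le_eqVlt; apply/orP; left; apply/eqP; field; rewrite th.
Qed.

Hypothesis hX : solves_sde P T F W mu sigma X.

(* The Euler sum along the exact solution, which the fine Euler scheme is
   compared with before the solution itself. *)
Fixpoint driven (K j : nat) (w : Omega) : 'cV[R]_d :=
  if j is l.+1 then
    driven K l w + (T / K%:R) *: mu (X (grid K l) w) + sigma (X (grid K l) w) *m dW K l w
  else X 0 w.

Lemma drivenE K j w : driven K j w =
  X 0 w + \sum_(l < j) (T / K%:R) *: mu (X (grid K l) w) + riemann_ito K j w.
Proof.
elim: j => [|j IH] /=; first by rewrite /riemann_ito !big_ord0 !addr0.
by rewrite IH /riemann_ito !big_ord_recr/= !addrA; congr (_ + _); rewrite addrAC.
Qed.

Lemma rv_driven K j : (0 < K)%N -> (j <= K)%N -> rv (F (grid K j)) (driven K j).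
Proof.
move=> K0 jK.
have [] := @rv_scheme _ _ _ _ _ _ _ _ hF hW d K (grid K) (T / K%:R) (driven K)
  (fun l w => mu (X (grid K l) w)) (fun l w => sigma (X (grid K l) w)) _ _ _ _ _ _ _ j jK => //.
- exact: grid_ge0.
- exact: grid_leT.
- by rewrite divr_ge0// ltW.
- by move=> i _; exact: gridS.
- by rewrite grid0; apply: (rv_X hF hXa); rewrite lexx ltW.
- move=> i iK _; have rX := rv_X_grid K0 (ltnW iK).
  by split; apply: rv_lipschitz rX.
Qed.

Lemma drift_coord_continuous w i : {within `[0, T], continuous (fun t => mu (X t w) i 0)}.
Proof.
have [L L0 HL] := Phi_lipschitz (q := 1) isT hmu.
apply/subspace_continuousP => s; rewrite /= in_itv/= => sT.
apply/cvgrPdist_lt => /= e e0.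
have e1 : 0 < e ^+ 2 / (L + 1) / 2 by rewrite !divr_gt0 ?exprn_gt0// ltr_wpDl.
have [r r0 rP] := uniform_modulus_mx (@hXc w) e1.
rewrite /prop_near1/= /within/=; apply/nbhs_ballP; exists r => // t/= st.
rewrite in_itv/= => tT; have := rP _ _ sT tT st.
move=> /(ler_wpM2l L0)/(le_trans (HL _ _))/(le_trans (sqr_coord_le_Phi _ i 0)) He.
rewrite -(@ltr_pXn2r _ 2) ?nnegrE ?(ltW e0)// real_normK ?num_real//.
rewrite !mxE in He; apply: le_lt_trans He _.
rewrite mulrA ltr_pdivrMr// mulrCA ltr_pM2l ?exprn_gt0//.
rewrite ltr_pdivrMr ?ltr_wpDl//; lra.
Qed.

(** On [good] the drift error is small for every path, and the noise error is handled by
    [ito_riemann_probability]. A null set [N] accounts for the almost sure form of the equation. *)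
Lemma driven_probability : exists2 C : R, 0 <= C &
  forall K j (delta e theta : R), (0 < K)%N -> (j <= K)%N -> 0 < e -> 0 < theta ->
  T / K%:R < delta ->
  (P (good delta e `&` [set w | (theta < Phi 1 (X (grid K j) w - driven K j w))%R]) <=
     (C * e / theta)%:E)%E.
Proof.
have [C1 C10 H1] := ito_riemann_probability.
have [L L0 HL] := Phi_lipschitz (q := 1) isT hmu.
(* Each of the [d] coordinates of the drift error is at most [T] times the root of
   [L * (20 * e)]. *)
pose c2 := d%:R * (T ^+ 2 * (L * 20)).
have c20 : 0 <= c2 by rewrite mulr_ge0// mulr_ge0 ?sqr_ge0// mulr_ge0.
exists (8 * c2 + 8 * C1); first by rewrite addr_ge0// mulr_ge0.
move=> K j delta e theta K0 jK e0 th0 Kd.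
set C := 8 * c2 + 8 * C1.
have mX (t : R) : 0 <= t <= T -> rv measurable (X t) by exact: (rv_X_measurable hF hXa).
have mG : measurable (good delta e) by exact: (measurable_good T0 hF hXa).
have md : measurable (good delta e `&` [set w | theta < Phi 1 (X (grid K j) w - driven K j w)]).
  apply: measurableI => //; apply: measurable_superlevel; apply: rv_measurable_Phi.
  apply: rvB; first exact: mX (grid_itv K0 jK).
  by apply: (rv_filtration hF (grid_itv K0 jK)); exact: rv_driven.
(* If [C * e] exceeds [theta] the bound is above 1 and trivial. Otherwise [8 * (c2 * e) <= theta],
   and [4 * (c2 * e + theta / 8) <= theta]. *)
have [small|big] := leP (C * e) theta; last first.
  apply: (@le_trans _ _ 1%E); first exact: probability_le1.
  by rewrite lee_fin ler_pdivlMr// mul1r ltW.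
have tin : grid K j \in `[0, T] by rewrite in_itv/= grid_itv.
have [I hI Xae] := hX tin.
have th8 : 0 < theta / 8 by rewrite divr_gt0.
have [mI HI] := H1 K j delta e (theta / 8) I K0 jK e0 th8 Kd hI.
have [N [mN N0 HN]] := Xae.
set A := good delta e `&` [set w | theta / 8 < Phi 1 (I w - riemann_ito K j w)] in mI HI *.
have mA : measurable A by exact: measurableI.
apply: (@le_trans _ _ (P (A `|` N))).
  apply: le_measure; rewrite ?inE//; first exact: measurableU.
  move=> w [gw /= thw].
  have [/HN|/contrapT XE] := pselect (~ (X (grid K j) w = X 0 w +
        \col_(i < d) (\int[lebesgue_measure]_(s in `[0, grid K j]) mu (X s w) i 0)%R
        + I w)); first by right.
  left; split=> //=.
  set dr := \col_(i < d) _ in XE.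
  pose rs := \sum_(l < j) (T / K%:R) *: mu (X (grid K l) w).
  have dPhi : Phi 1 (dr - rs) <= c2 * e.
    rewrite /Phi (eq_bigr (fun i => (dr i 0 - rs i 0) ^+ 2)); last first.
      by move=> i _; rewrite big_ord1 !mxE.
    apply: (@le_trans _ _ (\sum_(i < d) (T ^+ 2 * (L * (20 * e))))); last first.
      rewrite sumr_const card_ord -[leLHS]mulr_natl /c2 le_eqVlt.
      by apply/orP; left; apply/eqP; ring.
    apply: ler_sum => i _.
    have k0 : 0 <= L * (20 * e) by rewrite !mulr_ge0// ltW.
    have := riemann_sum_error T0 K0 jK (sqrtr_ge0 (L * (20 * e))) (@drift_coord_continuous w i).
    set D := (_ - _) => HD.
    have -> : dr i 0 - rs i 0 = D.
      rewrite /dr /rs mxE summxE /D; congr (_ - _).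
      by apply: eq_bigr => l _; rewrite mxE.
    rewrite -(sqr_sqrtr k0) -exprMn -[D ^+ 2]real_normK ?num_real//.
    rewrite lerXn2r ?nnegrE ?mulr_ge0 ?sqrtr_ge0 ?(ltW T0)//; apply: HD => s t sT tT st.
    rewrite -(@ler_pXn2r _ 2) ?nnegrE ?sqrtr_ge0// real_normK ?num_real// sqr_sqrtr//.
    have h1 : Phi 1 (X s w - X t w) <= 20 * e.
      by apply: (goodP T0 hXc e0 gw) => //; exact: le_lt_trans st Kd.
    have := sqr_coord_le_Phi (mu (X s w) - mu (X t w)) i 0; rewrite !mxE => /le_trans; apply.
    by apply: le_trans (HL _ _) _; apply: ler_wpM2l.
  rewrite drivenE XE in thw.
  have E3 : X 0 w + dr + I w - (X 0 w + rs + riemann_ito K j w) =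
    (dr - rs) + (I w - riemann_ito K j w).
    by apply/matrixP => i l; rewrite !mxE; ring.
  rewrite E3 in thw; have := lt_le_trans thw (PhiD_le _ _ _).
  have : 8 * (c2 * e) <= theta.
    by apply: le_trans small; rewrite mulrA ler_wpM2r ?(ltW e0)// lerDl mulr_ge0.
  by rewrite (_ : 2 ^+ (2 * 1) = 4); [lra|rewrite -natrX].
apply: le_trans (measureU2 _ mA mN) _.
rewrite [X in (_ + X)%E](_ : _ = 0%E); last exact: N0.
rewrite adde0; apply: le_trans HI _; rewrite lee_fin invf_div.
rewrite (_ : C1 * e * (8 / theta) = 8 * C1 * e / theta); last by ring.
apply: ler_wpM2r; first by rewrite invr_ge0 ltW.
by apply: ler_wpM2r; [exact: ltW|rewrite lerDr mulr_ge0].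
Qed.

End ito_riemann.

Lemma sigma_algebraI disp (T : measurableType disp) (G : set (set T)) (A B : set T) :
  sigma_algebra setT G -> G A -> G B -> G (A `&` B).
Proof.
move=> sG GA GB.
have mA : measurable (A : set (g_sigma_algebraType G)) by exact: sub_sigma_algebra.
have mB : measurable (B : set (g_sigma_algebraType G)) by exact: sub_sigma_algebra.
by have := measurableI _ _ mA mB; rewrite /measurable/= sigma_algebra_id.
Qed.

(** * Convergence of the Euler scheme in probability *)

Section stopped_scheme.
Context {disp : measure_display} {Omega : measurableType disp} {R : realType}.
Variables (P : probability Omega R) (T : R) (F : R -> set (set Omega)).
Variables (d m : nat) (W : R -> Omega -> 'cV[R]_m).
Hypotheses (T0 : 0 < T) (hF : is_filtration T F).
Hypothesis hW : standard_brownian_motion P T F W.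
Variables (mu : 'cV[R]_d -> 'cV[R]_d) (sigma : 'cV[R]_d -> 'M[R]_(d, m)).
Hypotheses (hmu : globally_lipschitz mu) (hsigma : globally_lipschitz sigma).
Variable X : R -> Omega -> 'cV[R]_d.
Hypotheses (hXa : adapted T F X) (hXc : continuous_paths T X).

Local Notation grid := (grid T).
Local Notation dW := (dW T W).
Local Notation good := (good T X).
Local Notation euler := (euler T W mu sigma (X 0)).
Local Notation driven := (driven T W mu sigma X).
Local Notation frozen := (frozen T W mu sigma (X 0)).

Lemma rv_initial : rv (F 0) (X 0).
Proof. by apply: (rv_X hF hXa); rewrite lexx ltW. Qed.

Section fixed_mesh.
Variables (N M : nat) (e : R).
Hypotheses (N0 : (0 < N)%N) (M0 : (0 < M)%N) (e0 : 0 < e).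
Let K := (N * M)%N.
Let fl i := (i %/ M * M)%N.

(** Two deviations are monitored: the motion of [X] since the last coarse node, with the factor 20
    of [goodP], and the error of [driven] at that node only. The second is thus tested at finitely
    many nodes, whose number does not depend on [M]. *)
Definition close (i : nat) (w : Omega) : bool :=
  (Phi 1 (X (grid K i) w - X (grid K (fl i)) w) <= 20 * e) &&
  (Phi 1 (X (grid K (fl i)) w - driven K (fl i) w) <= e).

(** Records that stopping has not occurred up to [i]; this is known at time [grid K i], so
    multiplying coefficients by it preserves adaptedness. *)
Fixpoint active (i : nat) (w : Omega) : bool :=
  if i is j.+1 then active j w && close i w else close 0 w.

(* The difference of the two schemes, frozen once the exact solution has left
   the region where the fine scheme is known to follow it. *)
Fixpoint stopped (i : nat) (w : Omega) : 'cV[R]_d :=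
  if i is j.+1 then
    stopped j w +
    (T / K%:R) *: (if active j w then mu (X (grid K j) w) - mu (euler N (j %/ M) w) else 0) +
    (if active j w then sigma (X (grid K j) w) - sigma (euler N (j %/ M) w) else 0) *m dW K j w
  else 0.

Lemma fine_gt0 : (0 < K)%N. Proof. by rewrite muln_gt0 N0. Qed.

Lemma active_le i j w : (i <= j)%N -> active j w -> active i w.
Proof.
elim: j => [|j IH]; first by rewrite leqn0 => /eqP->.
by rewrite leq_eqVlt ltnS => /predU1P[->//|/IH{}IH] /= /andP[/IH].
Qed.

Lemma active_close i w : active i w -> close i w.
Proof. by case: i => //= i /andP[]. Qed.

Lemma activeP i w : (forall l, (l <= i)%N -> close l w) -> active i w.
Proof.
elim: i => [|i IH] H /=; first exact: H.
by rewrite IH ?H// => l li; apply: H; exact: ltnW.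
Qed.

Lemma stopped_active i w : (forall l, (l < i)%N -> active l w) ->
  stopped i w = driven K i w - frozen N M i w.
Proof.
elim: i => [|i IH] H /=; first by rewrite subrr.
rewrite IH => [|l li]; last by apply: H; exact: ltnW.
rewrite (H i (ltnSn i)) scalerBr mulmxBl -/K !opprD.
by rewrite [RHS]addrACA; congr (_ + _); rewrite addrACA.
Qed.

Lemma rv_close i : (i <= K)%N -> F (grid K i) [set w | close i w].
Proof.
move=> iK; have itv := grid_itv T0 fine_gt0 iK.
have flK : (fl i <= K)%N by exact: leq_trans (leq_trunc_div _ _) iK.
have rfl n (Z : Omega -> 'cV[R]_n) : rv (F (grid K (fl i))) Z -> rv (F (grid K i)) Z.
  apply: (rv_filtration_le hF); [exact: grid_ge0|exact/grid_le/leq_trunc_div|exact: grid_leT fine_gt0 _].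
have sG := filtration_sigma hF itv.
rewrite (_ : [set w | _] = [set w | Phi 1 (X (grid K i) w - X (grid K (fl i)) w) <= 20 * e] `&`
  [set w | Phi 1 (X (grid K (fl i)) w - driven K (fl i) w) <= e]).
  apply: sigma_algebraI => //; apply: gmeas_le => //; apply: gmeas_Phi; apply: rvB.
  - exact: (rv_X_grid T0 hF hXa fine_gt0).
  - by apply: rfl; apply: (rv_X_grid T0 hF hXa fine_gt0).
  - by apply: rfl; apply: (rv_X_grid T0 hF hXa fine_gt0).
  - by apply: rfl; apply: (rv_driven T0 hF hW hmu hsigma hXa fine_gt0).
by apply/seteqP; split => w /= /andP.
Qed.

Lemma rv_active i : (i <= K)%N -> F (grid K i) [set w | active i w].
Proof.
elim: i => [|i IH] iK /=; first exact: rv_close.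
rewrite (_ : [set w | _] = [set w | active i w] `&` [set w | close i.+1 w]); last first.
  by apply/seteqP; split => w /= /andP.
have [_ _ Fle] := hF.
apply: sigma_algebraI; [exact: (filtration_sigma hF (grid_itv T0 fine_gt0 iK))| |exact: rv_close].
apply: (Fle (grid K i)); last exact/IH/ltnW.
- exact: grid_ge0.
- exact: grid_le.
- exact: grid_leT fine_gt0 _.
Qed.

Variable L : R.
Hypothesis L0 : 0 <= L.

(** Through [X] and [driven] at the last coarse node, two uses of [PhiD_le] give
    [4 * (20 * e + 4 * (e + Phi))], with [Phi] that of the stopped difference; [80 + 16 = 96]. *)
Lemma active_gap i w : (i < K)%N -> active i w ->
  Phi 1 (X (grid K i) w - euler N (i %/ M) w) <= 96 * (e + Phi 1 (stopped (fl i) w)).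
Proof.
move=> iK act.
have act' l : (l < fl i)%N -> active l w.
  by move=> li; apply: active_le act; apply: ltnW (leq_trans li (leq_trunc_div _ _)).
rewrite (stopped_active act') /fl frozen_coarse//.
have /andP[] := active_close act; rewrite /fl.
set x := X (grid K i) w; set y := X _ w; set z := driven _ _ _; set u := euler _ _ _.
move=> h1 h2.
rewrite -(subrKA y); apply: le_trans (PhiD_le _ _ _) _.
have := PhiD_le 1 (y - z) (z - u); rewrite subrKA.
rewrite (_ : 2 ^+ (2 * 1) = 4 :> R); last by rewrite -natrX.
by have := Phi_ge0 1 (z - u); move: e0; lra.
Qed.

Lemma stopped_gap_moment (k n : nat) (f : 'cV[R]_d -> 'M[R]_(k, n)) i x :
  globally_lipschitz f ->
  (forall x y, Phi 1 (f x - f y) <= L * Phi 1 (x - y)) -> (i < K)%N -> 0 <= x ->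
  rv measurable (stopped (fl i)) -> mom_le P 1 (stopped (fl i)) x ->
  mom_le P 1 (fun w => if active i w then f (X (grid K i) w) - f (euler N (i %/ M) w) else 0)
    (96 * L * (e + x)).
Proof.
move=> hf fL iK x0 rD Dx; rewrite /mom_le.
apply: (@le_trans _ _ (\int[P]_w ((96 * L)%:E * (e%:E + (Phi 1 (stopped (fl i) w))%:E)))%E).
  apply: ge0_le_integral_nonmeas => w; first by rewrite lee_fin Phi_ge0.
  rewrite -EFinD -EFinM lee_fin; case: ifP => act; last first.
    by rewrite Phi0// !mulr_ge0// addr_ge0 ?Phi_ge0// ltW.
  apply: le_trans (fL _ _) _; rewrite [96 * L]mulrC -mulrA.
  by apply: ler_wpM2l => //; exact: active_gap.
have mPhi : measurable_fun setT (fun w => (Phi 1 (stopped (fl i) w))%:E).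
  exact/measurable_EFinP/rv_measurable_Phi.
rewrite ge0_integralZl//; last 3 first.
- exact: emeasurable_funD.
- by move=> w _; rewrite -EFinD lee_fin addr_ge0 ?Phi_ge0// ltW.
- by rewrite lee_fin mulr_ge0.
rewrite [X in (_ <= X)%E]EFinM; apply: lee_wpmul2l; first by rewrite lee_fin mulr_ge0.
rewrite ge0_integralD//; last 2 first.
- by move=> w _; rewrite lee_fin ltW.
- by move=> w _; rewrite lee_fin Phi_ge0.
by rewrite integral_cst//= probability_setT mule1 EFinD; apply: leeD.
Qed.

End fixed_mesh.

(** [active_gap] bounds the coefficients by [e] plus the stopped difference at the last coarse node,
    which is the hypothesis of [gronwall_frozen] with [b = e]. The factor [T ^+ 2 + T] compensates
    its divisions. *)
Lemma stopped_moment : exists2 C : R, 0 <= C & forall N M e j,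
  (0 < N)%N -> (0 < M)%N -> 0 < e -> (j <= N * M)%N ->
  rv measurable (stopped N M e j) /\ mom_le P 1 (stopped N M e j) (C * e).
Proof.
have [L1 L10 muL1] := Phi_lipschitz (q := 1) isT hmu.
have [L2 L20 sigmaL2] := Phi_lipschitz (q := 1) isT hsigma.
pose L := L1 + L2; have L0 : 0 <= L by rewrite addr_ge0.
have muL x y : Phi 1 (mu x - mu y) <= L * Phi 1 (x - y).
  by apply: le_trans (muL1 x y) _; rewrite ler_wpM2r ?Phi_ge0// lerDl.
have sigmaL x y : Phi 1 (sigma x - sigma y) <= L * Phi 1 (x - y).
  by apply: le_trans (sigmaL2 x y) _; rewrite ler_wpM2r ?Phi_ge0// lerDr.
have c0 : 0 <= 96 * L * (T ^+ 2 + T) by rewrite !mulr_ge0// addr_ge0 ?sqr_ge0 ?ltW.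
have [C C0 HC] := gronwall_frozen hF hW (q := 1) isT c0.
exists C => // N M e j N0 M0 e0 jK.
set K := (N * M)%N in jK *; have K0 : (0 < K)%N by rewrite muln_gt0 N0.
pose gap (k n : nat) (f : 'cV[R]_d -> 'M[R]_(k, n)) i w :=
  if active N M e i w then f (X (grid K i) w) - f (euler N (i %/ M) w) else 0.
have rgap (k n : nat) (f : 'cV[R]_d -> 'M[R]_(k, n)) i : globally_lipschitz f ->
    (i < K)%N -> rv (F (grid K i)) (gap _ _ f i).
  move=> hf iK; apply: rv_if; [exact: rv_active (ltnW iK)| |exact: rv_cst].
  apply: rvB; apply: rv_lipschitz hf _.
    by apply: (rv_X_grid T0 hF hXa K0); exact: ltnW.
  exact: (rv_euler_coarse T0 hF hW hmu hsigma rv_initial).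
have tauS i : (i < K)%N -> grid K i.+1 = grid K i + T / K%:R by rewrite gridS.
have dt0 : 0 < T / K%:R by rewrite divr_gt0// ltr0n.
have gK : grid K K <= T by rewrite gridK.
have g0 : 0 <= grid K 0 by rewrite grid0.
have rD i : (i <= K)%N -> rv (F (grid K i)) (stopped N M e i).
  move=> iK.
  have [] := @rv_scheme _ _ _ _ _ _ _ _ hF hW d K (grid K) (T / K%:R) (stopped N M e)
    (gap _ _ mu) (gap _ _ sigma) g0 gK (ltW dt0) tauS _ _ _ i iK => //.
    exact: rv_cst.
  by move=> l lK _; split; exact: rgap.
have rDm i : (i <= K)%N -> rv measurable (stopped N M e i).
  by move=> iK; apply: (rv_filtration hF (grid_itv T0 K0 iK)); exact: rD.
split; first exact: rDm.
apply: (HC d K (grid K) (T / K%:R) e (fun i => i %/ M * M)%N (stopped N M e)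
  (gap _ _ mu) (gap _ _ sigma) g0 gK dt0 (ltW e0) tauS) => //.
- by move=> i _; exact: leq_trunc_div.
- exact: rv_cst.
- by move=> l lK _; split; exact: rgap.
- by apply: (mom_le_trans (ltW e0)); exact: mom_le0.
move=> i x iK x0 Dx.
have KT : K%:R * (T / K%:R) = T by rewrite mulrC divfK// pnatr_eq0 -lt0n.
have fliK : (i %/ M * M <= K)%N by exact: leq_trans (leq_trunc_div _ _) (ltnW iK).
have ex0 : 0 <= 96 * L * (e + x) by rewrite !mulr_ge0// addr_ge0// ltW.
rewrite KT; split.
- apply: (mom_le_trans _ (stopped_gap_moment N0 M0 e0 L0 hmu muL iK x0 (rDm _ fliK) Dx)).
  rewrite ler_pdivlMr ?exprn_gt0// [leRHS]mulrAC ler_wpM2l// muln1 lerDl ltW//.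
- apply: (mom_le_trans _ (stopped_gap_moment N0 M0 e0 L0 hsigma sigmaL iK x0 (rDm _ fliK) Dx)).
  rewrite ler_pdivlMr ?exprn_gt0// [leRHS]mulrAC ler_wpM2l// expr1 lerDr sqr_ge0//.
Qed.

Hypothesis hX : solves_sde P T F W mu sigma X.

(** The refinement [M] is auxiliary: it makes [driven] accurate at the [N.+1] coarse nodes. Four bad
    events get [eta / 4] each: two failures of path regularity, an inaccurate node, and a large
    stopped difference. *)
Lemma euler_cvg_in_probability (theta eta : R) : 0 < theta -> 0 < eta ->
  exists2 N0, (0 < N0)%N & forall N j, (N0 <= N)%N -> (j <= N)%N ->
  (P [set w | (theta < Phi 1 (X (grid N j) w - euler N j w))%R] <= eta%:E)%E.
Proof.
move=> th0 eta0.
have [C1 C10 H1] := driven_probability T0 hF hW hmu hsigma hXa hXc hX.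
have [C2 C20 H2] := stopped_moment.
(* The first bound gives [4 * (e + theta / 16) <= theta], the second bounds the Markov estimate
   [16 * C2 * e / theta] by [eta / 4]. *)
pose e := Num.min (theta / 8) (eta * theta / (64 * (C2 + 1))).
have C21 : 0 < C2 + 1 by rewrite ltr_wpDl.
have e0 : 0 < e.
  by rewrite /e lt_min !divr_gt0//= ?mulr_gt0.
have e1 : 8 * e <= theta by rewrite mulrC -ler_pdivlMr// /e ge_min lexx.
have e2 : 64 * (C2 * e) <= eta * theta.
  have : e * (64 * (C2 + 1)) <= eta * theta.
    by rewrite -ler_pdivlMr ?mulr_gt0// /e ge_min lexx orbT.
  by apply: le_trans; lra.
have eta4 : 0 < eta / 4 by rewrite divr_gt0.
have [delta delta0 Pg] := good_probability P T0 hF hXa hXc e0 eta4.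
have [N0 N00 HN0] := small_mesh T delta0.
exists N0 => // N j NN jN; have Npos : (0 < N)%N := leq_trans N00 NN.
(* [driven] has to be accurate at all [N.+1] coarse nodes at once, so each may fail with probability
   [eta / (4 * N.+1)] only. Hence [delta'] and [M] are chosen after [N]. *)
pose e' := e * eta / (4 * N.+1%:R * (C1 + 1)).
have C11 : 0 < C1 + 1 by rewrite ltr_wpDl.
have e'0 : 0 < e' by rewrite /e' divr_gt0 ?mulr_gt0.
have [delta' delta'0 Pg'] := good_probability P T0 hF hXa hXc e'0 eta4.
have [M M0 /(_ M (leqnn M)) HM] := small_mesh T delta'0.
set K := (N * M)%N; have K0 : (0 < K)%N by rewrite muln_gt0 Npos.
have Kd : T / K%:R < delta'.
  apply: le_lt_trans HM; rewrite ler_pM2l// lef_pV2 ?posrE ?ltr0n// ler_nat.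
  exact: leq_pmull.
pose B3 k := good delta' e' `&` [set w | e < Phi 1 (X (grid K (k * M)) w - driven K (k * M) w)].
have kMK k : (k < N.+1)%N -> (k * M <= K)%N by rewrite ltnS leq_mul2r => ->; rewrite orbT.
have mB3 k : (k < N.+1)%N -> measurable (B3 k).
  move=> kN; apply: measurableI; first exact: (measurable_good T0 hF hXa).
  apply: measurable_superlevel; apply: rv_measurable_Phi; apply: rvB.
    exact: (rv_X_measurable hF hXa (grid_itv T0 K0 (kMK k kN))).
  by apply: (rv_filtration hF (grid_itv T0 K0 (kMK k kN)));
    apply: (rv_driven T0 hF hW hmu hsigma hXa K0); exact: kMK.
have PB3 k : (k < N.+1)%N -> (P (B3 k) <= (eta / (4 * N.+1%:R))%:E)%E.
  move=> kN; apply: le_trans (H1 K (k * M)%N delta' e' e K0 (kMK k kN) e'0 e0 Kd) _.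
  rewrite lee_fin ler_pdivrMr// /e'.
  rewrite (_ : C1 * _ = C1 / (C1 + 1) * (eta / (4 * N.+1%:R) * e)); last first.
    by field; rewrite !gt_eqF//= natr1 ltr0n.
  rewrite ger_pMl; last by rewrite mulr_gt0// divr_gt0.
  by rewrite ler_pdivrMr// mul1r lerDl.
pose D := stopped N M e (j * M).
have [rD mD] := H2 N M e (j * M)%N Npos M0 e0 (kMK j jN).
pose B4 := [set w | theta / 16 < Phi 1 (D w)].
have th16 : 0 < theta / 16 by rewrite divr_gt0.
have mB4 : measurable B4 by apply: measurable_superlevel; exact: rv_measurable_Phi.
have PB4 : (P B4 <= (eta / 4)%:E)%E.
  have := ebound_markov th16 (ebound_Phi rD mD).
  move=> /le_trans; apply; rewrite lee_fin ler_pdivrMr//; lra.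
pose B12 := ~` good delta e `|` ~` good delta' e'.
have mB1 dl e1' : measurable (~` good dl e1').
  by apply: measurableC; exact: (measurable_good T0 hF hXa).
have mB12 : measurable B12 by apply: measurableU.
have mBU : measurable (\big[setU/set0]_(k < N.+1) B3 k).
  by apply: bigsetU_measurable => k _; exact: mB3.
apply: (@le_trans _ _ (P ((B12 `|` \big[setU/set0]_(k < N.+1) B3 k) `|` B4))).
  apply: le_measure; rewrite ?inE.
  - apply: measurable_superlevel; apply: rv_measurable_Phi; apply: rvB.
      exact: (rv_X_measurable hF hXa (grid_itv T0 Npos jN)).
    apply: (rv_filtration hF (grid_itv T0 Npos jN)).
    exact: (rv_euler T0 hF hW hmu hsigma rv_initial Npos jN).
  - by apply: measurableU => //; apply: measurableU.
  move=> w /= thw.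
  have [g1|] := pselect (good delta e w); last by left; left; left.
  have [g2|] := pselect (good delta' e' w); last by left; left; right.
  have [[k kN bk]|nB3] := pselect (exists2 k, (k < N.+1)%N & B3 k w).
    by left; right; rewrite -bigcup_mkord; exists k.
  right; rewrite /B4 /=.
  have fine k : (k < N.+1)%N -> Phi 1 (X (grid K (k * M)) w - driven K (k * M) w) <= e.
    by move=> kN; rewrite leNgt; apply/negP => Hk; apply: nB3; exists k.
  have act i : (i < K)%N -> active N M e i w.
    move=> iK; apply: activeP => l li; have lK := leq_ltn_trans li iK.
    have lMN : (l %/ M < N)%N by exact: coarse_lt.
    apply/andP; split; last by apply: fine; exact: ltnW.
    apply: (goodP T0 hXc e0 g1); [exact: grid_itv (ltnW lK)|apply: grid_itv => //; apply: kMK; exact: ltnW|].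
    rewrite ger0_norm ?subr_ge0; last by apply: grid_le => //; exact: leq_trunc_div.
    apply: le_lt_trans (HN0 N NN).
    rewrite lerBlDr grid_refine//.
    rewrite addrC -gridS -(grid_refine T N _ M0); apply: grid_le => //.
    exact/ltnW/ltn_ceil.
  have DE : D w = driven K (j * M) w - euler N j w.
    rewrite /D stopped_active ?frozen_coarse// => l lj; apply: act.
    exact: leq_trans lj (kMK j jN).
  have := fine j jN; rewrite grid_refine// => fj.
  rewrite DE ltNge; apply/negP => Hle; move: thw; apply/negP; rewrite -leNgt.
  rewrite -(subrKA (driven K (j * M) w)); apply: le_trans (PhiD_le _ _ _) _.
  by rewrite (_ : 2 ^+ (2 * 1) = 4); [lra|rewrite -natrX].
apply: le_trans (measureU2 _ (measurableU _ _ mB12 mBU) mB4) _.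
have -> : eta%:E = (((eta / 4)%:E + (eta / 4)%:E) + (eta / 4)%:E + (eta / 4)%:E)%E.
  by rewrite -!EFinD; congr (_%:E); field.
apply: leeD => //; apply: le_trans (measureU2 _ mB12 mBU) _; apply: leeD.
  by apply: le_trans (measureU2 _ _ _) _ => //; apply: leeD.
apply: le_trans (@le_mu_bigsetU _ R Omega P B3 N.+1 mB3) _.
apply: (@le_trans _ _ (\sum_(k < N.+1) (eta / (4 * N.+1%:R))%:E)%E).
  by apply: lee_sum => k _; exact: PB3.
rewrite sumEFin lee_fin sumr_const card_ord -[leLHS]mulr_natr.
by rewrite le_eqVlt; apply/orP; left; apply/eqP; field; rewrite nat1r pnatr_eq0.
Qed.

End stopped_scheme.

Lemma ge0_integral_le_trunc disp (E : measurableType disp) (R : realType)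
    (mu : {measure set E -> \bar R}) (f : E -> R) (c : \bar R) :
  measurable_fun setT f -> (forall x, 0 <= f x) ->
  (forall K : nat, (\int[mu]_x (Num.min (f x) K%:R)%:E <= c)%E) ->
  (\int[mu]_x (f x)%:E <= c)%E.
Proof.
move=> mf f0 H.
pose g (n : nat) x := (Num.min (f x) n%:R)%:E.
have fE x : (f x)%:E = limn (g^~ x).
  apply/esym/cvg_lim => //; apply: cvg_near_cst.
  exists (Num.truncn (f x)).+1 => // n /= nf; rewrite /g min_l//.
  by apply: le_trans (ltW (truncnS_gt _)) _; rewrite ler_nat.
under eq_integral do rewrite fE.
rewrite monotone_convergence//.
- apply: lime_le; last by apply: nearW.
  apply: ereal_nondecreasing_is_cvgn => m n mn; apply: ge0_le_integral => //.
  + by move=> x _; rewrite lee_fin le_min f0/=.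
  + by apply/measurable_EFinP/measurable_minr.
  + by apply/measurable_EFinP/measurable_minr.
  + by move=> x _; rewrite lee_fin le_min ge_min lexx/= ge_min ler_nat mn orbT.
- by move=> n; apply/measurable_EFinP/measurable_minr.
- by move=> n x _; rewrite lee_fin le_min f0/=.
- by move=> x _ m n mn; rewrite lee_fin le_min ge_min lexx/= ge_min ler_nat mn orbT.
Qed.

Lemma Phi_le_Phi1 (R : realType) q m n (A : 'M[R]_(m, n)) : (0 < q)%N -> Phi q A <= Phi 1 A ^+ q.
Proof.
move=> q0; apply: le_trans (Phi_le_enorm A q0) _.
by rewrite exprM enorm_sqr.
Qed.

(** * Moments of the solution and of the error *)

Section fatou.
Context {disp : measure_display} {Omega : measurableType disp} {R : realType}.
Variable P : probability Omega R.

(* Fatou's lemma along convergence in probability; the constant is not sharp. *)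
Lemma mom_le_cvg_in_probability (q d : nat) (Z : Omega -> 'cV[R]_d) (c : R) :
  (0 < q)%N -> 0 <= c -> rv measurable Z ->
  (forall theta eta : R, 0 < theta -> 0 < eta -> exists Z' : Omega -> 'cV[R]_d,
     [/\ rv measurable Z', mom_le P q Z' c &
         (P [set w | (theta < Phi 1 (Z w - Z' w))%R] <= eta%:E)%E]) ->
  mom_le P q Z (2 ^+ (2 * q) * c).
Proof.
move=> q0 c0 rZ HZ; rewrite /mom_le.
have mZ : measurable_fun setT (fun w => Phi q (Z w)) by exact: rv_measurable_Phi.
apply: ge0_integral_le_trunc => // [w|K]; first exact: Phi_ge0.
apply/lee_addgt0Pr => e e0.
pose k2 : R := 2 ^+ (2 * q); have k20 : 0 < k2 by rewrite exprn_gt0.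
(* The cap at 1 gives [rho ^+ q <= rho], turning closeness in [Phi 1] into closeness in [Phi q]; the
   other bound makes the resulting error at most [e / 2]. *)
pose rho := Num.min 1 (e / (2 * k2)).
have rho0 : 0 < rho by rewrite lt_min ltr01 divr_gt0// mulr_gt0.
have rho1 : rho <= 1 by rewrite ge_min lexx.
have rhoe : k2 * rho <= e / 2.
  have : rho <= e / (2 * k2) by rewrite ge_min lexx orbT.
  by rewrite ler_pdivlMr ?mulr_gt0//; lra.
(* On the exceptional event only the truncation at [K] is available; it costs [K * eta <= e / 2]. *)
pose eta := e / (2 * (K%:R + 1)); have K1 : 0 < K%:R + 1 :> R by rewrite ltr_wpDl.
have eta0 : 0 < eta by rewrite divr_gt0// mulr_gt0.
have [Z' [rZ' mZ' PZ]] := HZ rho eta rho0 eta0.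
set A := [set w | _] in PZ.
have mA : measurable A.
  by apply: measurable_superlevel; apply: rv_measurable_Phi; exact: rvB.
have mPhi' : measurable_fun setT (fun w => Phi q (Z' w)) by exact: rv_measurable_Phi.
apply: (@le_trans _ _ (\int[P]_w (k2%:E * (Phi q (Z' w))%:E + ((k2 * rho)%:E + K%:R%:E * (\1_A w)%:E)))%E).
  apply: ge0_le_integral_nonmeas => w; first by rewrite lee_fin le_min Phi_ge0/=.
  rewrite -!EFinM -!EFinD lee_fin.
  have [wA|wA] := boolP (w \in A).
    rewrite indicE wA mulr1 ge_min; apply/orP; right.
    by rewrite addrA lerDr addr_ge0// mulr_ge0 ?Phi_ge0// ltW.
  rewrite indicE (negbTE wA) mulr0 addr0 ge_min; apply/orP; left.
  have : Phi 1 (Z w - Z' w) <= rho.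
    by rewrite leNgt; apply: contraNN wA => h; rewrite inE.
  move=> h; have h1 : Phi q (Z w - Z' w) <= rho.
    apply: le_trans (Phi_le_Phi1 _ q0) _; apply: (@le_trans _ _ (rho ^+ q)).
      by rewrite lerXn2r ?nnegrE ?Phi_ge0// ltW.
    by rewrite -[leRHS]expr1; apply: ler_wiXn2l; rewrite ?(ltW rho0).
  rewrite -{1}(subrK (Z' w) (Z w)) -mulrDr; apply: le_trans (PhiD_le _ _ _) _.
  by rewrite ler_pM2l// addrC lerD2l.
rewrite ge0_integralD//; last 4 first.
- by move=> w _; rewrite mule_ge0 ?lee_fin ?Phi_ge0// ltW.
- by apply: emeasurable_funM => //; exact/measurable_EFinP.
- by move=> w _; rewrite -EFinM -EFinD lee_fin addr_ge0 ?mulr_ge0// ltW.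
- apply: emeasurable_funD => //; apply: emeasurable_funM => //.
  by apply/measurable_EFinP; exact: measurable_indic.
rewrite ge0_integralZl//; last 3 first.
- exact/measurable_EFinP.
- by move=> w _; rewrite lee_fin Phi_ge0.
- by rewrite lee_fin ltW.
rewrite -/k2 [X in (_ <= X + _)%E]EFinM; apply: leeD.
  by apply: lee_wpmul2l => //; rewrite lee_fin ltW.
rewrite ge0_integralD//; last 2 first.
- by move=> w _; rewrite lee_fin mulr_ge0// ltW.
- by apply: emeasurable_funM => //; apply/measurable_EFinP; exact: measurable_indic.
rewrite integral_cst//= probability_setT mule1 ge0_integralZl//; do ?[by apply/measurable_EFinP; exact: measurable_indic|by move=> w _; rewrite lee_fin].
rewrite integral_indic// setIT.
apply: (@le_trans _ _ ((e / 2)%:E + K%:R%:E * eta%:E)%E).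
  by apply: leeD; [rewrite lee_fin|apply: lee_wpmul2l => //; rewrite lee_fin].
rewrite -EFinM -EFinD lee_fin [leRHS]splitr lerD2l /eta.
rewrite (_ : K%:R * _ = K%:R / (K%:R + 1) * (e / 2)); last by field; rewrite gt_eqF.
rewrite ger_pMl ?divr_gt0// ler_pdivrMr// mul1r lerDl//.
Qed.

End fatou.

Section solution_moments.
Context {disp : measure_display} {Omega : measurableType disp} {R : realType}.
Variables (P : probability Omega R) (T : R) (F : R -> set (set Omega)).
Variables (d m : nat) (W : R -> Omega -> 'cV[R]_m).
Hypotheses (T0 : 0 < T) (hF : is_filtration T F).
Hypothesis hW : standard_brownian_motion P T F W.
Variables (mu : 'cV[R]_d -> 'cV[R]_d) (sigma : 'cV[R]_d -> 'M[R]_(d, m)).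
Hypotheses (hmu : globally_lipschitz mu) (hsigma : globally_lipschitz sigma).
Variable X : R -> Omega -> 'cV[R]_d.
Hypotheses (hXa : adapted T F X) (hXc : continuous_paths T X).
Hypothesis hX : solves_sde P T F W mu sigma X.
Hypothesis hX0 : forall p : R, 1 <= p ->
  (\int[P]_w (enorm (X 0 w) `^ p)%:E < +oo)%E.

Local Notation grid := (grid T).
Local Notation euler := (euler T W mu sigma (X 0)).

Lemma initial_moment q : (0 < q)%N -> exists c, mom_le P q (X 0) c.
Proof.
move=> q0; have p1 : 1 <= (2 * q)%:R :> R by rewrite ler1n muln_gt0.
have := hX0 p1; set I := (\int[P]_w _)%E => Ioo.
have I0 : (0 <= I)%E by apply: integral_ge0 => w _; rewrite lee_fin powR_ge0.
exists (fine I); rewrite /mom_le fineK; last by rewrite ge0_fin_numE.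
apply: ge0_le_integral_nonmeas => w; first by rewrite lee_fin Phi_ge0.
by rewrite lee_fin powR_mulrn ?enorm_ge0//; exact: Phi_le_enorm.
Qed.

Let rX0 : rv (F 0) (X 0) := rv_initial T0 hF hXa.

Lemma rv_euler_grid N j : (0 < N)%N -> (j <= N)%N -> rv measurable (euler N j).
Proof.
move=> N0 jN; apply: (rv_filtration hF (grid_itv T0 N0 jN)).
exact: (rv_euler T0 hF hW hmu hsigma rX0).
Qed.

Lemma rv_solution_grid N j : (0 < N)%N -> (j <= N)%N -> rv measurable (X (grid N j)).
Proof. by move=> N0 jN; exact: (rv_X_measurable hF hXa (grid_itv T0 N0 jN)). Qed.

Lemma euler_fine_close N (theta eta : R) : (0 < N)%N -> 0 < theta -> 0 < eta ->
  exists2 M, (0 < M)%N & forall j, (j <= N)%N ->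
  (P [set w | (theta < Phi 1 (X (grid N j) w - euler (N * M) (j * M) w))%R] <= eta%:E)%E.
Proof.
move=> N0 th0 eta0.
have [K0 K00 HK] := euler_cvg_in_probability T0 hF hW hmu hsigma hXa hXc hX th0 eta0.
exists K0 => // j jN; rewrite -(grid_refine T N j K00); apply: HK.
  exact: leq_pmull.
by rewrite leq_mul2r jN orbT.
Qed.

Variable q : nat.
Hypothesis q0 : (0 < q)%N.

(** The bound of [euler_refinement_moment] does not depend on [M], so it survives the limit along
    ever finer schemes. *)
Lemma euler_error_moment : exists2 C : R, 0 <= C & forall N j, (0 < N)%N -> (j <= N)%N ->
  mom_le P q (fun w => X (grid N j) w - euler N j w) (C * N%:R ^- q).
Proof.
have [c0 Hc0] := initial_moment q0.
have [C C0 HC] := euler_refinement_moment T0 hF hW hmu hsigma rX0 q0 Hc0.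
exists (2 ^+ (2 * q) * C); first by rewrite mulr_ge0// exprn_ge0.
move=> N j N0 jN; rewrite -mulrA.
apply: mom_le_cvg_in_probability => //.
- by rewrite mulr_ge0// invr_ge0 exprn_ge0.
- by apply: rvB; [exact: rv_solution_grid|exact: rv_euler_grid].
move=> theta eta th0 eta0; have [M M0 HM] := euler_fine_close N0 th0 eta0.
have NM0 : (0 < N * M)%N by rewrite muln_gt0 N0.
have jM : (j * M <= N * M)%N by rewrite leq_mul2r jN orbT.
exists (fun w => euler (N * M) (j * M) w - euler N j w); split.
- by apply: rvB; exact: rv_euler_grid.
- exact: HC.
- apply: le_trans (HM j jN); rewrite le_eqVlt; apply/orP; left; apply/eqP.
  by congr (P _); apply/seteqP; split => w /=; rewrite opprB addrA subrK.
Qed.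

Lemma solution_increment_moment : exists2 C : R, 0 <= C &
  forall N i j, (0 < N)%N -> (i + j <= N)%N ->
  mom_le P q (fun w => X (grid N (i + j)) w - X (grid N i) w) (C * (j%:R / N%:R) ^+ q).
Proof.
have [c0 Hc0] := initial_moment q0.
have [C C0 HC] := euler_increment_moment T0 hF hW hmu hsigma rX0 q0 Hc0.
exists (2 ^+ (2 * q) * C); first by rewrite mulr_ge0// exprn_ge0.
move=> N i j N0 ijN; rewrite -mulrA.
have iN : (i <= N)%N := leq_trans (leq_addr _ _) ijN.
apply: mom_le_cvg_in_probability => //.
- by rewrite mulr_ge0// exprn_ge0.
- by apply: rvB; exact: rv_solution_grid.
move=> theta eta th0 eta0.
(* Both endpoints are approximated, and [PhiD_le] gives [4 * (theta / 8 + theta / 8) = theta]. *)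
have th8 : 0 < theta / 8 by rewrite divr_gt0.
have eta2 : 0 < eta / 2 by rewrite divr_gt0.
have [M M0 HM] := euler_fine_close N0 th8 eta2.
have NM0 : (0 < N * M)%N by rewrite muln_gt0 N0.
have le k : (k <= N)%N -> (k * M <= N * M)%N by move=> kN; rewrite leq_mul2r kN orbT.
have rerr k : (k <= N)%N -> rv measurable (fun w => X (grid N k) w - euler (N * M) (k * M) w).
  by move=> kN; apply: rvB; [exact: rv_solution_grid|apply: rv_euler_grid => //; exact: le].
exists (fun w => euler (N * M) ((i + j) * M) w - euler (N * M) (i * M) w); split.
- by apply: rvB; apply: rv_euler_grid => //; exact: le.
- have := HC (N * M)%N (i * M)%N (j * M)%N NM0; rewrite -mulnDl => /(_ (le _ ijN)).
  by rewrite !natrM -mulf_div divff ?mulr1// pnatr_eq0 -lt0n.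
pose A k := [set w | theta / 8 < Phi 1 (X (grid N k) w - euler (N * M) (k * M) w)].
have mA k : (k <= N)%N -> measurable (A k).
  by move=> kN; apply: measurable_superlevel; apply: rv_measurable_Phi; exact: rerr.
apply: (@le_trans _ _ (P (A (i + j)%N `|` A i))).
  apply: le_measure; rewrite ?inE.
  - apply: measurable_superlevel; apply: rv_measurable_Phi; apply: rvB; apply: rvB;
      by [exact: rv_solution_grid|apply: rv_euler_grid => //; exact: le].
  - by apply: measurableU; exact: mA.
  move=> w /= h; apply: contrapT => /not_orP[]; rewrite /A /=.
  move=> /negP; rewrite -leNgt => h1 /negP; rewrite -leNgt => h2.
  move: h; apply/negP; rewrite -leNgt opprB.
  rewrite [X in Phi 1 X](_ : _ = (X (grid N (i + j)) w - euler (N * M) ((i + j) * M) w) -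
    (X (grid N i) w - euler (N * M) (i * M) w)).
    apply: le_trans (PhiD_le _ _ _) _; rewrite PhiN.
    by rewrite (_ : 2 ^+ (2 * 1) = 4); [lra|rewrite -natrX].
  by apply/matrixP => a b; rewrite !mxE; ring.
apply: le_trans (measureU2 _ (mA _ ijN) (mA _ iN)) _.
by rewrite [eta]splitr EFinD; apply: leeD; exact: HM.
Qed.

End solution_moments.

(** * Chaining *)

Section dyadic_chaining.
Context {R : realType}.
Variables (f : R -> R) (A rho : R).
Hypotheses (A0 : 0 <= A) (rho0 : 0 < rho) (rho1 : rho < 1).
Hypothesis f_continuous : forall p, 0 <= p <= 1 -> forall e, 0 < e ->
  exists2 r, 0 < r & forall t, 0 <= t <= 1 -> `|p - t| < r -> `|f p - f t| < e.
Hypothesis f_dyadic : forall n k, (k < 2 ^ n)%N ->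
  `|f (k.+1%:R / 2 ^+ n) - f (k%:R / 2 ^+ n)| <= A * rho ^+ n.

Let idx n (x : R) := Num.truncn (x * 2 ^+ n).
Let dy n (x : R) : R := (idx n x)%:R / 2 ^+ n.

Let pow2_gt0 n : 0 < 2 ^+ n :> R. Proof. exact: exprn_gt0. Qed.

Let idx_itv n x : 0 <= x -> (idx n x)%:R <= x * 2 ^+ n < (idx n x).+1%:R.
Proof. by move=> x0; apply: truncn_itv; rewrite mulr_ge0// ltW. Qed.

Let dy_itv n x : 0 <= x -> 0 <= x - dy n x < (2 ^+ n)^-1.
Proof.
move=> x0; have /andP[h1 h2] := idx_itv n x0; rewrite /dy subr_ge0 ler_pdivrMr// h1/=.
by rewrite ltrBlDl -[X in _ + X]mul1r -mulrDl natr1 ltr_pdivlMr.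
Qed.

Let dy_le1 n x : 0 <= x <= 1 -> 0 <= dy n x <= 1.
Proof.
move=> /andP[x0 x1]; rewrite /dy divr_ge0 ?(ltW (pow2_gt0 n))//=.
have /andP[] := dy_itv n x0; rewrite subr_ge0 => h _; exact: le_trans h x1.
Qed.

(** Passing to the next level, the dyadic point just below [x] either stays or moves right by one
    cell of that level. *)
Let dy_step n x : 0 <= x <= 1 -> `|f (dy n.+1 x) - f (dy n x)| <= A * rho ^+ n.+1.
Proof.
move=> /andP[x0 x1].
have /andP[h1 h2] := idx_itv n x0; have /andP[h3 h4] := idx_itv n.+1 x0.
have E : dy n x = (idx n x).*2%:R / 2 ^+ n.+1.
  by rewrite /dy exprS -muln2 natrM; field; rewrite gt_eqF.
rewrite E /dy; move: (idx n.+1 x) (idx n x) h1 h2 h3 h4 => k' k h1 h2 h3 h4.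
rewrite exprS in h3 h4.
have lo : (k.*2 <= k')%N.
  by rewrite -ltnS -(ltr_nat R) -muln2 natrM; move: h1 h4; move: (2 ^+ n) => c; lra.
have hi : (k' <= k.*2.+1)%N.
  rewrite -ltnS -(ltr_nat R) -doubleS -muln2 natrM; move: h2 h3; move: (2 ^+ n) => c; lra.
have [->|ne] := eqVneq k' k.*2; first by rewrite subrr normr0 mulr_ge0// exprn_ge0// ltW.
have -> : k' = k.*2.+1.
  by apply/eqP; rewrite eqn_leq hi ltn_neqAle eq_sym ne.
apply: f_dyadic.
have : k.*2.+1%:R <= 2 ^+ n.+1 :> R.
  apply: (@le_trans _ _ k'%:R); first by rewrite ler_nat ltn_neqAle eq_sym ne.
  by apply: le_trans h3 _; rewrite -exprS ger_pMl.
by rewrite -natrX ler_nat.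
Qed.

(** The geometric sum of the [dy_step] bounds, multiplied by [1 - rho] to stay free of quotients. *)
Let dy_chain n j x : 0 <= x <= 1 ->
  (1 - rho) * `|f (dy (n + j) x) - f (dy n x)| <= A * (rho ^+ n - rho ^+ (n + j)).
Proof.
move=> x01; elim: j => [|j IH]; first by rewrite addn0 !subrr normr0 !mulr0.
rewrite addnS.
have -> : f (dy (n + j).+1 x) - f (dy n x) =
    (f (dy (n + j).+1 x) - f (dy (n + j) x)) + (f (dy (n + j) x) - f (dy n x)) by ring.
have h := dy_step (n + j) x01; have r0 : 0 < 1 - rho by rewrite subr_gt0.
apply: (@le_trans _ _ ((1 - rho) * (A * rho ^+ (n + j).+1) + A * (rho ^+ n - rho ^+ (n + j)))).
  apply: le_trans (ler_wpM2l (ltW r0) (ler_normD _ _)) _.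
  by rewrite mulrDr; apply: lerD => //; rewrite ler_wpM2l// ltW.
rewrite exprS; have : 0 <= A * rho ^+ (n + j) by rewrite mulr_ge0// exprn_ge0// ltW.
move: (rho ^+ (n + j)) (rho ^+ n) => c c' Ac.
rewrite -subr_ge0.
have -> : A * (c' - rho * c) - ((1 - rho) * (A * (rho * c)) + A * (c' - c)) = (1 - rho) ^+ 2 * (A * c) by ring.
by apply: mulr_ge0 => //; exact: sqr_ge0.
Qed.

Let dy_lim n x : 0 <= x <= 1 -> `|f x - f (dy n x)| <= A * rho ^+ n / (1 - rho).
Proof.
move=> x01; have r0 : 0 < 1 - rho by rewrite subr_gt0.
apply/ler_addgt0Pr => e e0.
have [r rpos fr] := f_continuous x01 e0.
have [j _ /(_ j (leqnn j)) /= jr] := near_infty_natSinv_expn_lt (PosNum rpos).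
rewrite div1r in jr.
have /andP[x0 x1] := x01.
have h1 : `|f x - f (dy (n + j) x)| < e.
  apply: fr; first exact: dy_le1.
  have /andP[d0 d1] := dy_itv (n + j) x0; rewrite ger0_norm//.
  apply: lt_trans d1 _; apply: le_lt_trans jr.
  by rewrite lef_pV2 ?posrE// ler_eXn2l ?ltr1n// leq_addl.
have h2 := dy_chain n j x01.
rewrite -(subrKA (f (dy (n + j) x))); apply: le_trans (ler_normD _ _) _.
rewrite addrC; apply: lerD; last exact: ltW.
rewrite ler_pdivlMr// mulrC; apply: le_trans h2 _.
by rewrite ler_wpM2l// gerBl exprn_ge0// ltW.
Qed.

(** At level [n] the dyadic points below [x] and [y] coincide or are neighbours, which costs 1 in
    the constant; each of the two tails of [dy_lim] costs [1 / (1 - rho)]. *)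
Lemma dyadic_chaining n x y : 0 <= x <= 1 -> 0 <= y <= 1 -> `|x - y| <= (2 ^+ n)^-1 ->
  `|f x - f y| <= (1 + 2 / (1 - rho)) * (A * rho ^+ n).
Proof.
wlog xy : x y / x <= y => [H|] x01 y01 d.
  have [xy|/ltW yx] := leP x y; first exact: H.
  by rewrite distrC; apply: H => //; rewrite distrC.
have /andP[x0 x1] := x01; have /andP[y0 y1] := y01.
have adj : `|f (dy n x) - f (dy n y)| <= A * rho ^+ n.
  have /andP[h1 h2] := idx_itv n x0; have /andP[h3 h4] := idx_itv n y0.
  rewrite distrC ger0_norm ?subr_ge0// in d.
  have d' : y * 2 ^+ n <= x * 2 ^+ n + 1.
    by rewrite -lerBlDl -mulrBl -ler_pdivlMr// div1r.
  have xy' : x * 2 ^+ n <= y * 2 ^+ n by rewrite ler_pM2r.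
  have y2 : y * 2 ^+ n <= 2 ^+ n by rewrite ger_pMl.
  rewrite /dy; move: (idx n x) (idx n y) h1 h2 h3 h4 => k k' h1 h2 h3 h4.
  have lo : (k <= k')%N by rewrite -ltnS -(ltr_nat R); lra.
  have hi : (k' <= k.+1)%N by rewrite -ltnS -(ltr_nat R) -[k.+2%:R]natr1; lra.
  have [->|ne] := eqVneq k' k; first by rewrite subrr normr0 mulr_ge0// exprn_ge0// ltW.
  have E : k' = k.+1 by apply/eqP; rewrite eqn_leq hi ltn_neqAle eq_sym ne.
  rewrite E distrC; apply: f_dyadic; rewrite -E -(ler_nat R) natrX.
  exact: le_trans h3 y2.
have -> : f x - f y = (f x - f (dy n x)) + ((f (dy n x) - f (dy n y)) + (f (dy n y) - f y)).
  by ring.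
apply: le_trans (ler_normD _ _) _; rewrite addrC.
apply: le_trans (lerD (ler_normD _ _) (lexx _)) _.
have := dy_lim n x01; have := dy_lim n y01; rewrite distrC.
rewrite mulrDl mul1r [2 / _ * _]mulrC mulrA [_ * 2]mulrC -mulrA; lra.
Qed.

End dyadic_chaining.

(** * From chaining in one cell to the Hoelder bound of a whole path *)

Section path_bound.
Context {R : realType}.
Variables (T alpha b : R).
Hypotheses (T0 : 0 < T) (alpha0 : 0 <= alpha) (alphab : alpha <= b) (b0 : 0 < b) (b1 : b <= 1).

Local Notation grid := (grid T).
Let rho : R := 2^-1 `^ b.

Let one_powR (r : R) : 1 `^ r = 1. Proof. by rewrite powR1. Qed.

Let rho_gt0 : 0 < rho. Proof. by rewrite powR_gt0. Qed.

Let rho_lt1 : rho < 1.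
Proof.
by rewrite -[ltRHS](one_powR b); apply: gt0_ltr_powR; rewrite ?nnegrE//; lra.
Qed.

(** [rho ^+ n] is [2 ^ (- n b)], at most [(2 u) ^ b]; then [2 ^ b <= 2], and [u ^ b <= u ^ alpha]
    because [u <= 1]. *)
Let rhoX_le n u : 0 <= u <= 1 -> (2 ^+ n.+1)^-1 <= u -> rho ^+ n <= 2 * u `^ alpha.
Proof.
move=> /andP[u0 u1] nu.
have n0 : 0 < (2 ^+ n)^-1 :> R by rewrite invr_gt0 exprn_gt0.
have -> : rho ^+ n = ((2 ^+ n)^-1) `^ b.
  by rewrite /rho -powR_mulrn ?powR_ge0// -powRrM mulrC powRrM powR_mulrn ?exprVn.
apply: (@le_trans _ _ ((2 * u) `^ b)).
  apply: ge0_ler_powR; rewrite ?nnegrE ?(ltW b0) ?(ltW n0)//; first by rewrite mulr_ge0.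
  by move: nu; rewrite exprS invfM mulrC ler_pdivrMr// mulrC.
rewrite powRM//; apply: ler_pM; rewrite ?powR_ge0//.
  by rewrite -[leRHS]powRr1//; apply: ler_powR => //; rewrite ler1n.
apply: ger_powR => //; rewrite u1 andbT; apply: lt_le_trans nu.
by rewrite invr_gt0 exprn_gt0.
Qed.

Let C := 1 + 2 / (1 - rho).

Let C_ge1 : 1 <= C.
Proof.
by rewrite /C lerDl; apply: divr_ge0 => //; rewrite subr_ge0; exact: ltW rho_lt1.
Qed.


Section path.
Variables (N : nat) (A : R) (x y : R -> R).
Hypotheses (N0 : (0 < N)%N) (A0 : 0 <= A).
Hypothesis xc : {within `[0, T], continuous x}.
Hypothesis x_dyadic : forall n k, (k < N * 2 ^ n)%N ->
  `|x (grid (N * 2 ^ n) k.+1) - x (grid (N * 2 ^ n) k)| <= A * rho ^+ n.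
Hypothesis y_linear : forall i t, (i < N)%N -> grid N i <= t <= grid N i.+1 ->
  y t = y (grid N i) + (t * N%:R / T - i%:R) * (y (grid N i.+1) - y (grid N i)).
Hypothesis y_step : forall i, (i < N)%N -> `|y (grid N i.+1) - y (grid N i)| <= A.
Hypothesis z_node : forall i, (i <= N)%N -> `|x (grid N i) - y (grid N i)| <= A.

Let NR : 0 < N%:R :> R. Proof. by rewrite ltr0n. Qed.
(** Time measured in coarse cells. Undoing this scaling produces the factor [N ^ alpha] of the final
    estimate. *)
Let scale (h : R) := `|h| * (N%:R / T).

Let x_cell i s t : (i < N)%N -> grid N i <= s <= grid N i.+1 ->
  grid N i <= t <= grid N i.+1 -> `|x s - x t| <= 2 * C * A * scale (s - t) `^ alpha.
Proof.
move=> iN si ti.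
pose f u := x (grid N i + u * (T / N%:R)).
pose c r := (r - grid N i) / (T / N%:R).
have TN : 0 < T / N%:R by rewrite divr_gt0.
have cK r : grid N i + c r * (T / N%:R) = r by rewrite /c divfK ?gt_eqF// addrC subrK.
have c01 r : grid N i <= r <= grid N i.+1 -> 0 <= c r <= 1.
  move=> /andP[r1 r2]; rewrite /c divr_ge0 ?subr_ge0 ?(ltW TN)//=.
  by rewrite ler_pdivrMr// mul1r lerBlDl -gridS.
have f01 u : 0 <= u <= 1 -> 0 <= grid N i + u * (T / N%:R) <= T.
  move=> /andP[u0 u1]; apply/andP; split.
    by apply: addr_ge0; [exact: grid_ge0|apply: mulr_ge0 => //; exact: ltW].
  apply: le_trans (grid_leT T0 N0 iN); rewrite gridS lerD2l ger_pMl//.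
have fc p : 0 <= p <= 1 -> forall e, 0 < e ->
    exists2 r, 0 < r & forall t, 0 <= t <= 1 -> `|p - t| < r -> `|f p - f t| < e.
  move=> p01 e e0; have [r r0 rP] := within_continuousP xc (f01 p p01) e0.
  exists (r / (T / N%:R)); first by rewrite divr_gt0.
  move=> u u01 pu; apply: rP; first exact: f01.
  by rewrite opprD addrACA subrr add0r -mulrBl normrM (gtr0_norm TN) -ltr_pdivlMr.
have fd n k : (k < 2 ^ n)%N -> `|f (k.+1%:R / 2 ^+ n) - f (k%:R / 2 ^+ n)| <= A * rho ^+ n.
  move=> kn.
  have gE l : grid N i + l%:R / 2 ^+ n * (T / N%:R) = grid (N * 2 ^ n) (i * 2 ^ n + l).
    rewrite gridD grid_refine ?expn_gt0// natrM natrX; congr (_ + _).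
    by field; rewrite !gt_eqF// exprn_gt0.
  rewrite /f !gE addnS; apply: x_dyadic.
  apply: (@leq_trans (i * 2 ^ n + 2 ^ n)); first by rewrite ltn_add2l.
  by rewrite -mulSnr leq_mul2r iN orbT.
have scE : scale (s - t) = `|c s - c t|.
  rewrite /c -mulrBl opprB addrA subrK normrM /scale [`|(T / N%:R)^-1|]gtr0_norm ?invr_gt0//.
  by rewrite invf_div.
have sc1 : scale (s - t) <= 1.
  rewrite scE; have /andP[c1 c2] := c01 _ si; have /andP[c3 c4] := c01 _ ti.
  by rewrite ler_norml; apply/andP; split; lra.
(* Equal times are set apart: the dyadic level chosen below exists only for a positive distance. *)
have [st|st] := eqVneq (scale (s - t)) 0.
  have : s = t.
    apply/eqP; rewrite -subr_eq0 -normr_eq0; move/eqP: st; rewrite /scale mulf_eq0.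
    by rewrite (gt_eqF (divr_gt0 NR T0)) orbF.
  by move=> ->; rewrite subrr normr0 !mulr_ge0// ?powR_ge0// (le_trans ler01 C_ge1).
have sc0 : 0 < scale (s - t) by rewrite lt_neqAle eq_sym st mulr_ge0// ltW// divr_gt0.
have [n nle nlt] : exists2 n, scale (s - t) <= (2 ^+ n)^-1 &
    (2 ^+ n.+1)^-1 < scale (s - t).
  have ex : exists n, (2 ^+ n)^-1 < scale (s - t).
    have [j _ /(_ j (leqnn j)) /= jr] := near_infty_natSinv_expn_lt (PosNum sc0).
    by exists j; rewrite div1r in jr.
  case: (ex_minnP ex) => -[|n] nP nmin.
    by move: nP; rewrite expr0 invr1 ltNge sc1.
  exists n => //; rewrite leNgt; apply/negP => /nmin; by rewrite ltnn.
have -> : x s = f (c s) by rewrite /f cK.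
have -> : x t = f (c t) by rewrite /f cK.
have := dyadic_chaining A0 rho_gt0 rho_lt1 fc fd (c01 _ si) (c01 _ ti).
rewrite -scE => /(_ n nle) /le_trans; apply.
rewrite -/C -!mulrA [2 * _]mulrCA; apply: ler_wpM2l; first exact: le_trans C_ge1.
rewrite mulrCA; apply: ler_wpM2l => //; apply: rhoX_le; last exact: ltW.
by rewrite sc1 ltW.
Qed.

Let scale_powR (u : R) : 0 <= u <= 1 -> u <= u `^ alpha.
Proof.
move=> /andP[u0 u1]; have [->|une] := eqVneq u 0; first exact: powR_ge0.
by apply: ger1_powR; [rewrite u1 lt_neqAle eq_sym une u0|exact: le_trans b1].
Qed.

Let y_cell i s t : (i < N)%N -> grid N i <= s <= grid N i.+1 ->
  grid N i <= t <= grid N i.+1 -> `|y s - y t| <= A * scale (s - t) `^ alpha.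
Proof.
move=> iN si ti; rewrite (y_linear iN si) (y_linear iN ti).
set D := _ - y (grid N i).
have -> : y (grid N i) + (s * N%:R / T - i%:R) * D - (y (grid N i) + (t * N%:R / T - i%:R) * D)
  = (s - t) * (N%:R / T) * D by ring.
rewrite normrM mulrC; apply: ler_pM => //; first exact: y_step.
rewrite normrM (gtr0_norm (divr_gt0 NR T0)); apply: scale_powR.
rewrite mulr_ge0//=; last by rewrite ltW// divr_gt0.
rewrite -ler_pdivlMr ?divr_gt0// div1r invf_div.
have E := gridS T N i; rewrite ler_norml; move: si ti => /andP[h1 h2] /andP[h3 h4].
by apply/andP; split; lra.
Qed.

Let z t := x t - y t.

Let z_cell i s t : (i < N)%N -> grid N i <= s <= grid N i.+1 ->
  grid N i <= t <= grid N i.+1 -> `|z s - z t| <= (2 * C + 1) * A * scale (s - t) `^ alpha.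
Proof.
move=> iN si ti; rewrite /z.
have -> : x s - y s - (x t - y t) = (x s - x t) - (y s - y t) by ring.
apply: le_trans (ler_normB _ _) _; 
have -> : (2 * C + 1) * A * scale (s - t) `^ alpha =
  2 * C * A * scale (s - t) `^ alpha + A * scale (s - t) `^ alpha by ring.
apply: lerD.
  exact: x_cell iN si ti.
exact: y_cell iN si ti.
Qed.

Let cell t : 0 <= t <= T -> exists2 i, (i < N)%N & grid N i <= t <= grid N i.+1.
Proof.
move=> /andP[t0 tT]; have [t00|tn0] := eqVneq t 0.
  by exists 0%N => //; rewrite t00 grid0 lexx grid_ge0.
have tp : 0 < t by rewrite lt_neqAle eq_sym tn0.
have tN : t <= grid N N by rewrite gridK.
by have [l lN /andP[/ltW h1 h2]] := grid_cell tp tN; exists l => //; rewrite h1.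
Qed.

Lemma path_sup_le t : 0 <= t <= T -> `|x t - y t| <= (2 * C + 2) * A.
Proof.
move=> tT; have [i iN ti] := cell tT.
have gi : grid N i <= grid N i <= grid N i.+1 by rewrite lexx grid_le.
have h := z_cell iN ti gi.
have s1 : scale (t - grid N i) `^ alpha <= 1.
  rewrite -[leRHS](one_powR alpha); apply: ge0_ler_powR; rewrite ?nnegrE//.
    by rewrite mulr_ge0// ltW// divr_gt0.
  rewrite /scale -ler_pdivlMr ?divr_gt0// div1r invf_div.
  move: ti => /andP[h1 h2]; rewrite ger0_norm ?subr_ge0//.
  by rewrite lerBlDl -gridS.
have := z_node (ltnW iN); rewrite -/(z (grid N i)) => h2.
rewrite -/(z t) -(subrK (z (grid N i)) (z t)); apply: le_trans (ler_normD _ _) _.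
have -> : (2 * C + 2) * A = (2 * C + 1) * A + A by ring.
apply: lerD => //; apply: le_trans h _; rewrite ler_piMr// mulr_ge0//.
by rewrite addr_ge0// mulr_ge0// (le_trans ler01 C_ge1).
Qed.

(** At distance of at least one cell twice the sup bound suffices. Closer times share a cell or lie
    in neighbouring ones, where the common node [m] is inserted. *)
Lemma path_holder_le s t : 0 <= s <= T -> 0 <= t <= T ->
  `|(x s - y s) - (x t - y t)| <= (4 * C + 4) * A * (`|s - t| * (N%:R / T)) `^ alpha.
Proof.
wlog st : s t / s <= t => [H|] sT tT.
  have [st|/ltW ts] := leP s t; first exact: H.
  by rewrite distrC [`|s - t|]distrC; apply: H.
have C0 : 0 <= C := le_trans ler01 C_ge1.
rewrite -/(scale (s - t)) -/(z s) -/(z t).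
have NT0 : 0 < N%:R / T by rewrite divr_gt0.
have [u1|u1] := leP 1 (scale (s - t)).
  apply: le_trans (ler_normB _ _) _.
  apply: le_trans (lerD (path_sup_le sT) (path_sup_le tT)) _.
  rewrite -mulrDl (_ : 2 * C + 2 + _ = 4 * C + 4); last by ring.
  rewrite ler_peMr ?mulr_ge0 ?addr_ge0 ?mulr_ge0//.
  by rewrite -[leLHS](one_powR alpha); apply: ge0_ler_powR; rewrite ?nnegrE// ?(le_trans ler01 u1).
have [i iN si] := cell sT; have /andP[s1 s2] := si.
have [t1|t1] := leP t (grid N i.+1).
  have ti : grid N i <= t <= grid N i.+1 by rewrite t1 (le_trans s1 st).
  apply: le_trans (z_cell iN si ti) _; apply: ler_wpM2r; first exact: powR_ge0.
  by apply: ler_wpM2r => //; lra.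
set m := grid N i.+1 in s2 t1 *.
have iN1 : (i.+1 < N)%N.
  rewrite ltn_neqAle iN andbT; apply/negP => /eqP iE.
  by move: t1; rewrite /m iE gridK// ltNge; case/andP: tT => _ ->.
have mi : grid N i <= m <= grid N i.+1 by rewrite lexx andbT; exact: grid_le.
have mi1 : grid N i.+1 <= m <= grid N i.+2 by rewrite lexx; exact: grid_le.
have dst : t - s < T / N%:R.
  move: u1; rewrite /scale -ltr_pdivlMr// div1r invf_div.
  by rewrite distrC ger0_norm ?subr_ge0.
have ti1 : grid N i.+1 <= t <= grid N i.+2.
  by rewrite (ltW t1) gridS -/m; lra.
have E : z s - z t = (z s - z m) + (z m - z t) by ring.
rewrite E; apply: le_trans (ler_normD _ _) _.
have mono h : `|h| <= `|s - t| -> scale h `^ alpha <= scale (s - t) `^ alpha.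
  move=> hst; apply: ge0_ler_powR => //; rewrite ?nnegrE /scale.
  - by apply: mulr_ge0 => //; exact: ltW.
  - by apply: mulr_ge0 => //; exact: ltW.
  - by apply: ler_wpM2r => //; exact: ltW.
have h1 := z_cell iN si mi; have h2 := z_cell iN1 mi1 ti1.
have B0 : 0 <= (2 * C + 1) * A by rewrite mulr_ge0// addr_ge0// mulr_ge0.
have h3 : scale (s - m) `^ alpha <= scale (s - t) `^ alpha.
  apply: mono; rewrite !ler0_norm ?subr_le0//; move: t1; lra.
have h4 : scale (m - t) `^ alpha <= scale (s - t) `^ alpha.
  apply: mono; rewrite !ler0_norm ?subr_le0 ?(ltW t1)//; move: s2; lra.
apply: (@le_trans _ _ (2 * ((2 * C + 1) * A) * scale (s - t) `^ alpha)).
  rewrite -mulrA mulrDl mul1r; apply: lerD.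
    by apply: le_trans h1 _; apply: ler_wpM2l.
  by apply: le_trans h2 _; apply: ler_wpM2l.
apply: ler_wpM2r; first exact: powR_ge0.
by rewrite mulrA; apply: ler_wpM2r => //; lra.
Qed.

End path.
End path_bound.

(** The weights [1 / 2 ^ n.+1] sum to one. The added 1 fits the inequality that later replaces
    Jensen's. *)
Lemma ebound_series disp (Omega : measurableType disp) (R : realType)
    (P : probability Omega R) (V : nat -> Omega -> R) (D : R) :
  0 <= D -> (forall n, ebound P (V n) (D / (2 ^ n.+1)%:R)) ->
  (\int[P]_w (1%:E + \sum_(0 <= n <oo) (V n w)%:E) <= (1 + D)%:E)%E.
Proof.
move=> D0 HV.
have V0 n w : (0 <= (V n w)%:E)%E by have [_ + _] := HV n; rewrite lee_fin; apply.
have mV n : measurable_fun setT (fun w => (V n w)%:E).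
  by have [mV _ _] := HV n; exact/measurable_EFinP.
rewrite ge0_integralD//; last 2 first.
- by move=> w _; apply: nneseries_ge0.
- exact: ge0_emeasurable_sum.
rewrite integral_cst//= probability_setT mule1 EFinD; apply: leeD => //.
rewrite integral_nneseries//; apply: le_trans (epsilon_trick0 xpredT D0).
apply: lee_nneseries => [n _ _|n _]; first exact: integral_ge0.
by have [] := HV n.
Qed.

Lemma term_le_series (R : realType) (V : nat -> R) (n : nat) :
  (forall k, 0 <= V k) -> ((V n)%:E <= \sum_(0 <= k <oo) (V k)%:E)%E.
Proof.
move=> V0; apply: le_trans (nneseries_lim_ge n.+1 _); last first.
  by move=> k _ _; rewrite lee_fin.
rewrite big_nat_recr//= leeDr// sume_ge0// => k _; by rewrite lee_fin.
Qed.

Lemma enorm_le_coord (R : realType) (d : nat) (v : 'cV[R]_d) (M : R) :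
  0 <= M -> (forall i, `|v i 0| <= M) -> enorm v <= d.+1%:R * M.
Proof.
move=> M0 vM; have dM : 0 <= d.+1%:R * M by rewrite mulr_ge0.
rewrite -(@ler_pXn2r _ 2) ?nnegrE ?enorm_ge0// enorm_sqr.
apply: (@le_trans _ _ (\sum_(i < d) M ^+ 2)).
  rewrite /Phi; apply: ler_sum => i _; rewrite big_ord1 muln1 -real_normK ?num_real//.
  by rewrite lerXn2r ?nnegrE.
rewrite sumr_const card_ord -[leLHS]mulr_natl [leRHS]exprMn; apply: ler_wpM2r; first exact: sqr_ge0.
by rewrite -natrX ler_nat -mulnn mulSn; apply: leq_trans (leq_addr _ _); rewrite leqnSn.
Qed.

Lemma holder_norm_le (R : realType) (d : nat) (T r : R) (f : R -> 'cV[R]_d) (M K : R) :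
  0 <= T -> 0 <= M -> 0 <= K ->
  (forall t i, 0 <= t <= T -> `|f t i 0| <= M) ->
  (forall s t i, 0 <= s <= T -> 0 <= t <= T -> `|f s i 0 - f t i 0| <= K * `|s - t| `^ r) ->
  (holder_norm T r f <= (d.+1%:R * (M + K))%:E)%E.
Proof.
move=> T0 M0 K0 fM fK; rewrite /holder_norm mulrDr EFinD; apply: leeD.
  apply: ge_ereal_sup => _ [t tT <-]; rewrite lee_fin.
  by apply: enorm_le_coord => // i; apply: fM; move: tT; rewrite /= in_itv.
apply: ge_ereal_sup => _ [[t s] [/= sT tT st] <-]; rewrite lee_fin.
rewrite !in_itv/= in sT tT.
have h0 : 0 < `|s - t| `^ r by rewrite powR_gt0// normr_gt0 subr_eq0 eq_sym.
rewrite ler_pdivrMr// -mulrA; apply: enorm_le_coord; first by rewrite mulr_ge0// ltW.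
by move=> i; rewrite !mxE; exact: fK.
Qed.

Lemma holder_norm_ge0 (R : realType) (d : nat) (T r : R) (f : R -> 'cV[R]_d) :
  0 < T -> (0 <= holder_norm T r f)%E.
Proof.
move=> T0; have e0 : 0 \in `[0, T] by rewrite in_itv/= lexx ltW.
have eT : T \in `[0, T] by rewrite in_itv/= lexx ltW.
apply: adde_ge0.
  apply: (@le_trans _ _ (enorm (f 0))%:E); first by rewrite lee_fin enorm_ge0.
  by apply: ereal_sup_ubound; exists 0.
apply: (@le_trans _ _ (enorm (f T - f 0) / `|T - 0| `^ r)%:E).
  by rewrite lee_fin divr_ge0 ?enorm_ge0 ?powR_ge0.
by apply: ereal_sup_ubound; exists (0, T) => //=; split=> //; rewrite lt_eqF.
Qed.

Lemma coord_le_root (R : realType) (q d : nat) (v : 'cV[R]_d) (M : R) i :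
  (0 < q)%N -> 0 <= M -> Phi q v <= M ^+ (2 * q) -> `|v i 0| <= M.
Proof.
move=> q0 M0 vM; have q20 : (0 < 2 * q)%N by rewrite muln_gt0.
rewrite -(ler_pXn2r q20) ?nnegrE//; apply: le_trans vM.
rewrite -normrX ger0_norm ?even_pow_ge0// /Phi (bigD1 i)//= big_ord1 lerDl.
by apply: sumr_ge0 => j _; apply: sumr_ge0 => k _; exact: even_pow_ge0.
Qed.

(** * The Hoelder norm of the error *)

Section holder_error.
Context {disp : measure_display} {Omega : measurableType disp} {R : realType}.
Variables (P : probability Omega R) (T : R) (F : R -> set (set Omega)).
Variables (d m : nat) (W : R -> Omega -> 'cV[R]_m).
Hypotheses (T0 : 0 < T) (hF : is_filtration T F).
Hypothesis hW : standard_brownian_motion P T F W.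
Variables (mu : 'cV[R]_d -> 'cV[R]_d) (sigma : 'cV[R]_d -> 'M[R]_(d, m)).
Hypotheses (hmu : globally_lipschitz mu) (hsigma : globally_lipschitz sigma).
Variable X : R -> Omega -> 'cV[R]_d.
Hypotheses (hXa : adapted T F X) (hXc : continuous_paths T X).
Hypothesis hX : solves_sde P T F W mu sigma X.
Hypothesis hX0 : forall p : R, 1 <= p ->
  (\int[P]_w (enorm (X 0 w) `^ p)%:E < +oo)%E.
Variable Y : nat -> R -> Omega -> 'cV[R]_d.
Hypothesis hY0 : forall N : nat, (0 < N)%N -> forall w, Y N 0 w = X 0 w.

Local Notation grid := (grid T).
Local Notation dW := (dW T W).
Local Notation euler := (euler T W mu sigma (X 0)).

Hypothesis hY : forall N n : nat, (0 < N)%N -> (n < N)%N ->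
  forall t : R, grid N n <= t -> t <= grid N n.+1 -> forall w,
    Y N t w = Y N (grid N n) w + (t - grid N n) *: mu (Y N (grid N n) w) +
      (t * N%:R / T - n%:R) *: (sigma (Y N (grid N n) w) *m dW N n w).

Lemma interpolation_node N i w : (0 < N)%N -> (i <= N)%N -> Y N (grid N i) w = euler N i w.
Proof.
move=> N0; elim: i => [|i IH] iN; first by rewrite grid0 hY0.
rewrite (hY N0 iN (grid_le T0 N (leqnSn i)) (lexx _)) (IH (ltnW iN)) /=.
have -> : grid N i.+1 - grid N i = T / N%:R by rewrite gridS addrAC subrr add0r.
have -> : grid N i.+1 * N%:R / T - i%:R = 1.
  rewrite /grid -natr1; field.
  by rewrite (gt_eqF T0) pnatr_eq0 -lt0n N0.
by rewrite scale1r.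
Qed.

(** Drift and noise are multiplied by the same fraction of the cell, so each coordinate is affine
    between the values at the two nodes. *)
Lemma interpolation_linear N i t w c : (0 < N)%N -> (i < N)%N ->
  grid N i <= t <= grid N i.+1 ->
  Y N t w c 0 = Y N (grid N i) w c 0 +
    (t * N%:R / T - i%:R) * (Y N (grid N i.+1) w c 0 - Y N (grid N i) w c 0).
Proof.
move=> N0 iN /andP[t1 t2]; rewrite (hY N0 iN t1 t2).
have -> : Y N (grid N i.+1) w = euler N i.+1 w by exact: interpolation_node.
rewrite (interpolation_node w N0 (ltnW iN)) /= !mxE.
have -> : t - grid N i = (t * N%:R / T - i%:R) * (T / N%:R).
  by rewrite /grid; field; rewrite (gt_eqF T0) pnatr_eq0 -lt0n N0.
ring.
Qed.

Section exponents.
Variable q : nat.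
Hypothesis q3 : (2 < q)%N.
Let q0 : (0 < q)%N := ltn_trans (isT : (0 < 2)%N) q3.

(** Sums of powers stand in for maxima over nodes and cells, because their expectations can be
    computed termwise. The second sum controls the slopes of the interpolation. *)
Definition node_terms N w : R :=
  \sum_(i < N.+1) Phi q (X (grid N i) w - euler N i w) +
  \sum_(i < N) Phi q (euler N i.+1 w - euler N i w).

Definition dyadic_terms N n w : R :=
  (2 ^+ (q - 2)) ^+ n * \sum_(k < N * 2 ^ n)
    Phi q (X (grid (N * 2 ^ n) k.+1) w - X (grid (N * 2 ^ n) k) w).

(* [(2 ^+ (q - 2)) ^+ n] is [2 ^ (2 q n b)] for the chaining exponent
   [b = 1/2 - 1/q]; the power of [N] makes the expectation of [level N n] of
   order [2 ^ -n] uniformly in [N]. *)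
Definition level N n w : R := N%:R ^+ q.-1 *
  (if n is l.+1 then dyadic_terms N l w else node_terms N w).

Lemma level_ge0 N n w : 0 <= level N n w.
Proof.
apply: mulr_ge0; first exact: exprn_ge0.
case: n => [|n]; first by apply: addr_ge0; apply: sumr_ge0 => i _; exact: Phi_ge0.
by apply: mulr_ge0; [exact/exprn_ge0/exprn_ge0|apply: sumr_ge0 => i _; exact: Phi_ge0].
Qed.

(** At level 0, of order [N] terms of size [N ^ (- q)] meet the weight [N ^ (q - 1)]. At dyadic
    level [n], with [K = N 2^n] cells, [N ^ (q - 1) * 2 ^ (n (q - 2)) * K ^ (1 - q) = 2 ^ (- n)]. *)
Lemma level_moment : exists2 D : R, 0 <= D & forall N n, (0 < N)%N ->
  ebound P (level N n) (D / (2 ^ n.+1)%:R).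
Proof.
have sum_cst (k : nat) (c : R) : \sum_(i < k) c = k%:R * c by rewrite sumr_const card_ord mulr_natl.
have [c0 Hc0] := initial_moment hX0 q0.
have rX := rv_initial T0 hF hXa.
have [C1 C10 H1] := euler_error_moment T0 hF hW hmu hsigma hXa hXc hX hX0 q0.
have [C2 C20 H2] := euler_increment_moment T0 hF hW hmu hsigma rX q0 Hc0.
have [C3 C30 H3] := solution_increment_moment T0 hF hW hmu hsigma hXa hXc hX hX0 q0.
(* Level 0 needs [2 * C1 + C2 <= D / 2]. Dyadic level [n] is term [n.+1] of the series and needs
   [C3 / 2 ^ n <= D / 2 ^ n.+2]. *)
exists (4 * (C1 + C2 + C3)); first by rewrite mulr_ge0// !addr_ge0.
move=> N n N0; have NR : 0 < N%:R :> R by rewrite ltr0n.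
have rXg K j : (0 < K)%N -> (j <= K)%N -> rv measurable (X (grid K j)).
  by move=> K0 jK; exact: (rv_solution_grid T0 hF hXa).
have rEg K j : (0 < K)%N -> (j <= K)%N -> rv measurable (euler K j).
  by move=> K0 jK; exact: (rv_euler_grid T0 hF hW hmu hsigma hXa).
case: n => [|n].
  apply: (@ebound_le _ _ _ P _ (N%:R ^+ q.-1 *
     (\sum_(i < N.+1) C1 * N%:R ^- q + \sum_(i < N) C2 * (1%:R / N%:R) ^+ q))); last first.
    apply: eboundZ; first exact: exprn_ge0.
    apply: eboundD; apply: ebound_sum => i; apply: ebound_Phi.
    - have iN : (i <= N)%N by rewrite -ltnS.
      by apply: rvB; [exact: rXg|exact: rEg].
    - by apply: H1 => //; rewrite -ltnS.
    - by apply: rvB; apply: rEg => //; exact: ltnW.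
    - have := H2 N i 1%N N0; rewrite addn1; apply; exact: ltn_ord.
  rewrite !sum_cst div1r exprVn.
  have -> : N%:R ^- q = N%:R ^- q.-1 / N%:R :> R.
    by rewrite -{1}(prednK q0) exprSr invfM mulrC.
  have -> : N%:R ^+ q.-1 * (N.+1%:R * (C1 * (N%:R ^- q.-1 / N%:R)) + N%:R * (C2 * (N%:R ^- q.-1 / N%:R)))
    = C1 * (N.+1%:R / N%:R) + C2 :> R.
    by field; rewrite !gt_eqF// exprn_gt0.
  have : N.+1%:R / N%:R <= 2 :> R.
    by rewrite ler_pdivrMr// -natrM ler_nat mul2n -addnn -addn1 leq_add2l.
  move=> /(ler_wpM2l C10); rewrite expn1; lra.
pose K := (N * 2 ^ n)%N; have K0 : (0 < K)%N by rewrite muln_gt0 N0 expn_gt0.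
apply: (@ebound_le _ _ _ P _ (N%:R ^+ q.-1 * ((2 ^+ (q - 2)) ^+ n *
   (\sum_(k < K) C3 * (1%:R / K%:R) ^+ q)))); last first.
  do 2 (apply: eboundZ; first by rewrite ?exprn_ge0).
  apply: ebound_sum => i; apply: ebound_Phi.
  - by apply: rvB; apply: rXg => //; exact: ltnW.
  - have := H3 K i 1%N K0; rewrite addn1; apply; exact: ltn_ord.
rewrite sum_cst div1r exprVn.
have two : 0 < 2 ^+ n :> R by rewrite exprn_gt0.
have qE : q = (q - 2).+2 by rewrite -addn2 subnK// ltnW.
have -> : N%:R ^+ q.-1 * ((2 ^+ (q - 2)) ^+ n * (K%:R * (C3 * K%:R ^- q))) = C3 / 2 ^+ n :> R.
  rewrite /K natrM natrX {1 3}qE /= -exprM mulnC exprM.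
  rewrite !exprS exprMn.
  by field; rewrite !gt_eqF// exprn_gt0.
rewrite natrX !exprS.
have -> : 4 * (C1 + C2 + C3) / (2 * (2 * 2 ^+ n)) = (C1 + C2 + C3) / 2 ^+ n by field; rewrite gt_eqF.
by apply: ler_wpM2r; [rewrite invr_ge0 ltW|rewrite lerDr addr_ge0].
Qed.

Variable alpha : R.
Let b : R := 2^-1 - q%:R^-1.
Hypotheses (alpha0 : 0 <= alpha) (alphab : alpha <= b).

Let qR : 0 < q%:R :> R. Proof. by rewrite ltr0n. Qed.

Let b_gt0 : 0 < b.
Proof.
by rewrite /b subr_gt0 ltf_pV2 ?posrE// ltr_nat.
Qed.

Let b_le1 : b <= 1.
Proof.
rewrite /b lerBlDr; have : 0 < q%:R^-1 :> R by rewrite invr_gt0.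
lra.
Qed.

Let rho : R := 2^-1 `^ b.

(** [2 q b = q - 2]: the weight in [dyadic_terms] exactly cancels the decay allowed by chaining. *)
Let rhoX : rho ^+ (2 * q) = (2 ^+ (q - 2))^-1.
Proof.
rewrite /rho -powR_mulrn ?powR_ge0// -powRrM -exprVn -powR_mulrn//.
congr (_ `^ _); rewrite natrM natrB; last exact: ltnW.
by rewrite /b; field; rewrite gt_eqF.
Qed.

Let C : R := 1 + 2 / (1 - rho).

Let C_ge0 : 0 <= C.
Proof.
rewrite /C addr_ge0// divr_ge0// subr_ge0 ltW//.
rewrite /rho -[ltRHS](_ : 1 `^ b = 1); last by rewrite powR1.
by apply: gt0_ltr_powR; rewrite ?nnegrE//; lra.
Qed.

Let B : R := d.+1%:R * ((4 * C + 4) * (1 + T^-1 `^ alpha)).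

(** Each single level is at most [S], so one number bounds all node errors, all steps of the scheme
    and, up to [rho ^+ n], all dyadic increments of [X]. These are the hypotheses of the path
    lemmas, applied coordinate by coordinate. *)
Lemma holder_norm_level N w : (0 < N)%N ->
  let S := (\sum_(0 <= n <oo) (level N n w)%:E)%E in (S < +oo)%E ->
  (holder_norm T alpha (fun t => X t w - Y N t w)%R <=
   (B * N%:R `^ alpha * (fine S / N%:R ^+ q.-1) `^ (2 * q)%:R^-1)%:E)%E.
Proof.
move=> N0 S Soo; set s := fine S.
have S0 : (0 <= S)%E by apply: nneseries_ge0 => n _ _; rewrite lee_fin level_ge0.
have s0 : 0 <= s by rewrite fine_ge0.
have NR : 0 < N%:R :> R by rewrite ltr0n.
have N1 : 1 <= N%:R :> R by rewrite ler1n.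
have Nq : 0 < N%:R ^+ q.-1 :> R by rewrite exprn_gt0.
have levelS n : level N n w <= s.
  rewrite -lee_fin /s fineK ?ge0_fin_numE//.
  by apply: (term_le_series (V := fun n => level N n w)) => k; exact: level_ge0.
set v := s / N%:R ^+ q.-1; have v0 : 0 <= v by rewrite divr_ge0// ltW.
have q20 : (2 * q)%:R != 0 :> R by rewrite pnatr_eq0 muln_eq0 negb_or -!lt0n q0.
set A := v `^ _; have A0 : 0 <= A by exact: powR_ge0.
have AX : A ^+ (2 * q) = v.
  by rewrite -powR_mulrn// /A -powRrM mulVf// powRr1.
have rho0 : 0 < rho by rewrite powR_gt0.
have node : node_terms N w <= v by rewrite ler_pdivlMr// mulrC; exact: (levelS 0%N).
have dyad n : dyadic_terms N n w <= v by rewrite ler_pdivlMr// mulrC; exact: (levelS n.+1).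
have sumPhi (k : nat) (f : 'I_k -> 'cV[R]_d) i : Phi q (f i) <= \sum_(j < k) Phi q (f j).
  by rewrite (bigD1 i)//= lerDl; apply: sumr_ge0 => j _; exact: Phi_ge0.
have sumPhi0 (k : nat) (f : 'I_k -> 'cV[R]_d) : 0 <= \sum_(j < k) Phi q (f j).
  by apply: sumr_ge0 => j _; exact: Phi_ge0.
have z_node i c : (i <= N)%N -> `|X (grid N i) w c 0 - Y N (grid N i) w c 0| <= A.
  move=> iN; have := @coord_le_root R q d (X (grid N i) w - euler N i w) A c q0 A0.
  rewrite interpolation_node// !mxE; apply; rewrite AX; apply: le_trans node.
  rewrite -ltnS in iN.
  apply: le_trans (sumPhi _ (fun i : 'I_N.+1 => X (grid N i) w - euler N i w) (Ordinal iN)) _.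
  by rewrite lerDl.
have y_step i c : (i < N)%N ->
    `|Y N (grid N i.+1) w c 0 - Y N (grid N i) w c 0| <= A.
  move=> iN; have := @coord_le_root R q d (euler N i.+1 w - euler N i w) A c q0 A0.
  rewrite !interpolation_node ?(ltnW iN)// !mxE; apply; rewrite AX; apply: le_trans node.
  apply: le_trans (sumPhi _ (fun i : 'I_N => euler N i.+1 w - euler N i w) (Ordinal iN)) _.
  by rewrite lerDr.
have x_dyadic c n k : (k < N * 2 ^ n)%N ->
    `|X (grid (N * 2 ^ n) k.+1) w c 0 - X (grid (N * 2 ^ n) k) w c 0| <= A * rho ^+ n.
  move=> kn; have Ar0 : 0 <= A * rho ^+ n by rewrite mulr_ge0// exprn_ge0// ltW.
  have := @coord_le_root R q d (X (grid (N * 2 ^ n) k.+1) w - X (grid (N * 2 ^ n) k) w) _ c q0 Ar0.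
  rewrite !mxE; apply; rewrite exprMn AX exprAC rhoX exprVn ler_pdivlMr; last first.
    by rewrite !exprn_gt0.
  apply: le_trans (dyad n); rewrite mulrC ler_pM2l ?exprn_gt0//.
  exact: (sumPhi _ (fun k : 'I_(N * 2 ^ n) =>
    X (grid (N * 2 ^ n) k.+1) w - X (grid (N * 2 ^ n) k) w) (Ordinal kn)).
have xc c := within_continuous_coord (i := c) (@hXc w).
have y_linear c i t (iN : (i < N)%N) (ti : grid N i <= t <= grid N i.+1) :=
  interpolation_linear w c N0 iN ti.
have supX c := path_sup_le T0 alpha0 alphab b_gt0 b_le1 N0 A0 (xc c) (x_dyadic c)
  (y_linear c) (fun i => y_step i c) (fun i => z_node i c).
have holX c := path_holder_le T0 alpha0 alphab b_gt0 b_le1 N0 A0 (xc c) (x_dyadic c)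
  (y_linear c) (fun i => y_step i c) (fun i => z_node i c).
rewrite -/rho -/C in supX holX.
have M0 : 0 <= (2 * C + 2) * A by rewrite mulr_ge0// addr_ge0// mulr_ge0.
have K0 : 0 <= (4 * C + 4) * A * (N%:R / T) `^ alpha.
  by rewrite mulr_ge0 ?powR_ge0// mulr_ge0// addr_ge0// mulr_ge0.
apply: le_trans (holder_norm_le (ltW T0) M0 K0 _ _) _.
- by move=> t c tT; rewrite !mxE; exact: supX.
- move=> u t c uT tT; rewrite !mxE; apply: le_trans (holX c u t uT tT) _.
  by rewrite powRM ?divr_ge0 ?(ltW T0)// [X in _ <= X]mulrAC mulrA.
rewrite lee_fin /B -!mulrA; apply: ler_wpM2l => //.
have Na : 1 <= N%:R `^ alpha.
  by rewrite -[leLHS](powRr0 N%:R); apply: ler_powR.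
rewrite powRM ?invr_ge0 ?(ltW T0)//.
have T_ge0 : 0 <= T^-1 `^ alpha by exact: powR_ge0.
have -> : (4 * C + 4) * ((1 + T^-1 `^ alpha) * (N%:R `^ alpha * A)) =
   (4 * C + 4) * A * N%:R `^ alpha + (4 * C + 4) * (A * (N%:R `^ alpha * T^-1 `^ alpha)) by ring.
rewrite lerD2r; apply: (@le_trans _ _ ((4 * C + 4) * A)); last first.
  by rewrite ler_peMr// mulr_ge0// addr_ge0// mulr_ge0.
by apply: ler_wpM2r => //; move: C_ge0; lra.
Qed.

Lemma holder_error_moment (p eps : R) : 1 <= p -> p <= (2 * q)%:R -> (2 * q)%:R^-1 <= eps ->
  exists D : R, forall N, (0 < N)%N ->
  ((N%:R `^ (2^-1 - alpha - eps))%:E *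
   (\int[P]_w (holder_norm T alpha (fun t => (X t w - Y N t w)%R)) `^ p) `^ p^-1 <= D%:E)%E.
Proof.
move=> p1 pq qeps; have [D D0 HD] := level_moment.
have p0 : 0 < p by exact: lt_le_trans p1.
have B0 : 0 < B.
  apply: mulr_gt0 => //; apply: mulr_gt0; first by rewrite ltr_wpDl// mulr_ge0.
  by rewrite ltr_pwDl// powR_ge0.
exists (B * (1 + D) `^ p^-1) => N N0.
have NR : 0 < N%:R :> R by rewrite ltr0n.
have N1 : 1 <= N%:R :> R by rewrite ler1n.
pose th : R := (2 * q)%:R^-1.
have th0 : 0 < th by rewrite invr_gt0 ltr0n muln_gt0 q0.
pose kap := B * N%:R `^ alpha * (N%:R ^+ q.-1)^-1 `^ th.
have kap0 : 0 < kap.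
  apply: mulr_gt0; first by apply: mulr_gt0 => //; exact: powR_gt0.
  by apply: powR_gt0; rewrite invr_gt0 exprn_gt0.
pose S w := (\sum_(0 <= n <oo) (level N n w)%:E)%E.
have S0 w : (0 <= S w)%E by apply: nneseries_ge0 => n _ _; rewrite lee_fin level_ge0.
have Hp w : (holder_norm T alpha (fun t => (X t w - Y N t w)%R) `^ p <= (kap `^ p)%:E * (1%:E + S w))%E.
  (* Where the series diverges the right-hand side is infinite, so the majorant holds at every
     [w]. *)
  have [Soo|] := ltP (S w) +oo%E; last first.
    rewrite leye_eq => /eqP ->; rewrite addey// gt0_muley ?leey// lte_fin.
    exact: powR_gt0.
  have hn0 := holder_norm_ge0 alpha (fun t => (X t w - Y N t w)%R) T0.
  have Hh := holder_norm_level N0 Soo.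
  rewrite /= -/(S w) in Hh; set s := fine (S w) in Hh.
  have s0 : 0 <= s by rewrite fine_ge0.
  have sE : S w = s%:E by rewrite /s fineK// ge0_fin_numE.
  have ks : B * N%:R `^ alpha * (s / N%:R ^+ q.-1) `^ th = kap * s `^ th.
    by rewrite powRM ?invr_ge0 ?exprn_ge0// /kap; ring.
  rewrite ks in Hh.
  have ks0 : 0 <= kap * s `^ th by rewrite mulr_ge0 ?powR_ge0// ltW.
  apply: (@le_trans _ _ ((kap * s `^ th) `^ p)%:E).
    rewrite -poweR_EFin; apply: gt0_ler_poweR => //; first exact: ltW.
    - by rewrite in_itv/= hn0 leey.
    - by rewrite in_itv/= lee_fin ks0 leey.
  rewrite sE -EFinD -EFinM lee_fin powRM ?powR_ge0 ?(ltW kap0)//.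
  apply: ler_wpM2l; first exact: powR_ge0.
  (* [s ^ (th * p) <= 1 + s] replaces Jensen's inequality. *)
  rewrite -powRrM; have thp1 : th * p <= 1 by rewrite mulrC ler_pdivrMr ?mul1r// ltr0n muln_gt0 q0.
  have [s1|/ltW s1] := leP s 1.
    apply: (@le_trans _ _ 1); last by rewrite lerDl.
    rewrite -[leRHS](_ : 1 `^ (th * p) = 1); last by rewrite powR1.
    by apply: ge0_ler_powR; rewrite ?nnegrE// mulr_ge0// ltW.
  by apply: le_trans (ler1_powR s1 thp1) _; rewrite lerDr.
have D1 : 0 <= 1 + D by rewrite addr_ge0.
have int : (\int[P]_w (holder_norm T alpha (fun t => (X t w - Y N t w)%R)) `^ p <= (kap `^ p * (1 + D))%:E)%E.
  apply: (@le_trans _ _ ((\int[P]_w ((kap `^ p)%:E * (1%:E + S w)))%E)).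
    by apply: ge0_le_integral_nonmeas => w; [exact: poweR_ge0|exact: Hp].
  rewrite ge0_integralZl//; last 3 first.
  - apply: emeasurable_funD => //; apply: ge0_emeasurable_sum => [n w _ _|n _].
      by rewrite lee_fin level_ge0.
    by have [mV _ _] := HD N n N0; exact/measurable_EFinP.
  - by move=> w _; rewrite adde_ge0.
  - by rewrite lee_fin powR_ge0.
  rewrite [X in (_ <= X)%E]EFinM; apply: lee_wpmul2l; first by rewrite lee_fin powR_ge0.
  by apply: ebound_series => // n; exact: HD.
apply: (@le_trans _ _ ((N%:R `^ (2^-1 - alpha - eps))%:E * ((kap `^ p * (1 + D)) `^ p^-1)%:E)%E).
  apply: lee_wpmul2l; first by rewrite lee_fin powR_ge0.
  rewrite -poweR_EFin; apply: gt0_ler_poweR => //.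
  - by rewrite invr_ge0 ltW.
  - by rewrite in_itv/= leey andbT; apply: integral_ge0 => w _; exact: poweR_ge0.
  - by rewrite in_itv/= leey andbT lee_fin mulr_ge0 ?powR_ge0.
rewrite -EFinM lee_fin powRM ?powR_ge0// -powRrM divff ?gt_eqF// powRr1 ?(ltW kap0)//.
rewrite mulrA; apply: ler_wpM2r; first exact: powR_ge0.
have -> : N%:R `^ (2^-1 - alpha - eps) * kap =
  B * (N%:R `^ (2^-1 - alpha - eps) * N%:R `^ alpha * (N%:R ^+ q.-1)^-1 `^ th).
  by rewrite /kap; ring.
rewrite ger_pMr//.
have -> : (N%:R ^+ q.-1)^-1 = N%:R `^ (- q.-1%:R) :> R by rewrite powRN powR_mulrn ?ltW.
have Nne (x : R) : N%:R `^ x != 0 by rewrite gt_eqF// powR_gt0.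
have Npos : N%:R != 0 :> R by rewrite gt_eqF.
rewrite -powRrM -!powRD; do ?[by rewrite Npos implybT].
rewrite -[leRHS](powRr0 N%:R); apply: ler_powR => //.
(* The total exponent of [N]: since [(q - 1) / (2 q) = 1/2 - 1/(2 q)], what remains is
   [1/(2 q) - eps], which is nonpositive by assumption. *)
have -> : 2^-1 - alpha - eps + alpha + - q.-1%:R * th = th - eps.
  rewrite /th -{2 3}(prednK q0) natrM -natr1; field.
  by rewrite nat1r pnatr_eq0.
by rewrite subr_le0.
Qed.

End exponents.
End holder_error.

Theorem corollary2p12 (R : realType) (T : R) (hT : 0 < T)
  (d m : nat) (hd : (0 < d)%N) (hm : (0 < m)%N)
  (disp : measure_display) (Omega : measurableType disp)
  (P : probability Omega R)
  (F : R -> set (set Omega)) (hF : normal_filtration P T F)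
  (W : R -> Omega -> 'cV[R]_m)
  (hW : standard_brownian_motion P T F W) (hWc : continuous_paths T W)
  (mu : 'cV[R]_d -> 'cV[R]_d) (hmu : globally_lipschitz mu)
  (sigma : 'cV[R]_d -> 'M[R]_(d, m)) (hsigma : globally_lipschitz sigma)
  (X : R -> Omega -> 'cV[R]_d)
  (hXa : adapted T F X) (hXc : continuous_paths T X)
  (hX0 : forall p : R, 1 <= p ->
     (\int[P]_w (enorm (X 0 w) `^ p)%:E < +oo)%E)
  (hX : solves_sde P T F W mu sigma X)
  (Y : nat -> R -> Omega -> 'cV[R]_d)
  (hY0 : forall N : nat, (0 < N)%N -> forall w, Y N 0 w = X 0 w)
  (hY : forall N n : nat, (0 < N)%N -> (n < N)%N ->
     forall t : R, n%:R * T / N%:R <= t -> t <= n.+1%:R * T / N%:R ->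
     forall w,
       Y N t w =
         Y N (n%:R * T / N%:R) w
         + (t - n%:R * T / N%:R) *: mu (Y N (n%:R * T / N%:R) w)
         + (t * N%:R / T - n%:R) *:
             (sigma (Y N (n%:R * T / N%:R) w)
              *m (W (n.+1%:R * T / N%:R) w - W (n%:R * T / N%:R) w))) :
  forall alpha eps p : R, 0 <= alpha -> alpha < 2^-1 -> 0 < eps -> 1 <= p ->
    (ereal_sup
       [set (N%:R `^ (2^-1 - alpha - eps))%:E *
            (\int[P]_w
               (holder_norm T alpha (fun t => (X t w - Y N t w)%R)) `^ p)
            `^ p^-1
       | N in [set N : nat | (0 < N)%N]] < +oo)%E.
Proof.
move=> alpha eps p alpha0 alphah eps0 p1.
have [hfilt _ _] := hF.
have gap0 : 0 < 2^-1 - alpha by rewrite subr_gt0.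
(* [q] exceeds the inverse of [1/2 - alpha], the inverse of [eps], and [p]: this gives [alpha <= b],
   [1/(2 q) <= eps] and [p <= 2 q]. The three successors ensure [2 < q]. *)
pose q := (Num.truncn ((2^-1 - alpha)^-1 + eps^-1 + p)).+3.
have qbig : (2^-1 - alpha)^-1 + eps^-1 + p < q%:R.
  by apply: lt_le_trans (truncnS_gt _) _; rewrite ler_nat /q !ltnS ltnW.
have a0 : 0 < (2^-1 - alpha)^-1 by rewrite invr_gt0.
have b0 : 0 < eps^-1 by rewrite invr_gt0.
have p0 : 0 < p by exact: lt_le_trans p1.
have q0 : 0 < q%:R :> R by rewrite ltr0n.
have alphab : alpha <= 2^-1 - q%:R^-1.
  have : q%:R^-1 <= 2^-1 - alpha by rewrite invf_ple ?posrE//; move: qbig b0 p0; lra.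
  by lra.
have p2q : p <= (2 * q)%:R by rewrite natrM; move: qbig a0 b0 p0; lra.
have qeps : (2 * q)%:R^-1 <= eps.
  rewrite invf_ple ?posrE// ?ltr0n ?muln_gt0// natrM; move: qbig a0 p0; lra.
have [D HD] := holder_error_moment hT hfilt hW hmu hsigma hXa hXc hX hX0 hY0 hY
  (isT : (2 < q)%N) alpha0 alphab p1 p2q qeps.
apply: le_lt_trans (ltry D); apply: ge_ereal_sup => _ [N N0 <-].
exact: HD.
Qed.
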